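(* Let $n\ge 3$, $\gamma\in\mathbb{R}$, $\alpha>1$, $s\in\mathbb{R}$, $q\in[1,\infty]$, $r\in(0,\infty]$ and $T>0$. Assume $$\gamma>-\min(2,n),\qquad \alpha\ge \max\Big(1,1+\frac{\gamma}{n}\Big),\qquad \frac{\gamma}{\alpha-1}< s\le n,\qquad \alpha\le q\le\infty,\qquad 0<r\le\infty,\qquad \frac sn+\frac1q>0,$$ and assume moreover the exponent condition: either $\frac sn+\frac1q<1$, or $\frac sn+\frac1q=1$ and $r\le1$. Put $q_c=\frac{n(\alpha-1)}{2+\gamma}$ and $Q_c=\frac{n\alpha}{n+\gamma}$. Suppose that either (i) $\frac sn+\frac1q=\frac1{q_c}<\frac1{Q_c}$, $q<\infty$ and $r=\infty$; or (ii) $\frac sn+\frac1q=\frac1{q_c}=\frac1{Q_c}$ and either ($q<\infty$ and $r\le\alpha-1$) or ($q\le\infty$ and $r\le\min(1,\alpha-1)$). Then for any initial datum $u_0\in\dot{\mathcal K}^s_{q,r}(\mathbb{R}^n)$, solutions of the Hardy–Hénon parabolic equation in $C([0,T];\dot{\mathcal K}^s_{q,r}(\mathbb{R}^n))$ are unique: if $u_1,u_2\in C([0,T];\dot{\mathcal K}^s_{q,r}(\mathbb{R}^n))$ are both solutions with initial datum $u_0$, then $u_1=u_2$ on $[0,T]$.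
   Context: For $j\in\mathbb{Z}$ let $A_j=\{x\in\mathbb{R}^n: 2^{j-1}\le|x|<2^j\}$. For $s\in\mathbb{R}$ and $0<q,r\le\infty$, the homogeneous Herz space $\dot K^s_{q,r}(\mathbb{R}^n)$ is the space of measurable $f$ with finite quasi-norm $\|f\|_{\dot K^s_{q,r}}=\big(\sum_{j\in\mathbb{Z}}[2^{js}\|f\chi_{A_j}\|_{L^q}]^r\big)^{1/r}$ (supremum over $j$ if $r=\infty$). $\dot{\mathcal K}^s_{q,r}(\mathbb{R}^n)$ denotes the closure of $C_c^\infty(\mathbb{R}^n)$ in $\dot K^s_{q,r}(\mathbb{R}^n)$. The heat semigroup is $e^{t\Delta}f(x)=(4\pi t)^{-n/2}\int_{\mathbb{R}^n}e^{-|x-y|^2/(4t)}f(y)\,dy$. The Hardy–Hénon parabolic equation is $\partial_t u-\Delta u=|x|^\gamma|u|^{\alpha-1}u$ on $(0,\infty)\times\mathbb{R}^n$, $u(0)=u_0$; a solution on $[0,T]$ with initial datum $u_0$ means a function $u$ with $u(0)=u_0$ satisfying $u(t)=e^{t\Delta}u_0+\int_0^t e^{(t-\tau)\Delta}\big[|\cdot|^\gamma|u(\tau)|^{\alpha-1}u(\tau)\big]\,d\tau$ for $t\in(0,T]$. *)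

(* Defs.v *)
From mathcomp Require Import all_boot all_order all_algebra.
From mathcomp Require Import all_classical all_reals all_analysis.
Set Implicit Arguments. Unset Strict Implicit. Unset Printing Implicit Defensive.
Import Order.TTheory GRing.Theory Num.Theory.
Local Open Scope classical_set_scope.
Local Open Scope ring_scope.

(* Points of R^n are n-tuples of reals (with the product = Borel sigma-algebra). *)

Definition tsub (R : realType) (n : nat) (x y : n.-tuple R) : n.-tuple R :=
  [tuple tnth x i - tnth y i | i < n].

Definition enorm (R : realType) (n : nat) (x : n.-tuple R) : R :=
  Num.sqrt (\sum_(i < n) tnth x i ^+ 2).

(* Lebesgue integral over R^n, realised as the iterated one-dimensional
   Lebesgue integral (equal to the n-dimensional Lebesgue integral for
   measurable functions that are nonnegative or integrable, by Fubini--Tonelli). *)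
Fixpoint iint (R : realType) (n : nat) : (n.-tuple R -> \bar R) -> \bar R :=
  match n return (n.-tuple R -> \bar R) -> \bar R with
  | 0 => fun f => f [tuple]
  | n'.+1 => fun f =>
      (\int[@lebesgue_measure R]_x iint (fun y : n'.-tuple R => f [tuple of x :: y]))%E
  end.

Definition rn_null (R : realType) (n : nat) (A : set (n.-tuple R)) : Prop :=
  measurable A /\ iint (fun x => (\1_A x : R)%:E) = 0%E.

Definition ae_rn (R : realType) (n : nat) (P : n.-tuple R -> Prop) : Prop :=
  exists N : set (n.-tuple R), rn_null N /\ forall x, ~ N x -> P x.

Definition esssup_rn (R : realType) (n : nat) (h : n.-tuple R -> R) : \bar R :=
  ereal_inf [set M : \bar R | ae_rn (fun x => ((h x)%:E <= M)%E)].

Definition Lqnorm (R : realType) (n : nat) (q : \bar R) (g : n.-tuple R -> R) : \bar R :=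
  match q with
  | EFin p => ((iint (fun x => (`|g x| `^ p)%:E)) `^ p^-1)%E
  | +oo%E => esssup_rn (fun x => `|g x|)
  | -oo%E => 0%E
  end.

Definition annulus (R : realType) (n : nat) (j : int) : set (n.-tuple R) :=
  [set x | (2 : R) ^ (j - 1) <= enorm x < (2 : R) ^ j].

Definition herz (R : realType) (n : nat) (s : R) (q r : \bar R)
    (f : n.-tuple R -> R) : \bar R :=
  let loc := fun j : int =>
    (((2 : R) `^ (j%:~R * s))%:E * Lqnorm q (fun x => (f x * \1_(@annulus R n j) x)%R))%E in
  match r with
  | EFin p => ((\esum_(j in [set: int]) (loc j `^ p)) `^ p^-1)%E
  | +oo%E => ereal_sup (range loc)
  | -oo%E => 0%E
  end.

Definition in_herz (R : realType) (n : nat) (s : R) (q r : \bar R)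
    (f : n.-tuple R -> R) : Prop :=
  measurable_fun [set: n.-tuple R] f /\ (herz s q r f < +oo)%E.

Definition tshift (R : realType) (n : nat) (x : n.-tuple R) (i : 'I_n) (h : R)
    : n.-tuple R :=
  [tuple tnth x k + (if k == i then h else 0) | k < n].

Definition cont_rn (R : realType) (n : nat) (g : n.-tuple R -> R) : Prop :=
  forall x (e : R), 0 < e -> exists2 d : R, 0 < d &
    forall y, enorm (tsub y x) < d -> `|g y - g x| < e.

Fixpoint iterP (R : realType) (n : nat) (ids : seq 'I_n) (g : n.-tuple R -> R)
    : n.-tuple R -> R :=
  match ids with
  | [::] => g
  | i :: ids' => fun x => derive1 (fun h : R => iterP ids' g (tshift x i h)) 0
  end.

Definition smooth_rn (R : realType) (n : nat) (f : n.-tuple R -> R) : Prop :=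
  forall ids : seq 'I_n,
    cont_rn (iterP ids f) /\
    forall x i, derivable (fun h : R => iterP ids f (tshift x i h)) 0 1.

Definition Cc_infty (R : realType) (n : nat) (f : n.-tuple R -> R) : Prop :=
  smooth_rn f /\ exists M : R, forall x, M < enorm x -> f x = 0.

Definition in_Kcal (R : realType) (n : nat) (s : R) (q r : \bar R)
    (f : n.-tuple R -> R) : Prop :=
  in_herz s q r f /\
  forall e : R, 0 < e -> exists phi, Cc_infty phi /\
    (herz s q r (fun x => (f x - phi x)%R) < e%:E)%E.

Definition cont_Kcal (R : realType) (n : nat) (s : R) (q r : \bar R) (T : R)
    (u : R -> n.-tuple R -> R) : Prop :=
  (forall t, 0 <= t <= T -> in_Kcal s q r (u t)) /\
  forall t0, 0 <= t0 <= T -> forall e : R, 0 < e -> exists2 d : R, 0 < d &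
    forall t, 0 <= t <= T -> `|t - t0| < d ->
      (herz s q r (fun x => (u t x - u t0 x)%R) < e%:E)%E.

Definition heat_kernel (R : realType) (n : nat) (t : R) (z : n.-tuple R) : R :=
  (4 * pi * t) `^ (- (n%:R / 2)) * expR (- (enorm z ^+ 2) / (4 * t)).

Definition heat (R : realType) (n : nat) (t : R) (f : n.-tuple R -> R)
    (x : n.-tuple R) : \bar R :=
  iint (fun y => (heat_kernel t (tsub x y) * f y)%:E).

Definition NL (R : realType) (n : nat) (gamma alpha : R) (v : n.-tuple R -> R)
    (y : n.-tuple R) : R :=
  enorm y `^ gamma * (`|v y| `^ (alpha - 1) * v y).

(* u is a solution on [0,T] with initial datum u0 (Duhamel formulation);
   the integrals in the Duhamel formula are required to converge absolutely *)
Definition is_solution (R : realType) (n : nat) (gamma alpha T : R)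
    (u0 : n.-tuple R -> R) (u : R -> n.-tuple R -> R) : Prop :=
  ae_rn (fun x => u 0 x = u0 x) /\
  forall t, 0 < t <= T -> ae_rn (fun x =>
    (iint (fun y => (`|heat_kernel t (tsub x y) * u0 y|)%:E) < +oo)%E /\
    (\int[@lebesgue_measure R]_(tau in `[0%R, t])
        iint (fun y => (`|heat_kernel (t - tau) (tsub x y) * NL gamma alpha (u tau) y|)%:E)
      < +oo)%E /\
    (u t x)%:E = (heat t u0 x +
       \int[@lebesgue_measure R]_(tau in `[0%R, t])
          heat (t - tau) (NL gamma alpha (u tau)) x)%E).

Definition qinv (R : realType) (q : \bar R) : R :=
  match q with EFin p => p^-1 | _ => 0 end.

(* Main.v *)
(* Let f = ||x|^gamma (|u1|^(alpha-1) u1 - |u2|^(alpha-1) u2)|.  Duhamel's formula gives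
   |u1 - u2|(t) <= int_0^t e^((t-tau)Delta) f(tau) dtau, hence f(t) is at most a constant times
   (V1 + V2)(t) int_0^t e^((t-tau)Delta) f(tau) dtau with V_k = |x|^gamma |u_k|^(alpha-1).
   Integrate this over the annulus A_j, of radius L = 2^j, and move the heat semigroup onto
   V_k 1_(A_j).  With U_j the j-th term of the Herz norm, Hoelder's inequality and the decay of
   the heat kernel bound e^(r Delta)(V_k 1_(A_j)) by
     U_j(u_k)^(alpha-1) L^-2 min((r/L^2)^-a, (r/L^2)^-nu) (1 + |y|/L)^(-2 mu),
   with a < 1 < nu and no further power of L because s/n + 1/q is critical.  Over lags
   r <= d the time integral of the kernel is at most a constant times min(1, (d/L^2)^eps).
   For d small, the factors U_j(u_k)^(alpha-1) min(1, (d/L^2)^eps) are small, in l^oo (case (i),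
   by density of test functions, which vanish at the scale L -> 0 since s/n + 1/q > 0) or in l^1
   (case (ii), as r <= alpha - 1).  So the pairings of f with the weights (1 + |y|/L)^(-2 mu),
   once known to vanish before t0 and to be O(L^beta), beta = gamma + n - alpha (s + n/q),
   on [t0, t0 + d), are at most half that bound, hence vanish there.  Summing annuli against the
   weights costs nothing if beta = 0 = mu (case (ii)) and needs 0 < beta < 2 mu in case (i). *)
Require Import Defs.
From HB Require Import structures.
From mathcomp Require Import all_boot all_order all_algebra.
From mathcomp Require Import all_classical all_reals all_analysis.
From mathcomp Require Import measurable_realfun ring lra.
Import Order.TTheory GRing.Theory Num.Theory.
Import numFieldNormedType.Exports.
Local Open Scope classical_set_scope.
Local Open Scope ring_scope.
Set Implicit Arguments.
Unset Strict Implicit.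
Unset Printing Implicit Defensive.

(** The exponents come from the critical relation (alpha - 1)(s + n/q) = 2 + gamma. It turns
    gamma/(alpha - 1) < s into a = (alpha - 1) n/(2q) < 1, which makes short lags integrable. Long
    lags need nu = n/2 - mu > 1; the relation also gives beta = n - 2 - (s + n/q) < n - 2, so that a
    mu with beta < 2 mu < n - 2 is available, and with mu = 0 what is left is n > 2. The contraction
    runs on pairings with weights because the flow of a function living on one annulus is spread
    over all of space. Two obstacles shape the rest. A path is continuous into a Herz space, but
    nothing is known of its joint measurability in (tau, x), while Tonelli's theorem is applied in
    these variables; joint measurability is recovered for heat flows only, as limits of flows of
    paths that are piecewise constant in time. And [iint] is an iterated integral that has a value
    for every function, measurable or not: it has to be tied to a measure, and comparisons around it
    must not presuppose measurability. *)

Section nonmeasurable_integral.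
Local Open Scope ereal_scope.
Context d (X : measurableType d) (R : realType) (mu : {measure set X -> \bar R}).
Implicit Types (D N : set X) (f g : X -> \bar R).

(** The integral of a nonnegative function is a supremum over the simple functions below it, hence
    monotone whether or not the integrands are measurable. *)
Lemma ge0_le_integral_nonmeas D f g : (forall x, D x -> 0 <= f x) ->
  (forall x, D x -> f x <= g x) ->
  \int[mu]_(x in D) f x <= \int[mu]_(x in D) g x.
Proof.
move=> f0 fg; rewrite (integral_mkcond D) [leRHS]integral_mkcond.
have h1 x : 0 <= (f \_ D) x by apply: erestrict_ge0.
have h2 x : (f \_ D) x <= (g \_ D) x by apply: lee_restrict.
rewrite !ge0_integralTE//; last by move=> x; exact: le_trans (h2 x).
apply: le_ereal_sup => _ [h hf <-]; exists h => //= x.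
exact: le_trans (hf x) (h2 x).
Qed.

(** A possibly nonmeasurable [f] is squeezed between the two measurable functions equal to [g] off
    [N] and to 0, respectively +oo, on [N]; both have the integral of [g]. *)
Let ae_modT N f g : measurable N -> mu N = 0 -> measurable_fun setT g ->
  (forall x, 0 <= f x) -> (forall x, 0 <= g x) ->
  (forall x, ~ N x -> f x = g x) -> \int[mu]_x f x = \int[mu]_x g x.
Proof.
move=> mN N0 mg f0 g0 fg.
have mNc : measurable (~` N) by exact: measurableC.
pose gl := g \_ (~` N); pose gu := gl \+ (cst +oo \_ N).
have mgl : measurable_fun setT gl.
  by apply/(measurable_restrictT g mNc); exact: measurable_funTS.
have mgu : measurable_fun setT gu.
  by apply: emeasurable_funD => //; exact/(measurable_restrictT _ mN).
have gl0 x : 0 <= gl x by apply: erestrict_ge0 => y _; exact: g0.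
have gu0 x : 0 <= gu x.
  by apply: adde_ge0 => //; apply: erestrict_ge0 => y _; rewrite leey.
have glN x : ~ N x -> gl x = g x by move=> Nx; rewrite /gl patchE mem_set.
have guN x : ~ N x -> gu x = g x.
  by move=> Nx; rewrite /gu /= glN // patchE memNset// adde0.
have E1 : \int[mu]_x gl x = \int[mu]_x g x.
  apply: ge0_ae_eq_integral => //; exists N; split => // x /= nx.
  by apply: contrapT => Nx; apply: nx => _; rewrite glN.
have E2 : \int[mu]_x gu x = \int[mu]_x g x.
  apply: ge0_ae_eq_integral => //; exists N; split => // x /= nx.
  by apply: contrapT => Nx; apply: nx => _; rewrite guN.
apply/eqP; rewrite eq_le -{1}E2 -E1; apply/andP; split.
  apply: ge0_le_integral_nonmeas => // x _.
  have [Nx|Nx] := pselect (N x); last by rewrite guN// fg.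
  rewrite /gu /= [X in _ <= _ + X]patchE mem_set// addey ?leey//.
  by rewrite -ltNye (lt_le_trans _ (gl0 x)).
apply: ge0_le_integral_nonmeas => // x _.
have [Nx|Nx] := pselect (N x); last by rewrite glN// fg.
by rewrite /gl patchE memNset//= => /(_ Nx).
Qed.

Lemma eq_integral_off_null D N f g : measurable D -> measurable N -> mu N = 0 ->
  measurable_fun D g -> (forall x, D x -> ~ N x -> f x = g x) ->
  \int[mu]_(x in D) f x = \int[mu]_(x in D) g x.
Proof.
move=> mD mN N0 mg fg; rewrite (integral_mkcond D) [RHS]integral_mkcond.
have mg' : measurable_fun setT (g \_ D) by apply/(measurable_restrictT g mD).
have fg' x : ~ N x -> (f \_ D) x = (g \_ D) x.
  move=> Nx; rewrite !patchE; case: ifPn => // /set_mem Dx; exact: fg.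
rewrite integralE [RHS]integralE; congr (_ - _).
  apply: (ae_modT mN N0) => //; first exact: measurable_funepos.
  by move=> x Nx; rewrite !funeposE fg'.
apply: (ae_modT mN N0) => //; first exact: measurable_funeneg.
by move=> x Nx; rewrite !funenegE fg'.
Qed.

End nonmeasurable_integral.

(** * Lebesgue measure on R^n recovered from the iterated integral *)

Lemma iint_scale_prod (R : realType) n (c : R) (g : 'I_n -> R -> R) : 0 <= c ->
  (forall i, measurable_fun setT (g i)) -> (forall i x, 0 <= g i x) ->
  (iint (fun x : n.-tuple R => (c * \prod_(i < n) g i (tnth x i))%:E) =
   c%:E * \prod_(i < n) \int[lebesgue_measure]_x (g i x)%:E)%E.
Proof.
elim: n c g => [|n IH] c g c0 mg g0 /=; first by rewrite !big_ord0 mulr1 mule1.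
transitivity (\int[@lebesgue_measure R]_x ((c%:E * (g ord0 x)%:E) *
    \prod_(i < n) \int[lebesgue_measure]_x (g (lift ord0 i) x)%:E))%E.
  apply: eq_integral => x _.
  rewrite -EFinM -IH; [|by rewrite mulr_ge0|by []|by []].
  congr iint; apply/funext => y; rewrite big_ord_recl /= mulrA.
  rewrite (_ : tnth [tuple of x :: y] ord0 = x)//.
  by congr ((_ * _)%:E); apply: eq_bigr => i _; rewrite tnthS.
have mg0 : measurable_fun setT (fun x : measurableTypeR R => (g ord0 x)%:E).
  by apply/measurable_EFinP; exact: mg.
rewrite ge0_integralZr//; last 3 first.
- exact: measurable_funeM.
- by move=> x _; rewrite mule_ge0 // lee_fin.
- by apply: prode_ge0 => i _; apply: integral_ge0 => x _; rewrite lee_fin.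
rewrite ge0_integralZl//; last by move=> x _; rewrite lee_fin.
by rewrite big_ord_recl muleA.
Qed.

Lemma measurable_cons_pair (R : realType) n :
  measurable_fun setT (fun p : measurableTypeR R * n.-tuple R =>
    [tuple of p.1 :: p.2] : n.+1.-tuple R).
Proof.
exact: (@measurable_cons _ _ (measurableTypeR R * n.-tuple R)%type (measurableTypeR R) fst n snd).
Qed.

(** Exhaustion by the cubes |x_i| <= k, of measure (2k)^n. Sigma-finiteness is what Tonelli's
    theorem asks of this measure when the next coordinate is added. *)
Lemma iint_sigma_finite (R : realType) n (mu : {measure set (n.-tuple R) -> \bar R}) :
  (forall f, measurable_fun setT f -> (forall x, 0 <= f x)%E ->
    iint f = (\int[mu]_x f x)%E) -> sigma_finite setT mu.
Proof.
move=> H.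
pose F (k : nat) := [set x : n.-tuple R | forall i, `|tnth x i| <= k%:R].
have mF k : measurable (F k).
  rewrite (_ : F k = \bigcap_(i in [set: 'I_n])
      ((fun x : n.-tuple R => tnth x i) @^-1` `[- k%:R, k%:R])); last first.
    by apply/seteqP; split => x /= h i; [move=> _|];
      move: (h i); rewrite /= in_itv /= -ler_norml // => /(_ Logic.I).
  apply: fin_bigcap_measurable => //.
  move=> i _; rewrite -[X in measurable X]setTI.
  by apply: (@measurable_tnth _ R n i measurableT); exact: measurable_itv.
exists F.
  apply/seteqP; split => // x _.
  exists (Num.truncn (\sum_(i < n) `|tnth x i|)).+1 => //= i.
  apply: le_trans (ltW (truncnS_gt _)).
  rewrite (bigD1 i)//= lerDl; exact: sumr_ge0.
move=> k; split => //.
rewrite -(setIT (F k)) -integral_indic// -H; last 2 first.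
  by apply/measurable_EFinP; exact: measurable_indic.
  by move=> x; rewrite lee_fin.
rewrite (_ : (fun x => _) = (fun x : n.-tuple R =>
    (1 * \prod_(i < n) \1_(`[- k%:R, k%:R]%classic) (tnth x i) : R)%:E)); last first.
  apply/funext => x; rewrite mul1r; congr EFin; rewrite indicE.
  have [Fx|Fx] := pselect (F k x).
    rewrite mem_set// big1 // => i _.
    by rewrite indicE mem_set //= in_itv /= -ler_norml.
  rewrite memNset//; have [i hi] : exists i, ~ (`|tnth x i| <= k%:R).
    by apply/existsNP.
  by rewrite (bigD1 i)//= indicE memNset ?mul0r//= in_itv /= -ler_norml.
rewrite (@iint_scale_prod R n 1 (fun=> \1_(`[- k%:R, k%:R]%classic)))//.
rewrite mul1e (eq_bigr (fun=> (k%:R - - k%:R)%:E)); last first.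
  move=> i _; rewrite integral_indic //= setIT lebesgue_measure_itv /= lte_fin.
  case: ltP => // h; congr EFin; have := ler0n R k; lra.
by rewrite prodEFin ltry.
Qed.

Section sigma_finite_measure_of.
Context d (X : measurableType d) (R : realType) (m : {measure set X -> \bar R}).

(** An alias of [m] indexed by the proof [sf], to which the sigma-finite structure can be attached
    as an instance. *)
Definition sigma_finite_measure_of (sf : sigma_finite setT m) : set X -> \bar R := m.

Variable sf : sigma_finite setT m.
HB.instance Definition _ := Measure.on (sigma_finite_measure_of sf).
HB.instance Definition _ :=
  Measure_isSigmaFinite.Build d X R (sigma_finite_measure_of sf) sf.

End sigma_finite_measure_of.

(** By induction on the dimension: the product of the one-dimensional measure with the previous one
    is pushed forward by the map that prepends a coordinate, and Tonelli's theorem turns its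
    integral into the iterated one. *)
Lemma lebn_exists (R : realType) n :
  exists mu : {sigma_finite_measure set (n.-tuple R) -> \bar R},
  forall f, measurable_fun setT f -> (forall x, 0 <= f x)%E ->
    iint f = (\int[mu]_x f x)%E.
Proof.
elim: n => [|n [mu H]].
  exists [the {sigma_finite_measure set _ -> \bar R} of \d_([tuple] : 0.-tuple R)] => f mf f0 /=.
  by rewrite integral_dirac// diracT mul1e.
pose lm := (@lebesgue_measure R \x mu)%E.
pose phi (p : measurableTypeR R * n.-tuple R) : n.+1.-tuple R := [tuple of p.1 :: p.2].
have mphi : measurable_fun setT phi by exact: measurable_cons_pair.
pose nu0 := [the measure _ _ of pushforward lm phi].
pose nu : {measure set (n.+1.-tuple R) -> \bar R} := nu0 mphi.
have Hnu f : measurable_fun setT f -> (forall x, 0 <= f x)%E -> iint f = (\int[nu]_x f x)%E.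
  move=> mf f0; rewrite ge0_integral_pushforward//.
  rewrite preimage_setT fubini_tonelli1//=; last exact: (measurableT_comp mf mphi).
  apply: eq_integral => x _; rewrite H//; apply: (measurableT_comp mf).
  exact: (measurableT_comp (@measurable_cons_pair R n) (pair1_measurable x)).
by exists [the {sigma_finite_measure set _ -> \bar R} of
  sigma_finite_measure_of (iint_sigma_finite Hnu)].
Qed.

Definition lebn (R : realType) n := projT1 (cid (lebn_exists R n)).

Section lebn_theory.
Context (R : realType).

Lemma iintE n (f : n.-tuple R -> \bar R) :
  measurable_fun setT f -> (forall x, 0 <= f x)%E -> iint f = (\int[lebn R n]_x f x)%E.
Proof. by rewrite /lebn; case: cid => mu /= H; exact: H. Qed.

Lemma rn_nullP n (A : set (n.-tuple R)) :
  rn_null A <-> measurable A /\ lebn R n A = 0.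
Proof.
have E : measurable A -> iint (fun x => (\1_A x : R)%:E) = lebn R n A.
  move=> mA; rewrite iintE ?integral_indic ?setIT//.
    by apply/measurable_EFinP; exact: measurable_indic.
by split=> -[mA h]; split=> //; [rewrite -E|rewrite E].
Qed.

Lemma ae_rnP n (P : n.-tuple R -> Prop) : ae_rn P <-> {ae lebn R n, forall x, P x}.
Proof.
split=> [[N [/rn_nullP[mN N0] NP]]|[N [mN N0 NP]]].
  by exists N; split => // x /= nPx; apply: contrapT => Nx; apply: nPx; exact: NP.
exists N; split; first exact/rn_nullP.
by move=> x Nx; apply: contrapT => nP; apply: Nx; apply: NP.
Qed.

Lemma lebn_cons n (f : n.+1.-tuple R -> \bar R) :
  measurable_fun setT f -> (forall x, 0 <= f x)%E ->
  (\int[lebn R n.+1]_x f x =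
   \int[@lebesgue_measure R]_x \int[lebn R n]_y f [tuple of x :: y])%E.
Proof.
move=> mf f0; rewrite -iintE//=; apply: eq_integral => x _; rewrite iintE//.
apply: (measurableT_comp mf).
exact: (measurableT_comp (@measurable_cons_pair R n) (pair1_measurable x)).
Qed.

Lemma measurable_lebn_cons n (f : n.+1.-tuple R -> \bar R) :
  measurable_fun setT f -> (forall x, 0 <= f x)%E ->
  measurable_fun setT (fun x : measurableTypeR R => \int[lebn R n]_y f [tuple of x :: y])%E.
Proof.
move=> mf f0.
apply: (@measurable_fun_fubini_tonelli_F _ _ _ _ R (lebn R n)
  (fun p : measurableTypeR R * n.-tuple R => f [tuple of p.1 :: p.2])) => //.
exact: (measurableT_comp mf (@measurable_cons_pair R n)).
Qed.

(** The slices of a signed function are integrable only for almost every first coordinate. Off that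
    null set the induction hypothesis gives the difference of [Fp] and [Fn], the integrals of the
    positive and negative parts; on it the inner [iint] is uncontrolled, hence the appeal to
    [eq_integral_off_null]. *)
Lemma iint_integrable n (f : n.-tuple R -> \bar R) :
  (lebn R n).-integrable setT f -> iint f = (\int[lebn R n]_x f x)%E.
Proof.
elim: n f => [|n IH] f /[dup] fi /integrableP[mf fioo].
  have c0 : iint f = f [tuple] by [].
  have eqf x : f x = f [tuple] by rewrite (tuple0 x).
  have [f0|f0] := leP 0%E (f [tuple]); first by rewrite iintE// => x; rewrite eqf.
  rewrite -[RHS]oppeK -integralN /=; last first.
    have -> : (\int[lebn R 0]_x f^\+ x = 0)%E.
      by apply: integral0_eq => x _; rewrite funeposE eqf max_r// ltW.
    exact: fin_num_adde_defr.
  rewrite -iintE /=; [by rewrite oppeK|exact: measurableT_comp|].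
  by move=> x; rewrite eqf oppe_ge0 ltW.
pose fx (x : R) (y : n.-tuple R) := f [tuple of x :: y].
have mfx x : measurable_fun setT (fx x).
  apply: (measurableT_comp mf).
  exact: (measurableT_comp (@measurable_cons_pair R n) (pair1_measurable x)).
have mfp : measurable_fun setT (f^\+)%E by exact: measurable_funepos.
have mfn : measurable_fun setT (f^\-)%E by exact: measurable_funeneg.
pose Fp x := (\int[lebn R n]_y f^\+ [tuple of x :: y])%E.
pose Fn x := (\int[lebn R n]_y f^\- [tuple of x :: y])%E.
have mFp : measurable_fun setT (Fp : measurableTypeR R -> _) by exact: measurable_lebn_cons.
have mFn : measurable_fun setT (Fn : measurableTypeR R -> _) by exact: measurable_lebn_cons.
have Fp0 x : (0 <= Fp x)%E by exact: integral_ge0.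
have Fn0 x : (0 <= Fn x)%E by exact: integral_ge0.
have /integrableP[_ fpoo] := integrable_funepos measurableT fi.
have /integrableP[_ fnoo] := integrable_funeneg measurableT fi.
have abseI (g : n.+1.-tuple R -> \bar R) : (forall x, 0 <= g x)%E ->
    (\int[lebn R n.+1]_x `|g x| = \int[lebn R n.+1]_x g x)%E.
  by move=> g0; apply: eq_integral => x _; rewrite gee0_abs.
rewrite abseI// in fpoo; rewrite abseI// in fnoo.
have iFp : (@lebesgue_measure R).-integrable setT Fp.
  apply/integrableP; split => //; under eq_integral do rewrite gee0_abs//.
  by rewrite -lebn_cons.
have iFn : (@lebesgue_measure R).-integrable setT Fn.
  apply/integrableP; split => //; under eq_integral do rewrite gee0_abs//.
  by rewrite -lebn_cons.
have [Np [mNp Np0 NpP]] := integrable_ae measurableT iFp.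
have [Nn [mNn Nn0 NnP]] := integrable_ae measurableT iFn.
rewrite /= (@eq_integral_off_null _ _ _ _ _ (Np `|` Nn) _ (Fp \- Fn)%E)//; last 4 first.
- exact: measurableU.
- apply/eqP; rewrite eq_le measure_ge0 andbT; apply: le_trans (measureU2 _ mNp mNn) _.
  by rewrite -[leRHS]adde0; apply: leeD; rewrite le_eqVlt; apply/orP; left; apply/eqP.
- exact: (emeasurable_funB mFp mFn).
- move=> x _ /not_orP[Npx Nnx].
  have Fpfin : Fp x \is a fin_num.
    by apply: contrapT => h; apply: Npx; apply: NpP => /(_ Logic.I).
  have Fnfin : Fn x \is a fin_num.
    by apply: contrapT => h; apply: Nnx; apply: NnP => /(_ Logic.I).
  rewrite (IH (fx x)).
    rewrite integralE; congr (_ - _)%E; apply: eq_integral => y _.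
      by rewrite !funeposE.
    by rewrite !funenegE.
  apply/integrableP; split; first exact: mfx.
  rewrite (eq_integral (fun y : n.-tuple R => f^\+ [tuple of x :: y] + f^\- [tuple of x :: y])%E); last first.
    by move=> y _; rewrite -[RHS]/((f^\+ \+ f^\-)%E _) -fune_abse.
  rewrite ge0_integralD//; [by rewrite lte_add_pinfty// ltey_eq ?Fpfin ?Fnfin| |].
    exact: (measurableT_comp mfp (measurableT_comp (@measurable_cons_pair R n) (pair1_measurable x))).
  exact: (measurableT_comp mfn (measurableT_comp (@measurable_cons_pair R n) (pair1_measurable x))).
by rewrite integralB// [RHS]integralE !lebn_cons.
Qed.

End lebn_theory.

Lemma measurable_sqrt (R : realType) : measurable_fun setT (@Num.sqrt R : R -> R).
Proof. apply: continuous_measurable_fun; exact: sqrt_continuous. Qed.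

Lemma measurable_inv (R : realType) : measurable_fun setT (@GRing.inv R : R -> R).
Proof.
(* [powR] inverts only positive bases, hence the detour through the square; at 0 both sides are
   0. *)
rewrite (_ : GRing.inv = fun a : R => a * (a ^+ 2) `^ (- 1)).
  apply: measurable_funM => //; apply: (@measurableT_comp _ _ _ _ _ _ (fun t : R => t `^ _)).
    exact: measurable_powR.
  exact: measurable_funX.
apply/funext => a; have [->|a0] := eqVneq a 0; first by rewrite invr0 mul0r.
by rewrite powR_inv1 ?sqr_ge0// expr2 invfM mulrA divff// mul1r.
Qed.

(** * Euclidean norm, balls and annuli *)

Section euclidean.
Context (R : realType) (n : nat).
Implicit Types (x y z : n.-tuple R) (t L : R).

Lemma enorm_ge0 x : 0 <= enorm x. Proof. exact: sqrtr_ge0. Qed.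

Lemma enorm_sqr x : enorm x ^+ 2 = \sum_(i < n) tnth x i ^+ 2.
Proof. by rewrite sqr_sqrtr// sumr_ge0// => i _; exact: sqr_ge0. Qed.

Lemma tnth_le_enorm x i : `|tnth x i| <= enorm x.
Proof.
rewrite -(ler_pXn2r (n := 2))// ?nnegrE ?enorm_ge0//.
rewrite enorm_sqr -normrX ger0_norm ?sqr_ge0// (bigD1 i)//= lerDl.
by apply: sumr_ge0 => j _; exact: sqr_ge0.
Qed.

Lemma enorm_sqr_tsub x y : enorm y ^+ 2 <= 2 * enorm x ^+ 2 + 2 * enorm (tsub x y) ^+ 2.
Proof.
rewrite !enorm_sqr !mulr_sumr -big_split /=; apply: ler_sum => i _.
rewrite tnth_mktuple; have := sqr_ge0 (2 * tnth x i - tnth y i); nra.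
Qed.

Lemma measurable_tnth_comp d (Y : measurableType d) (f : Y -> n.-tuple R) i :
  measurable_fun setT f -> measurable_fun setT (fun p => tnth (f p) i).
Proof.
move=> mf; apply: (@measurableT_comp _ _ _ _ _ _ (fun x : n.-tuple R => tnth x i)) => //.
exact: measurable_tnth.
Qed.

Lemma measurable_enorm : measurable_fun setT (@enorm R n).
Proof.
rewrite (_ : @enorm R n = Num.sqrt \o (fun x => \sum_(i < n) tnth x i ^+ 2))//.
apply: measurableT_comp; first exact: measurable_sqrt.
by apply: measurable_sum => i; apply: measurable_funX; exact: measurable_tnth.
Qed.

Lemma measurable_annulus j : measurable (@annulus R n j).
Proof.
rewrite (_ : annulus j = @enorm R n @^-1` `[2 ^ (j - 1), 2 ^ j[); last first.
  by apply/seteqP; split => x /=; rewrite in_itv.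
by rewrite -[X in measurable X]setTI; apply: measurable_enorm => //.
Qed.

Lemma measurable_ball L : measurable [set x : n.-tuple R | enorm x <= L].
Proof.
rewrite (_ : mkset _ = @enorm R n @^-1` `]-oo, L]); last first.
  by apply/seteqP; split => x /=; rewrite in_itv.
by rewrite -[X in measurable X]setTI; apply: measurable_enorm => //.
Qed.

(** Crude comparison with the cube of half-side L: only the order L^n matters below. *)
Lemma ball_volume L : 0 <= L ->
  (lebn R n [set x | (enorm x <= L)%R] <= ((2 * L) ^+ n)%:E)%E.
Proof.
move=> L0; set B := [set x | _].
have mB : measurable B by exact: measurable_ball.
pose g (x : n.-tuple R) : R := 1 * \prod_(i < n) \1_(`[- L, L]%classic) (tnth x i).
have g0 x : 0 <= g x by rewrite /g mul1r prodr_ge0.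
have mg : measurable_fun setT (EFin \o g).
  apply/measurable_EFinP; apply: measurable_funM => //; apply: measurable_prod => i _.
  apply: (@measurableT_comp _ _ _ _ _ _ (\1_(`[- L, L]%classic) : R -> R)) => //.
  exact: measurable_tnth.
have -> : lebn R n B = (\int[lebn R n]_x (\1_B x)%:E)%E.
  by rewrite integral_indic// setIT.
have -> : ((2 * L) ^+ n)%:E = iint (fun x : n.-tuple R => (g x)%:E).
  rewrite (@iint_scale_prod R n 1 (fun=> \1_(`[- L, L]%classic)))//.
  rewrite mul1e (eq_bigr (fun=> (L - - L)%:E)); last first.
    move=> i _; rewrite integral_indic //= setIT lebesgue_measure_itv /= lte_fin.
    by case: ltP => // h; congr EFin; lra.
  rewrite prodEFin prodr_const card_ord opprK; congr ((_ ^+ _)%:E); lra.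
rewrite iintE//; apply: ge0_le_integral => //.
- by apply/measurable_EFinP; exact: measurable_indic.
- move=> x _; rewrite lee_fin indicE; have [/set_mem Bx|_] := boolP (x \in B); last exact: g0.
  rewrite /g mul1r big1// => i _; rewrite indicE mem_set//= in_itv/= -ler_norml.
  exact: le_trans (tnth_le_enorm x i) Bx.
Qed.

Lemma annulus_volume j : (lebn R n (annulus j) <= ((2 * 2 ^ j) ^+ n)%:E)%E.
Proof.
apply: le_trans (ball_volume _); last by rewrite exprz_ge0.
apply: le_measure; rewrite ?inE.
- exact: measurable_annulus.
- exact: measurable_ball.
by move=> x /= /andP[_ /ltW].
Qed.

Lemma enorm_eq0_null : (0 < n)%N -> lebn R n [set x | enorm x <= 0] = 0%E.
Proof.
move=> n0; apply/eqP; rewrite eq_le measure_ge0 andbT.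
by have := ball_volume (lexx 0); rewrite mulr0 expr0n gtn_eqF.
Qed.

End euclidean.

(** * Heat kernel and its decay away from an annulus *)

Section heat_kernel.
Context (R : realType) (n : nat).
Implicit Types (x y z : n.-tuple R) (t L mu : R).

Lemma heat_kernel_ge0 t z : 0 <= heat_kernel t z.
Proof. by rewrite mulr_ge0 ?powR_ge0 ?expR_ge0. Qed.

(** At time 0 the kernel is not a Dirac mass: [powR] sends the base 0 to 0 for a nonzero exponent.
    This lets the flow be defined, as 0, at nonpositive lags. *)
Lemma heat_kernel_time0 z : (0 < n)%N -> heat_kernel 0 z = 0.
Proof.
move=> n0; rewrite /heat_kernel mulr0 powR0 ?mul0r// oppr_eq0.
by rewrite gt_eqF// divr_gt0// ltr0n.
Qed.

Lemma pi4_gt1 : 1 < 4 * pi :> R.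
Proof. have := @pi_ge2 R; lra. Qed.

Lemma heat_kernel_le t z : 0 < t -> heat_kernel t z <= t `^ (- (n%:R / 2)).
Proof.
move=> t0; have p0 := pi4_gt1; rewrite /heat_kernel.
move: (4 * pi) p0 => p p0.
rewrite powRM//; [|by lra|exact: ltW].
rewrite -[leRHS]mul1r mulrAC ler_wpM2r ?powR_ge0//.
rewrite -[leRHS]mul1r ler_pM ?powR_ge0 ?expR_ge0//.
  rewrite -[leRHS](powRr0 p) ler_powR//; first exact: ltW.
rewrite -expR0 ler_expR mulNr oppr_le0 divr_ge0 ?sqr_ge0 ?mulr_ge0 ?(ltW t0)//.
Qed.

Lemma measurable_heat_kernel d (Y : measurableType d) (a : Y -> R) (u v : Y -> n.-tuple R) :
  measurable_fun setT a -> measurable_fun setT u -> measurable_fun setT v ->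
  measurable_fun setT (fun p => heat_kernel (a p) (tsub (u p) (v p))).
Proof.
move=> ma mu mv; apply: measurable_funM.
  apply: (@measurableT_comp _ _ _ _ _ _ (fun t : R => t `^ _)).
    exact: measurable_powR.
  exact: measurable_funM.
apply: (@measurableT_comp _ _ _ _ _ _ (@expR R)) => //.
apply: measurable_funM.
  rewrite (_ : (fun p => _) = fun p =>
      - \sum_(i < n) (tnth (u p) i - tnth (v p) i) ^+ 2); last first.
    by apply/funext => p; rewrite enorm_sqr; congr (- _); apply: eq_bigr => i _;
      rewrite tnth_mktuple.
  apply: measurableT_comp => //; apply: measurable_sum => i; apply: measurable_funX.
  by apply: measurable_funB; exact: measurable_tnth_comp.
apply: (@measurableT_comp _ _ _ _ _ _ (fun t : R => t^-1)).
  exact: measurable_inv.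
exact: measurable_funM.
Qed.

(** The kernel is a product of normal densities of variance 2t, so that its mass follows from the
    one-dimensional one. *)
Lemma heat_kernel_prod t x y : 0 < t ->
  heat_kernel t (tsub x y) = \prod_(i < n) normal_pdf (tnth y i) (Num.sqrt (2 * t)) (tnth x i).
Proof.
move=> t0.
have s0 : Num.sqrt (2 * t) != 0 by rewrite gt_eqF// sqrtr_gt0 mulr_gt0.
rewrite /heat_kernel.
under eq_bigr do rewrite normal_pdfE//.
rewrite big_split /= prodr_const card_ord /normal_peak /normal_fun.
rewrite [Num.sqrt (2 * t) ^+ 2]sqr_sqrtr; last by rewrite mulr_ge0 ?ltW.
rewrite (_ : 2 * t * pi *+ 2 = 4 * pi * t); last by rewrite mulr2n; move: (pi : R) => p; ring.
congr (_ * _).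
  have p0 : 0 <= 4 * pi * t by rewrite !mulr_ge0 ?pi_ge0// ltW.
  move: (4 * pi * t) p0 => p p0.
  by rewrite powRN mulrC powRrM powR_mulrn ?powR_ge0// powR12_sqrt// exprVn.
rewrite -expR_sum; congr expR; rewrite enorm_sqr -mulr_suml sumrN.
congr (- _ / _); last by rewrite mulr2n; ring.
by apply: eq_bigr => i _; rewrite tnth_mktuple.
Qed.

Lemma heat_kernel_mass t y : 0 < t ->
  (\int[lebn R n]_x (heat_kernel t (tsub x y))%:E = 1)%E.
Proof.
move=> t0; have s0 : Num.sqrt (2 * t) != 0 by rewrite gt_eqF// sqrtr_gt0 mulr_gt0.
rewrite -iintE; last 2 first.
- by apply/measurable_EFinP; exact: measurable_heat_kernel.
- by move=> x; rewrite lee_fin heat_kernel_ge0.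
transitivity (iint (fun x : n.-tuple R =>
    (1 * \prod_(i < n) normal_pdf (tnth y i) (Num.sqrt (2 * t)) (tnth x i))%:E)).
  by congr iint; apply/funext => x; rewrite mul1r heat_kernel_prod.
rewrite (@iint_scale_prod R n 1 (fun i => normal_pdf (tnth y i) (Num.sqrt (2 * t))))//.
- by rewrite mul1e big1// => i _; exact: integral_normal_pdf.
- by move=> i; exact: measurable_normal_pdf.
- by move=> i x; exact: normal_pdf_ge0.
Qed.

(** For mu > 0 the constant is mu^mu: raise r/mu <= exp(r/mu) to the power mu. *)
Lemma expRN_powR_le mu : 0 <= mu ->
  exists2 C : R, 0 < C & forall r, 0 < r -> expR (- r) <= C * r `^ (- mu).
Proof.
move=> mu0; have [->|mun0] := eqVneq mu 0.
  exists 1 => // r r0; rewrite oppr0 powRr0 mulr1 -expR0 ler_expR oppr_le0; exact: ltW.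
have {mun0}mu0 : 0 < mu by rewrite lt_neqAle eq_sym mun0.
exists (mu `^ mu); first exact: powR_gt0.
move=> r r0; rewrite powRN expRN -[leLHS]mul1r ler_pdivrMr ?expR_gt0//.
rewrite mulrAC ler_pdivlMr ?powR_gt0// mul1r.
have h : (r / mu) `^ mu <= expR r.
  rewrite -[in leRHS](divfK (lt0r_neq0 mu0) r) expRM.
  rewrite ge0_ler_powR ?nnegrE ?expR_ge0 ?divr_ge0 ?(ltW mu0) ?(ltW r0)//.
  by apply: le_trans (expR_ge1Dx _); rewrite lerDr.
have -> : r `^ mu = mu `^ mu * (r / mu) `^ mu.
  rewrite -powRM ?divr_ge0 ?ltW//; congr (_ `^ _); field; exact: lt0r_neq0.
by rewrite ler_pM2l ?powR_gt0.
Qed.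

(* Polynomial decay of order [2 mu], all that is used of the Gaussian decay
   of the heat evolution of a function supported in the annulus of radius [L]. *)
Definition bump mu L y : R := (1 + enorm y / L) `^ (- (2 * mu)).

Lemma bump_ge0 mu L y : 0 <= bump mu L y. Proof. exact: powR_ge0. Qed.

Lemma bump_le1 mu L y : 0 <= mu -> 0 < L -> bump mu L y <= 1.
Proof.
move=> mu0 L0; rewrite /bump -[leRHS](powRr0 (1 + enorm y / L)) ler_powR//.
  by rewrite lerDl divr_ge0 ?enorm_ge0 ?ltW.
by rewrite oppr_le0 mulr_ge0.
Qed.

Lemma measurable_bump mu L : measurable_fun setT (bump mu L).
Proof.
apply: (@measurableT_comp _ _ _ _ _ _ (fun t : R => t `^ _)); first exact: measurable_powR.
by apply: measurable_funD => //; apply: measurable_funM => //; exact: measurable_enorm.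
Qed.

(** The exponent |z|^2/(4t) is split into halves: one stays in the kernel at time 2t, the other pays
    for the bump. For |y| <= 2L the bump is bounded below. For |y| > 2L one has |x - y| >= |y|/2,
    and exp(-|y|^2/(32t)) is at most a constant times (|y|^2/(32t))^(-mu), which is (t/L^2)^mu
    (|y|/L)^(-2 mu) up to a constant. *)
Lemma heat_kernel_decay mu : 0 <= mu ->
  exists2 C : R, 0 < C & forall L t x y, 0 < L -> 0 < t -> enorm x <= L ->
    heat_kernel t (tsub x y) <=
    C * bump mu L y * (1 + (t / L ^+ 2) `^ mu) * heat_kernel (2 * t) (tsub x y).
Proof.
move=> mu0; have [C C0 HC] := expRN_powR_le mu0.
(* One term for each region: 1 + |y|/L <= 3 for |y| <= 2L, and 1 + |y|/L <= (3/2)|y|/L beyond. *)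
pose D1 : R := 3 `^ (2 * mu) + C * 32 `^ mu * (3 / 2) `^ (2 * mu).
have D10 : 0 < D1 by rewrite addr_gt0 ?powR_gt0// !mulr_gt0 ?powR_gt0.
exists (2 `^ (n%:R / 2) * D1); first by rewrite mulr_gt0 ?powR_gt0.
move => // L t x y L0 t0 xL.
set z := tsub x y.
have hE : heat_kernel t z = 2 `^ (n%:R / 2) * expR (- (enorm z ^+ 2 / (8 * t))) *
    heat_kernel (2 * t) z.
  rewrite /heat_kernel; have p0 : (0 : R) < 4 * pi by rewrite mulr_gt0 ?pi_gt0.
  move: (4 * pi) p0 => p p0.
  rewrite (_ : p * (2 * t) = 2 * (p * t)); last by ring.
  rewrite (powRM _ (_ : 0 <= 2))// ?mulr_ge0 ?ltW// (powRN 2).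
  rewrite (_ : - enorm z ^+ 2 / (4 * t) = - (enorm z ^+ 2 / (8 * t)) +
     - enorm z ^+ 2 / (4 * (2 * t))); last by field; exact: lt0r_neq0.
  rewrite expRD; have : 2 `^ (n%:R / 2) != 0 :> R by rewrite gt_eqF// powR_gt0.
  move: (2 `^ _) => a a0; by field.
rewrite hE ler_wpM2r ?heat_kernel_ge0//.
set T := (t / L ^+ 2) `^ mu.
have T0 : 0 <= T by exact: powR_ge0.
rewrite -[leRHS]mulrA -mulrA ler_pM2l ?powR_gt0//.
have b0 := bump_ge0 mu L y.
have yL0 : 0 <= enorm y / L by rewrite divr_ge0 ?enorm_ge0 ?ltW.
have y1 : 0 < 1 + enorm y / L by rewrite ltr_wpDr.
have bE : bump mu L y * (1 + enorm y / L) `^ (2 * mu) = 1.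
  by rewrite /bump powRN mulVf// gt_eqF// powR_gt0.
have [yL|yL] := leP (enorm y) (2 * L).
  apply: (@le_trans _ _ 1).
    by rewrite -expR0 ler_expR oppr_le0 divr_ge0 ?sqr_ge0// mulr_ge0 ?ltW.
  rewrite /D1 [leRHS]mulrDl; apply: (@le_trans _ _ (3 `^ (2 * mu) * (bump mu L y * (1 + T)))); last first.
    by rewrite lerDl !mulr_ge0 ?powR_ge0 ?(ltW C0) ?addr_ge0.
  rewrite mulrA -[leLHS]mulr1 ler_pM ?ler01//; last by rewrite lerDl.
  rewrite -[leLHS]bE [leRHS]mulrC ler_wpM2l// ge0_ler_powR ?nnegrE ?mulr_ge0 ?(ltW y1)//.
  have : enorm y / L <= 2 by rewrite ler_pdivrMr.
  lra.
have z2 : enorm y ^+ 2 / 4 <= enorm z ^+ 2.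
  have := enorm_sqr_tsub x y; rewrite -/z => h.
  have : enorm x ^+ 2 <= L ^+ 2 by rewrite ler_pXn2r// ?nnegrE ?enorm_ge0// ltW.
  have : (2 * L) ^+ 2 <= enorm y ^+ 2 by rewrite ler_pXn2r// ?nnegrE ?enorm_ge0 ?mulr_ge0// ltW.
  rewrite exprMn; nra.
have y0 : 0 < enorm y by apply: lt_trans yL; rewrite mulr_gt0.
pose r := enorm y ^+ 2 / (32 * t).
have r0 : 0 < r by rewrite divr_gt0 ?exprn_gt0 ?mulr_gt0.
apply: (@le_trans _ _ (expR (- r))).
  rewrite ler_expR lerN2 /r ler_pdivrMr ?mulr_gt0//.
  rewrite (_ : enorm z ^+ 2 / (8 * t) * (32 * t) = 4 * enorm z ^+ 2); first by lra.
  by field; exact: lt0r_neq0.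
apply: le_trans (HC _ r0) _.
have rE : r `^ (- mu) = 32 `^ mu * T * (enorm y / L) `^ (- (2 * mu)).
  rewrite (_ : r = (32 * (t / L ^+ 2))^-1 * (enorm y / L) ^+ 2); last first.
    by rewrite /r; field; rewrite !lt0r_neq0.
  rewrite /T; have : 0 < t / L ^+ 2 by rewrite divr_gt0 ?exprn_gt0.
  have : 0 < enorm y / L by rewrite divr_gt0.
  move: (t / _) (enorm y / L) => a b b0' a0.
  have a0' : 0 < 32 * a by rewrite mulr_gt0.
  rewrite powRM ?sqr_ge0 ?invr_ge0 ?(ltW a0')//.
  rewrite -powR_inv1 ?(ltW a0')// -powRrM mulrNN mul1r powRM ?(ltW a0)//; congr (_ * _).
  by rewrite -powR_mulrn ?(ltW b0')// -powRrM mulrN.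
have bL : (enorm y / L) `^ (- (2 * mu)) <= (3 / 2) `^ (2 * mu) * bump mu L y.
  have yL2 : 0 < enorm y / L by rewrite divr_gt0.
  rewrite powRN -[leLHS]mul1r ler_pdivrMr ?powR_gt0// -[leLHS]bE [X in _ <= X * _]mulrC -mulrA.
  apply: (ler_wpM2l b0); have : 2 < enorm y / L by rewrite ltr_pdivlMr.
  move: (enorm y / L) yL2 => b b0' b2; rewrite -powRM ?(ltW b0')//.
  apply: ge0_ler_powR; rewrite ?nnegrE; [exact: mulr_ge0|lra|lra|lra].
rewrite rE /D1 [leRHS]mulrDl; apply: (@le_trans _ _
    (C * (32 `^ mu * ((3 / 2) `^ (2 * mu) * (bump mu L y * T))))).
  rewrite ler_pM2l// -mulrA ler_pM2l ?powR_gt0// mulrC mulrA ler_wpM2r//.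
apply: ler_wpDl; first by rewrite !mulr_ge0 ?powR_ge0 ?addr_ge0.
rewrite -!mulrA ler_pM2l// ler_pM2l ?powR_gt0// ler_pM2l ?powR_gt0 ?divr_gt0//.
by rewrite ler_wpM2l// lerDr.
Qed.

End heat_kernel.

(** * Dyadic layers of a measurable function and geometric sums *)

Section dyadic_layers.
Context (R : realType).
Implicit Types (r e : R) (j : int).

Lemma dyadic_exists r : 0 < r -> exists j, (2 : R) ^ (j - 1) <= r < 2 ^ j.
Proof.
move=> r0; have l2 : 0 < ln (2 : R) by rewrite ln_gt0// ltr1n.
have E (j : int) : (2 : R) ^ j = expR (j%:~R * ln 2).
  by rewrite -powR_intmul// /powR pnatr_eq0.
have /andP[h1 h2] := floor_itv (ln r / ln 2).
exists (Num.floor (ln r / ln 2) + 1); rewrite addrK !E; apply/andP; split.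
  by rewrite -[leRHS]lnK ?posrE// ler_expR -ler_pdivlMr.
by rewrite -[ltLHS]lnK ?posrE// ltr_expR -ltr_pdivrMr.
Qed.

Lemma dyadic_unique r i j : (2 : R) ^ (i - 1) <= r < 2 ^ i ->
  (2 : R) ^ (j - 1) <= r < 2 ^ j -> i = j.
Proof.
have le k l : (2 : R) ^ (k - 1) <= r -> r < 2 ^ l -> (k <= l)%R.
  move=> h1 h2; have := le_lt_trans h1 h2.
  by rewrite ltr_eXz2l ?ltr1n// -lezD1 subrK.
move=> /andP[h1 h2] /andP[h3 h4]; apply/eqP; rewrite eq_le.
by rewrite (le _ _ h1 h4) (le _ _ h3 h2).
Qed.

(* Partial sums over the indices -K <= j < K. *)
Definition zsum (e : int -> R) (K : nat) : R := \sum_(k < K) (e (Posz k) + e (Negz k)).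

Lemma ler_zsum (e e' : int -> R) K : (forall j, e j <= e' j) -> zsum e K <= zsum e' K.
Proof. by move=> h; apply: ler_sum => k _; exact: lerD. Qed.

Lemma zsum_ge0 (e : int -> R) K : (forall j, 0 <= e j) -> 0 <= zsum e K.
Proof. by move=> h; apply: sumr_ge0 => k _; exact: addr_ge0. Qed.

Lemma zsumD (e e' : int -> R) K : zsum (fun j => e j + e' j) K = zsum e K + zsum e' K.
Proof. by rewrite /zsum -big_split; apply: eq_bigr => k _ /=; ring. Qed.

Lemma zsumZ (c : R) (e : int -> R) K : zsum (fun j => c * e j) K = c * zsum e K.
Proof. by rewrite /zsum mulr_sumr; apply: eq_bigr => k _ /=; ring. Qed.

Lemma zsum_nondecreasing (e : int -> R) K K' : (forall j, 0 <= e j) -> (K <= K')%N ->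
  zsum e K <= zsum e K'.
Proof.
move=> e0 KK'; rewrite /zsum -(subnK KK') addnC big_split_ord /= lerDl.
by apply: sumr_ge0 => k _; exact: addr_ge0.
Qed.

Section layers.
Context d (X : measurableType d) (mu : {measure set X -> \bar R}) (rho : X -> R).
Hypothesis mrho : measurable_fun setT rho.
Implicit Type f : X -> \bar R.

Let layer j := [set x | (2 : R) ^ (j - 1) <= rho x < 2 ^ j].

Lemma measurable_layer j : measurable (layer j).
Proof.
rewrite (_ : layer j = rho @^-1` `[2 ^ (j - 1), 2 ^ j[); last first.
  by apply/seteqP; split => x /=; rewrite in_itv.
by rewrite -[X in measurable X]setTI; exact: mrho.
Qed.

(** The integers are enumerated as pairs [Posz k], [Negz k], so that the sum over the layers is a
    series over the naturals. *)
Lemma integral_layers f : measurable_fun setT f -> (forall x, 0 <= f x)%E ->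
  (\int[mu]_(x in [set x | (0 < rho x)%R]) f x =
   \sum_(0 <= k <oo) (\int[mu]_(x in layer (Posz k)) f x +
                      \int[mu]_(x in layer (Negz k)) f x))%E.
Proof.
move=> mf f0.
have layer0 i j x : layer i x -> layer j x -> i = j by exact: dyadic_unique.
pose F k := layer (Posz k) `|` layer (Negz k).
have mF k : measurable (F k) by apply: measurableU; exact: measurable_layer.
have -> : [set x | (0 < rho x)%R] = \bigcup_k F k.
  apply/seteqP; split => [x /= /dyadic_exists[[k|k] h]|x [k _ [|]] /=].
  - by exists k => //; left.
  - by exists k => //; right.
  - by move=> /andP[h _]; apply: lt_le_trans h; exact: exprz_gt0.
  - by move=> /andP[h _]; apply: lt_le_trans h; exact: exprz_gt0.
rewrite ge0_integral_bigcup//; last 2 first.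
- exact: measurable_funTS.
- apply/trivIsetP => i j _ _ ij; apply/disjoints_subset => x /= [] hi [] hj.
  + by have [] := layer0 _ _ _ hi hj => E; rewrite E eqxx in ij.
  + by have := layer0 _ _ _ hi hj.
  + by have := layer0 _ _ _ hi hj.
  + by have [] := layer0 _ _ _ hi hj => E; rewrite E eqxx in ij.
apply: eq_eseriesr => k _; rewrite /F ge0_integral_setU//.
- exact: measurable_layer.
- exact: measurable_layer.
- exact: measurable_funTS.
- by rewrite disj_set2E; apply/eqP/disjoints_subset => x h1 h2; have := layer0 _ _ _ h1 h2.
Qed.

(** Stated for any measurable [rho]: it is applied to |x|, to |x|/2^i and to the rescaled time lag
    (t - tau)/L^2. *)
Lemma layers_cover f (e : int -> R) (M : R) :
  measurable_fun setT f -> (forall x, 0 <= f x)%E ->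
  (forall j, \int[mu]_(x in layer j) f x <= (e j)%:E)%E ->
  (forall K, zsum e K <= M) ->
  (\int[mu]_(x in [set x | (0 < rho x)%R]) f x <= M%:E)%E.
Proof.
move=> mf f0 fe eM; rewrite integral_layers//.
apply: lime_le.
  by apply: is_cvg_nneseries => k _ _; apply: adde_ge0; exact: integral_ge0.
apply: nearW => K; apply: le_trans (_ : (zsum e K)%:E <= _)%E; last by rewrite lee_fin.
rewrite big_mkord /zsum -sumEFin; apply: lee_sum => k _.
by rewrite EFinD; apply: leeD; exact: fe.
Qed.

End layers.

Lemma geometric_sum_le (q : R) K : 0 <= q < 1 -> \sum_(k < K) q ^+ k <= (1 - q)^-1.
Proof.
move=> /andP[q0 q1]; have d0 : 0 < 1 - q by rewrite subr_gt0.
rewrite -[leRHS]mul1r ler_pdivlMr// mulrC -opprB mulNr -subrX1 opprB gerBl.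
exact: exprn_ge0.
Qed.

Lemma geometric_powR_le e K : 0 < e -> \sum_(k < K) 2 `^ (- (e * k%:R)) <= (1 - 2 `^ (- e))^-1.
Proof.
move=> e0; under eq_bigr do rewrite -mulNr powRrM powR_mulrn ?powR_ge0//.
apply: geometric_sum_le; rewrite powR_ge0 /=.
rewrite powRN invf_lt1 ?powR_gt0//.
by rewrite -[ltLHS](powRr0 2) /powR pnatr_eq0/= ltr_expR ltr_pM2r ?ln_gt0// ltr1n.
Qed.

Lemma geometric_const_gt0 e : 0 < e -> 0 < (1 - 2 `^ (- e))^-1 :> R.
Proof.
by move=> e0; have := geometric_powR_le 1 e0; apply: lt_le_trans;
  rewrite big_ord_recl big_ord0 addr0 powR_gt0.
Qed.

End dyadic_layers.

(** * Integrating the kernel over time lags *)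

Section time_kernel.
Context (R : realType).
Implicit Types (a nu L r t d : R).

(* Size of the heat evolution, at lag [r], of the potential [|x|^gamma |u|^(alpha-1)]
   cut off to the annulus of radius [L]: Hoelder's inequality gives the power [-a],
   the size of the heat kernel away from short lags the power [-nu]. *)
Definition time_kernel a nu L r : R :=
  L ^- 2 * Num.min ((r / L ^+ 2) `^ (- a)) ((r / L ^+ 2) `^ (- nu)).

Lemma time_kernel_ge0 a nu L r : 0 <= time_kernel a nu L r.
Proof.
by rewrite mulr_ge0 ?invr_ge0 ?sqr_ge0// le_min !powR_ge0.
Qed.

Lemma measurable_time_kernel a nu L : measurable_fun setT (time_kernel a nu L).
Proof.
by apply: measurable_funM => //; apply: measurable_minr;
  apply: (@measurableT_comp _ _ _ _ _ _ (fun t : R => t `^ _));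
  rewrite ?measurable_powR//; exact: measurable_funM.
Qed.

(** On the layer where the lag over L^2 lies in [2^(j-1), 2^j) the kernel is at most L^-2
    (2^(j-1))^(-b), with b = nu for long lags and b = a for short ones, and the layer has length L^2
    2^(j-1). The powers of L cancel and both geometric series converge. *)
Lemma time_kernel_integral a nu : a < 1 -> 1 < nu -> 0 <= a ->
  exists2 C : R, 0 < C & forall L t, 0 < L ->
    (\int[@lebesgue_measure R]_(x in [set x | (x < t)%R]) (time_kernel a nu L (t - x))%:E
      <= C%:E)%E.
Proof.
move=> a1 nu1 a0.
pose G e : R := (1 - 2 `^ (- e))^-1.
have G0 e : 0 < e -> 0 < G e by exact: geometric_const_gt0.
have a1' : 0 < 1 - a by lra.
have nu1' : 0 < nu - 1 by lra.
exists (2 `^ (nu - 1) * G (nu - 1) + G (1 - a)).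
  by rewrite addr_gt0 ?mulr_gt0 ?powR_gt0 ?G0.
move=> L t L0; have L20 : 0 < L ^+ 2 by rewrite exprn_gt0.
have -> : [set x | (x < t)%R] = [set x | 0 < (t - x) / L ^+ 2].
  by apply/seteqP; split => x /=; rewrite pmulr_lgt0 ?invr_gt0// subr_gt0.
(* For [Posz k] this is (2^(k-1))^(1-nu). [Negz k] is -(k+1), whose exact bound 2^(-(1-a)(k+2)) is
   relaxed. *)
pose e (j : int) : R := match j with
  | Posz k => 2 `^ (nu - 1) * 2 `^ (- ((nu - 1) * k%:R))
  | Negz k => 2 `^ (- ((1 - a) * k%:R)) end.
have mtk : measurable_fun setT (fun x : R => time_kernel a nu L (t - x)).
  apply: (@measurableT_comp _ _ _ _ _ _ (time_kernel a nu L)).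
    exact: measurable_time_kernel.
  exact: measurable_funB.
apply: (@layers_cover R _ (measurableTypeR R) lebesgue_measure _ _ _ e) => //.
- by apply: measurable_funM => //; exact: measurable_funB.
- by apply/measurable_EFinP.
- by move=> x; rewrite lee_fin time_kernel_ge0.
- move=> j.
  set A := [set x | _].
  have AE : A = `]t - L ^+ 2 * 2 ^ j, t - L ^+ 2 * 2 ^ (j - 1)]%classic.
    apply/seteqP; split => x; rewrite /A/= in_itv/= ler_pdivlMr// ltr_pdivrMr// => /andP[h1 h2];
    apply/andP; split; lra.
  have p0 : 0 < (2 : R) ^ (j - 1) by exact: exprz_gt0.
  have pE : (2 : R) ^ j = 2 * 2 ^ (j - 1).
    by rewrite -{1}[j](subrK 1) addrC expfzDr ?pnatr_eq0.
  have mA : lebesgue_measure A = (L ^+ 2 * 2 ^ (j - 1))%:E.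
    rewrite AE lebesgue_measure_itv /= lte_fin ltrD2l ltrN2 ltr_pM2l// pE.
    rewrite ifT; last by lra.
    by rewrite -EFinD; congr EFin; ring.
  have AP b x : A x -> 0 <= b -> ((t - x) / L ^+ 2) `^ (- b) <= (2 ^ (j - 1)) `^ (- b).
    move=> /= /andP[h1 h2] b0; rewrite !powRN lef_pV2 ?posrE ?powR_gt0//.
      by rewrite ge0_ler_powR ?nnegrE ?(ltW p0)// (le_trans (ltW p0)).
    exact: lt_le_trans h1.
  pose b := if j is Posz _ then nu else a.
  have b0 : 0 <= b by rewrite /b; case: (j) => _ //; lra.
  apply: (@le_trans _ _ (\int[lebesgue_measure]_(x in A) (L ^- 2 * (2 ^ (j - 1)) `^ (- b))%:E)%E).
    apply: ge0_le_integral_nonmeas => x Ax; rewrite lee_fin ?time_kernel_ge0//.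
    rewrite ler_wpM2l ?invr_ge0 ?(ltW L20)// ge_min; apply/orP.
    by move: (AP b x Ax b0); rewrite /b; case: (j) => ?; [right|left].
  rewrite integral_cst; last by rewrite AE; exact: measurable_itv.
  rewrite -[X in (_ * X)%E]/(lebesgue_measure A) mA -EFinM lee_fin /=.
  apply: (@le_trans _ _ (2 ^ (j - 1) * (2 ^ (j - 1)) `^ (- b))).
    rewrite le_eqVlt; apply/orP; left; apply/eqP.
    by move: ((2 : R) ^ (j - 1)) => P; move: (P `^ _) => B; field; rewrite lt0r_neq0.
  rewrite -powR_intmul// -powRrM -powRD; last by rewrite pnatr_eq0 implybT.
  rewrite /b /e intrD intrN; case: (j) => k.
    rewrite -powRD; last by rewrite pnatr_eq0 implybT.
    rewrite ler_powR ?ler1n//= -[(Posz k)%:~R]/(k%:R : R); lra.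
  rewrite ler_powR ?ler1n//= NegzE intrN -[(Posz k.+1)%:~R]/(k.+1%:R : R) -natr1; lra.
- move=> K; rewrite /zsum big_split /= lerD//.
    by rewrite -mulr_sumr ler_wpM2l ?powR_ge0// geometric_powR_le.
  exact: geometric_powR_le.
Qed.

(* What the integral of [time_kernel] over the lags in [0, d] gains for [d << L^2]. *)
Definition time_small eps d L : R := Num.min 1 ((d / L ^+ 2) `^ eps).

Lemma time_small_ge0 eps d L : 0 <= time_small eps d L.
Proof. by rewrite le_min ler01 powR_ge0. Qed.

Lemma time_small_le1 eps d L : time_small eps d L <= 1.
Proof. by rewrite ge_min lexx. Qed.

(** Raising the exponent from a to the midpoint (1 + a)/2 of a and 1 frees the power (1 - a)/2 of
    the scaled lag, which is at most the same power of d/L^2; the new exponent is still integrable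
    at lag 0. *)
Lemma time_kernel_le_small a nu L r d : 0 <= a -> a < 1 -> 1 < nu -> 0 < L ->
  0 < r <= d ->
  time_kernel a nu L r <= time_small ((1 - a) / 2) d L * time_kernel ((1 + a) / 2) nu L r.
Proof.
move=> a0 a1 nu1 L0 /andP[r0 rd]; have L20 : 0 < L ^+ 2 by rewrite exprn_gt0.
rewrite /time_kernel mulrCA ler_wpM2l ?invr_ge0 ?(ltW L20)// /time_small.
have : 0 < r / L ^+ 2 by rewrite divr_gt0.
have : r / L ^+ 2 <= d / L ^+ 2 by rewrite ler_pM2r ?invr_gt0.
move: (r / _) (d / _) => p D pD p0.
set a' := (1 + a) / 2; set e := (1 - a) / 2.
have e0 : 0 < e by rewrite /e; lra.
have aE : p `^ (- a) = p `^ e * p `^ (- a').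
  rewrite -powRD; last by rewrite (gt_eqF p0) implybT.
  by congr (_ `^ _); rewrite /e /a'; lra.
have [D1|D1] := leP 1 D.
  rewrite (@min_l _ _ 1) ?mul1r; last first.
    by rewrite -[leLHS](powRr0 D) ler_powR// ltW.
  have [p1|p1] := leP 1 p.
    rewrite le_min; apply/andP; split; last by rewrite ge_min lexx orbT.
    by rewrite ge_min; apply/orP; right; rewrite ler_powR// lerN2 /a'; lra.
  rewrite le_min; apply/andP; split; last by rewrite ge_min lexx orbT.
  rewrite ge_min; apply/orP; left; rewrite aE -[leRHS]mul1r ler_wpM2r ?powR_ge0//.
  by rewrite -[leRHS](powRr0 p) ger_powR ?p0 ?ltW.
have p1 : p < 1 by exact: le_lt_trans pD D1.
have D0 : 0 < D by exact: lt_le_trans p0 pD.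
have DE1 : D `^ e <= 1 by rewrite -[leRHS](powRr0 D) ger_powR ?D0 ?ltW.
rewrite (@min_r _ _ 1)//.
rewrite (@min_l _ _ (p `^ (- a'))); last first.
  by rewrite ger_powR ?p0 ?ltW// ltrN2 /a'; lra.
rewrite ge_min; apply/orP; left; rewrite aE ler_wpM2r ?powR_ge0//.
by rewrite ge0_ler_powR ?nnegrE ?(ltW p0) ?(ltW D0) ?(ltW e0).
Qed.

Lemma time_kernel_small_integral a nu : a < 1 -> 1 < nu -> 0 <= a ->
  exists2 C : R, 0 < C & forall L d t0 t, 0 < L -> t0 <= t -> t - t0 <= d ->
    (\int[@lebesgue_measure R]_(x in [set x | (t0 <= x < t)%R])
        (time_kernel a nu L (t - x))%:E
      <= (C * time_small ((1 - a) / 2) d L)%:E)%E.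
Proof.
move=> a1 nu1 a0.
have [|//||C C0 HC] := @time_kernel_integral ((1 + a) / 2) nu; [lra|lra|].
exists C => // L d t0 t L0 t0t td.
set sm := time_small _ _ _.
have mtk : measurable_fun setT (fun x : R => time_kernel ((1 + a) / 2) nu L (t - x)).
  apply: (@measurableT_comp _ _ _ _ _ _ (time_kernel _ nu L)).
    exact: measurable_time_kernel.
  exact: measurable_funB.
have E1 : [set x | t0 <= x < t] = `[t0, t[%classic by apply/seteqP; split => x; rewrite /= in_itv.
have E2 : [set x | x < t] = `]-oo, t[%classic by apply/seteqP; split => x; rewrite /= in_itv.
have sm0 : 0 <= sm by exact: time_small_ge0.
apply: (@le_trans _ _ (sm%:E * \int[@lebesgue_measure R]_(x in [set x | (x < t)%R])
    (time_kernel ((1 + a) / 2) nu L (t - x))%:E)%E); last first.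
  by rewrite (mulrC C) EFinM lee_wpmul2l// ?lee_fin// HC.
rewrite -ge0_integralZl//; last 3 first.
- by rewrite E2; exact: measurable_itv.
- by apply/measurable_EFinP; exact: measurable_funTS.
- by move=> x _; rewrite lee_fin time_kernel_ge0.
apply: (@le_trans _ _ (\int[@lebesgue_measure R]_(x in [set x | (t0 <= x < t)%R])
    (sm%:E * (time_kernel ((1 + a) / 2) nu L (t - x))%:E))%E).
  apply: ge0_le_integral_nonmeas => x /=; first by rewrite lee_fin time_kernel_ge0.
  move=> /andP[h1 h2]; rewrite -EFinM lee_fin time_kernel_le_small//.
  by rewrite subr_gt0 h2; lra.
apply: ge0_subset_integral => //.
- by rewrite E1; exact: measurable_itv.
- by rewrite E2; exact: measurable_itv.
- by apply: measurable_funeM; apply/measurable_EFinP; exact: measurable_funTS.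
- by move=> x _; rewrite mule_ge0// lee_fin time_kernel_ge0.
- by move=> x /= /andP[].
Qed.

End time_kernel.

(** * Elementary inequalities for real powers *)

Section real_inequalities.
Context (R : realType).
Implicit Types (a b c p : R).

(** A substitute for the mean value theorem. For x < 1/2 the right side exceeds 1; otherwise combine
    1 + p ln x <= x^p with ln x >= -2(1 - x). *)
Lemma one_sub_powR_le (x p : R) : 1 <= p -> 0 <= x <= 1 -> 1 - x `^ p <= 2 * p * (1 - x).
Proof.
move=> p1 /andP[x0 x1]; have [xh|xh] := ltP x (1 / 2).
  have := powR_ge0 x p; nra.
have x0' : 0 < x by lra.
have h : 1 + p * ln x <= x `^ p by rewrite /powR gt_eqF// expR_ge1Dx.
have l : - (2 * (1 - x)) <= ln x.
  have : ln x^-1 <= x^-1 - 1.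
    have := @le_ln1Dx R (x^-1 - 1); rewrite [1 + _]addrC subrK; apply.
    by have : 0 < x^-1 by [rewrite invr_gt0]; lra.
  rewrite lnV ?posrE// => h1.
  have : x^-1 - 1 <= 2 * (1 - x).
    rewrite (_ : x^-1 - 1 = (1 - x) / x); last by field; exact: lt0r_neq0.
    by rewrite ler_pdivrMr//; nra.
  lra.
nra.
Qed.

Lemma powR_sub_le a b p : 1 <= p -> 0 <= b <= a ->
  a `^ p - b `^ p <= 2 * p * a `^ (p - 1) * (a - b).
Proof.
move=> p1 /andP[b0 ba]; have [a0|a0] := eqVneq a 0.
  by rewrite (_ : b = 0) ?a0 ?subrr ?mulr0//; lra.
have {}a0 : 0 < a by rewrite lt_neqAle eq_sym a0 (le_trans b0 ba).
have := @one_sub_powR_le (b / a) p p1; rewrite divr_ge0 ?(ltW a0)//= ler_pdivrMr// mul1r => /(_ ba) h.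
have ap : 0 < a `^ p by rewrite powR_gt0.
have bE : b `^ p = a `^ p * (b / a) `^ p.
  rewrite -powRM ?(ltW a0) ?divr_ge0 ?(ltW a0)//; congr (_ `^ _); field; exact: lt0r_neq0.
have aE : a `^ p = a `^ (p - 1) * a.
  by rewrite -{3}(powRr1 (ltW a0)) -powRD ?subrK// (gt_eqF a0) implybT.
rewrite bE -[X in X - _]mulr1 -mulrBr.
apply: (@le_trans _ _ (a `^ p * (2 * p * (1 - b / a)))); first by rewrite ler_pM2l.
rewrite aE le_eqVlt; apply/orP; left; apply/eqP.
move: (a `^ _) => A; field; exact: lt0r_neq0.
Qed.

Lemma powR_succ a c : 0 <= a -> 0 < c -> a `^ c * a = a `^ (c + 1).
Proof.
move=> a0 c0; rewrite le_eqVlt in a0; case/orP: a0 => [/eqP <-|a0].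
  by rewrite mulr0 powR0// gt_eqF// addr_gt0.
by rewrite powRD ?(gt_eqF a0) ?implybT// powRr1// ltW.
Qed.

(** For equal signs this is a difference of powers 1 + c of the moduli; for opposite signs |a - b|
    is the sum of the moduli and there is no cancellation to exploit. *)
Lemma signed_power_dist a b c : 0 < c ->
  `| `|a| `^ c * a - `|b| `^ c * b | <= 2 * (1 + c) * ((`|a| `^ c + `|b| `^ c) * `|a - b|).
Proof.
move=> c0.
have key x y : 0 <= y <= x ->
    `|x `^ c * x - y `^ c * y| <= 2 * (1 + c) * ((x `^ c + y `^ c) * `|x - y|).
  move=> /andP[y0 yx]; have x0 := le_trans y0 yx.
  have := @powR_sub_le x y (1 + c); rewrite y0 yx lerDl (ltW c0) => /(_ isT isT).
  rewrite !(powR_succ _ c0)// (addrC 1 c) addrK => h.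
  have h2 : y `^ (c + 1) <= x `^ (c + 1) by rewrite ge0_ler_powR ?nnegrE//; lra.
  rewrite !ger0_norm ?subr_ge0//; apply: le_trans h _.
  have := powR_ge0 y c; have := powR_ge0 x c => A B.
  by rewrite -!mulrA ler_pM2l// ler_pM2l; [rewrite ler_wpM2r ?subr_ge0// lerDl|lra].
have same x y : 0 <= x -> 0 <= y ->
    `|x `^ c * x - y `^ c * y| <= 2 * (1 + c) * ((x `^ c + y `^ c) * `|x - y|).
  move=> x0 y0; have [yx|/ltW xy] := leP y x; first by apply: key; rewrite y0.
  by rewrite distrC (addrC (x `^ c)) (distrC x); apply: key; rewrite x0.
have opp x y : 0 <= x -> 0 <= y ->
    `|x `^ c * x + y `^ c * y| <= 2 * (1 + c) * ((x `^ c + y `^ c) * `|x + y|).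
  move=> x0 y0; have := powR_ge0 y c; have := powR_ge0 x c => A B.
  rewrite !ger0_norm ?addr_ge0 ?mulr_ge0//.
  apply: (@le_trans _ _ (1 * ((x `^ c + y `^ c) * (x + y)))); first by nra.
  by rewrite ler_wpM2r ?mulr_ge0 ?addr_ge0//; lra.
have [a0|a0] := leP 0 a; have [b0|b0] := leP 0 b.
- by rewrite (ger0_norm a0) (ger0_norm b0); exact: same.
- rewrite (ger0_norm a0) (ltr0_norm b0).
  have -> : a `^ c * a - (- b) `^ c * b = a `^ c * a + (- b) `^ c * (- b) by ring.
  by apply: opp => //; rewrite oppr_ge0 ltW.
- rewrite (ltr0_norm a0) (ger0_norm b0).
  rewrite -[X in X <= _]normrN -[`|a - b|]normrN.
  have -> : - ((- a) `^ c * a - b `^ c * b) = (- a) `^ c * (- a) + b `^ c * b by ring.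
  have -> : - (a - b) = - a + b by ring.
  by apply: opp => //; rewrite oppr_ge0 ltW.
- rewrite (ltr0_norm a0) (ltr0_norm b0).
  rewrite -[X in X <= _]normrN -[`|a - b|]normrN.
  have -> : - ((- a) `^ c * a - (- b) `^ c * b) = (- a) `^ c * (- a) - (- b) `^ c * (- b) by ring.
  have -> : - (a - b) = - a - - b by ring.
  by apply: same; rewrite oppr_ge0 ltW.
Qed.

(** Either b <= eta a or a <= b/eta, and each alternative makes one term of the right side
    sufficient. *)
Lemma young_power a b c eta : 0 <= a -> 0 <= b -> 0 < c -> 0 < eta ->
  a `^ c * b <= eta * a `^ (c + 1) + eta `^ (- c) * b `^ (c + 1).
Proof.
move=> a0 b0 c0 e0; have [h|h] := leP b (eta * a).
  apply: ler_wpDr; first by rewrite mulr_ge0 ?powR_ge0.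
  by rewrite -powR_succ// mulrCA ler_wpM2l ?powR_ge0.
apply: ler_wpDl; first by rewrite mulr_ge0 ?powR_ge0 ?(ltW e0).
rewrite -(powR_succ b0)// mulrA ler_wpM2r//.
have : a <= b / eta by rewrite ler_pdivlMr// mulrC ltW.
move=> ha; apply: (@le_trans _ _ ((b / eta) `^ c)).
  by rewrite ge0_ler_powR ?nnegrE ?(ltW c0)// divr_ge0// ltW.
by rewrite powRM ?invr_ge0 ?(ltW e0)// -powR_inv1 ?(ltW e0)// -powRrM mulN1r mulrC.
Qed.

Lemma powR_add_le a b c : 0 <= a -> 0 <= b -> 0 <= c ->
  (a + b) `^ c <= 2 `^ c * (a `^ c + b `^ c).
Proof.
move=> a0 b0 c0; have [ab|/ltW ba] := leP a b.
  apply: (@le_trans _ _ ((2 * b) `^ c)).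
    by rewrite ge0_ler_powR ?nnegrE ?addr_ge0 ?mulr_ge0//; lra.
  by rewrite powRM// ler_pM2l ?powR_gt0// lerDr powR_ge0.
apply: (@le_trans _ _ ((2 * a) `^ c)).
  by rewrite ge0_ler_powR ?nnegrE ?addr_ge0 ?mulr_ge0//; lra.
by rewrite powRM// ler_pM2l ?powR_gt0// lerDl powR_ge0.
Qed.

Lemma powR_split a l c p : 0 <= a -> 0 < l -> 0 < c <= p ->
  a `^ c <= l `^ c + l `^ (c - p) * a `^ p.
Proof.
move=> a0 l0 /andP[c0 cp]; have [al|la] := leP a l.
  apply: ler_wpDr; first by rewrite mulr_ge0 ?powR_ge0.
  by rewrite ge0_ler_powR ?nnegrE ?(ltW l0) ?(ltW c0).
apply: ler_wpDl; first exact: powR_ge0.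
have a0' : 0 < a by exact: lt_trans la.
have -> : a `^ c = a `^ (c - p) * a `^ p.
  by rewrite -powRD ?subrK// (gt_eqF a0') implybT.
rewrite ler_wpM2r ?powR_ge0// -[c - p]opprB !powRN.
rewrite lef_pV2 ?posrE ?powR_gt0// ge0_ler_powR ?nnegrE ?(ltW l0) ?(ltW la)//.
by rewrite subr_ge0.
Qed.

End real_inequalities.

(** * Bounds in L^q and Hoelder's inequality *)

Section Lq_bounded.
Context (R : realType) (n : nat).
Implicit Types (q : \bar R) (u v w g phi : n.-tuple R -> R) (N M c : R).

(** A bound on the norm rather than the norm itself, with p-th powers on both sides, so that neither
    roots nor finiteness have to be carried along. *)
Definition Lq_bounded q v N : Prop :=
  match q with
  | EFin p => (\int[lebn R n]_x (`|v x| `^ p)%:E <= (N `^ p)%:E)%E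
  | +oo%E => {ae lebn R n, forall x, `|v x| <= N}
  | -oo%E => False
  end.

Lemma measurable_normr_powR d (Y : measurableType d) (v : Y -> R) p :
  measurable_fun setT v -> measurable_fun setT (fun x => `|v x| `^ p).
Proof.
move=> mv; apply: (@measurableT_comp _ _ _ _ _ _ (fun t : R => t `^ p)).
  exact: measurable_powR.
by apply: (@measurableT_comp _ _ _ _ _ _ (@Num.norm _ R)).
Qed.

Lemma Lq_bounded_norm q v N : (1 <= q)%E -> measurable_fun setT v -> 0 <= N ->
  (Lqnorm q v <= N%:E)%E -> Lq_bounded q v N.
Proof.
case: q => [p| |] //=; rewrite ?lee_fin => q1 mv N0.
  have p0 : 0 < p by lra.
  rewrite iintE; last 2 first.
  - by apply/measurable_EFinP; exact: measurable_normr_powR.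
  - by move=> x; rewrite lee_fin powR_ge0.
  set I := (\int[_]_x _)%E => h.
  have I0 : (0 <= I)%E by apply: integral_ge0 => x _; rewrite lee_fin powR_ge0.
  have := @gt0_ler_poweR R p (ltW p0) _ _ _ _ h.
  rewrite !in_itv /= !leey poweR_ge0 lee_fin N0 /= => /(_ isT isT).
  by rewrite -poweRrM mulVf ?gt_eqF// poweRe1.
move=> h.
(* The essential supremum is an infimum, so the bound is first obtained up to 1/(k+1), then for all
   k off a common null set. *)
have H k : {ae lebn R n, forall x, `|v x| <= N + k.+1%:R^-1}.
  have : (esssup_rn (fun x => `|v x|%R) < (N + k.+1%:R^-1)%:E)%E.
    by apply: le_lt_trans h _; rewrite lte_fin ltrDl invr_gt0.
  move=> /ereal_inf_lt [M /= /ae_rnP hM MN]; apply: filterS hM => x hx.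
  by rewrite -lee_fin (le_trans hx)// ltW.
have : {ae lebn R n, forall x, forall k, `|v x| <= N + k.+1%:R^-1}.
  exact: ae_foralln.
apply: filterS => x hx; apply/ler_addgt0Pr => e e0.
have [k _ hk] := near_infty_natSinv_lt (PosNum e0).
apply: le_trans (hx k) _; rewrite lerD2l; apply: ltW.
by have := hk k (leqnn k).
Qed.

(** A quasi-triangle inequality in place of Minkowski's: one factor 2 comes from the p-th power of a
    sum, the other from 2 <= 2^p, which absorbs the two terms. *)
Lemma Lq_bounded_add q u v w N M : (1 <= q)%E -> 0 <= N -> 0 <= M ->
  measurable_fun setT u -> measurable_fun setT v -> measurable_fun setT w ->
  (forall x, `|u x| <= `|v x| + `|w x|) ->
  Lq_bounded q v N -> Lq_bounded q w M -> Lq_bounded q u (4 * (N + M)).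
Proof.
case: q => [p| |] //=; rewrite ?lee_fin => q1 N0 M0 mu mv mw uvw hv hw.
  have p0 : 0 < p by lra.
  have m g : measurable_fun setT g ->
      measurable_fun setT (fun x => (`|g x| `^ p)%:E).
    by move=> mg; apply/measurable_EFinP; exact: measurable_normr_powR.
  apply: (@le_trans _ _ (\int[lebn R n]_x
      ((2 `^ p)%:E * ((`|v x| `^ p)%:E + (`|w x| `^ p)%:E)))%E).
    apply: ge0_le_integral_nonmeas => x _; first by rewrite lee_fin powR_ge0.
    rewrite -EFinD -EFinM lee_fin; apply: le_trans (powR_add_le _ _ (ltW p0)) => //.
    by rewrite ge0_ler_powR ?nnegrE ?addr_ge0 ?(ltW p0).
  rewrite ge0_integralZl ?lee_fin ?powR_ge0//; last 2 first.
  - by apply: emeasurable_funD; exact: m.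
  - by move=> x _; rewrite -EFinD lee_fin addr_ge0 ?powR_ge0.
  rewrite ge0_integralD//; [|exact: m..].
  apply: (@le_trans _ _ ((2 `^ p)%:E * ((N `^ p)%:E + (M `^ p)%:E))%E).
    by rewrite lee_wpmul2l ?lee_fin ?powR_ge0// leeD.
  rewrite -EFinD -EFinM lee_fin.
  have -> : 4 * (N + M) = 2 * (2 * (N + M)) by ring.
  rewrite powRM ?mulr_ge0 ?addr_ge0// ler_wpM2l ?powR_ge0//.
  rewrite powRM ?addr_ge0//.
  have h1 : N `^ p <= (N + M) `^ p.
    by rewrite ge0_ler_powR ?nnegrE ?addr_ge0 ?(ltW p0)// lerDl.
  have h2 : M `^ p <= (N + M) `^ p.
    by rewrite ge0_ler_powR ?nnegrE ?addr_ge0 ?(ltW p0)// lerDr.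
  have h3 : 2 <= 2 `^ p :> R by rewrite le1r_powR// ler1n.
  have := powR_ge0 (N + M) p; nra.
apply: filterS2 hv hw => x h1 h2; have := uvw x; lra.
Qed.

Lemma Lq_bounded_le q v w N M : (1 <= q)%E -> 0 <= N <= M ->
  (forall x, `|v x| <= `|w x|) -> Lq_bounded q w N -> Lq_bounded q v M.
Proof.
case: q => [p| |] //=; rewrite ?lee_fin => q1 /andP[N0 NM] vw hw.
  have p0 : 0 < p by lra.
  apply: le_trans (le_trans hw _).
    apply: ge0_le_integral_nonmeas => x _; rewrite lee_fin ?powR_ge0//.
    by rewrite ge0_ler_powR ?nnegrE ?(ltW p0).
  by rewrite lee_fin ge0_ler_powR ?nnegrE ?(ltW p0)// (le_trans N0).
apply: filterS hw => x h; exact: le_trans (vw x) (le_trans h NM).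
Qed.

(* Hoelder's inequality, through the splitting [|v|^c <= l^c + l^(c-q) |v|^q]
   with the optimal level [l = (kappa/m)^(1/q) N]. *)
Lemma weighted_power_le q phi v c kappa m N :
  measurable_fun setT phi -> measurable_fun setT v ->
  (forall x, 0 <= phi x <= kappa) -> (\int[lebn R n]_x (phi x)%:E <= m%:E)%E ->
  0 < kappa -> 0 < m -> 0 <= N -> 0 < c -> (c%:E <= q)%E -> Lq_bounded q v N ->
  (\int[lebn R n]_x (phi x * `|v x| `^ c)%:E
     <= (2 * m `^ (1 - c * qinv q) * kappa `^ (c * qinv q) * N `^ c)%:E)%E.
Proof.
move=> mphi mv phik phim k0 m0 N0 c0 cq hv.
have phi0 x : 0 <= phi x by have /andP[] := phik x.
have mphiE : measurable_fun setT (fun x => (phi x)%:E) by apply/measurable_EFinP.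
case: q cq hv => [p| |] //=; last first.
  move=> _ hv; rewrite !mulr0 subr0 !powRr1 ?(ltW m0)// powRr0 mulr1.
  apply: (@le_trans _ _ (\int[lebn R n]_x ((N `^ c)%:E * (phi x)%:E))%E).
    apply: ae_ge0_le_integral => //.
    - by move=> x _; rewrite lee_fin mulr_ge0 ?powR_ge0.
    - apply/measurable_EFinP; apply: measurable_funM => //; exact: measurable_normr_powR.
    - by move=> x _; rewrite -EFinM lee_fin mulr_ge0 ?powR_ge0.
    - exact: measurable_funeM.
    apply: filterS hv => x hx _; rewrite -EFinM lee_fin mulrC ler_wpM2r//.
    by rewrite ge0_ler_powR ?nnegrE ?(ltW c0).
  rewrite ge0_integralZl ?lee_fin ?powR_ge0//; last by move=> x _; rewrite lee_fin.
  apply: (@le_trans _ _ ((N `^ c)%:E * m%:E)%E).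
    by rewrite lee_wpmul2l ?lee_fin ?powR_ge0.
  rewrite -EFinM lee_fin mulrC ler_wpM2r ?powR_ge0//; lra.
rewrite lee_fin => cp hv; have p0 : 0 < p by lra.
(* The optimal level must be positive, so a positive N' >= N is used; for N = 0 it is chosen at the
   end so that the bound equals [e]. *)
have main N' : 0 < N' -> N <= N' -> (\int[lebn R n]_x (phi x * `|v x| `^ c)%:E
     <= (2 * m `^ (1 - c / p) * kappa `^ (c / p) * N' `^ c)%:E)%E.
  move=> N'0 NN'.
  pose l := (kappa / m) `^ p^-1 * N'.
  have km0 : 0 < kappa / m by rewrite divr_gt0.
  have l0 : 0 < l by rewrite mulr_gt0 ?powR_gt0.
  apply: (@le_trans _ _ (\int[lebn R n]_x ((l `^ c)%:E * (phi x)%:E +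
      (l `^ (c - p) * kappa)%:E * (`|v x| `^ p)%:E))%E).
    apply: ge0_le_integral_nonmeas => x _; first by rewrite lee_fin mulr_ge0 ?powR_ge0.
    rewrite -!EFinM -EFinD lee_fin.
    have h := @powR_split R `|v x| l c p (normr_ge0 _) l0.
    rewrite c0 cp in h; have {}h := h isT.
    apply: le_trans (ler_wpM2l (phi0 x) h) _.
    rewrite mulrDr [X in X + _]mulrC lerD2l mulrCA -mulrA.
    rewrite ler_wpM2l ?powR_ge0// ler_wpM2r ?powR_ge0//.
    by have /andP[] := phik x.
  have mvp : measurable_fun setT (fun x => (`|v x| `^ p)%:E).
    by apply/measurable_EFinP; exact: measurable_normr_powR.
  rewrite ge0_integralD//; last 4 first.
  - by move=> x _; rewrite -EFinM lee_fin mulr_ge0 ?powR_ge0.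
  - exact: measurable_funeM.
  - by move=> x _; rewrite -EFinM lee_fin !mulr_ge0 ?powR_ge0 ?(ltW k0).
  - exact: measurable_funeM.
  rewrite !ge0_integralZl ?lee_fin ?mulr_ge0 ?powR_ge0 ?(ltW k0)//; last first.
    by move=> x _; rewrite lee_fin.
  apply: (@le_trans _ _ ((l `^ c)%:E * m%:E + (l `^ (c - p) * kappa)%:E * (N' `^ p)%:E)%E).
    apply: leeD; rewrite lee_wpmul2l ?lee_fin ?mulr_ge0 ?powR_ge0 ?(ltW k0)//.
    by apply: le_trans hv _; rewrite lee_fin ge0_ler_powR ?nnegrE ?(ltW p0) ?(ltW N'0).
  rewrite -!EFinM -EFinD lee_fin.
  have E1 b : l `^ b = kappa `^ (b / p) * m `^ (- (b / p)) * N' `^ b.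
    rewrite /l powRM ?powR_ge0 ?(ltW N'0)// -powRrM (mulrC p^-1).
    rewrite powRM ?invr_ge0 ?(ltW k0) ?(ltW m0)//.
    by rewrite -(powR_inv1 (ltW m0)) -(powRrM m) mulN1r.
  rewrite !E1 le_eqVlt; apply/orP; left; apply/eqP.
  have kE : kappa `^ ((c - p) / p) * kappa = kappa `^ (c / p).
    rewrite -{2}(powRr1 (ltW k0)) -powRD; last by rewrite (gt_eqF k0) implybT.
    by congr (_ `^ _); field; exact: lt0r_neq0.
  have mE : m `^ (- (c / p)) * m = m `^ (1 - c / p).
    rewrite -{2}(powRr1 (ltW m0)) -powRD; last by rewrite (gt_eqF m0) implybT.
    by congr (_ `^ _); ring.
  have mE2 : m `^ (- ((c - p) / p)) = m `^ (1 - c / p).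
    by congr (_ `^ _); field; exact: lt0r_neq0.
  have NE : N' `^ (c - p) * N' `^ p = N' `^ c.
    by rewrite -powRD ?subrK// (gt_eqF N'0) implybT.
  rewrite mE2 -kE -mE -NE; ring.
apply/lee_addgt0Pr => e e0.
have c1 : 0 < 2 * m `^ (1 - c / p) * kappa `^ (c / p).
  by rewrite !mulr_gt0 ?powR_gt0.
have := N0; rewrite le_eqVlt => /predU1P[N00|N0']; last first.
  by apply: le_trans (main _ N0' (lexx _)) _; rewrite leeDl// lee_fin ltW.
pose N' := (e / (2 * m `^ (1 - c / p) * kappa `^ (c / p))) `^ c^-1.
have N'0 : 0 < N' by apply: powR_gt0; exact: divr_gt0.
apply: le_trans (main N' N'0 _) _; first by rewrite -N00 ltW.
rewrite -N00 powR0 ?gt_eqF// mulr0 add0e lee_fin /N' -powRrM mulVf ?gt_eqF// powRr1.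
  by rewrite mulrC divfK// gt_eqF.
by rewrite divr_ge0 ?(ltW e0) ?(ltW c1).
Qed.

End Lq_bounded.

Lemma ge0_integral_le_scale d (X : measurableType d) (R : realType)
    (mu : {measure set X -> \bar R}) (D : set X) (f g : X -> R) (k M : R) :
  measurable D -> measurable_fun D f -> (forall x, D x -> 0 <= f x) -> 0 <= k ->
  (forall x, D x -> 0 <= g x) -> (forall x, D x -> g x <= k * f x) ->
  (\int[mu]_(x in D) (f x)%:E <= M%:E)%E -> (\int[mu]_(x in D) (g x)%:E <= (k * M)%:E)%E.
Proof.
move=> mD mf f0 k0 g0 gf fM; rewrite EFinM.
apply: (@le_trans _ _ (k%:E * \int[mu]_(x in D) (f x)%:E)%E); last exact: lee_wpmul2l.
have -> : (k%:E * \int[mu]_(x in D) (f x)%:E = \int[mu]_(x in D) (k%:E * (f x)%:E))%E.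
  apply/esym/ge0_integralZl; [exact: mD|exact/measurable_EFinP|by []|by []].
by apply: ge0_le_integral_nonmeas => x Dx; rewrite lee_fin; [exact: g0|exact: gf].
Qed.

Lemma ge0_integral_le_add d (X : measurableType d) (R : realType)
    (mu : {measure set X -> \bar R}) (D : set X) (f1 f2 g : X -> R) (k1 k2 M1 M2 : R) :
  measurable D -> measurable_fun D f1 -> measurable_fun D f2 ->
  (forall x, D x -> 0 <= f1 x) -> (forall x, D x -> 0 <= f2 x) -> 0 <= k1 -> 0 <= k2 ->
  (forall x, D x -> 0 <= g x) -> (forall x, D x -> g x <= k1 * f1 x + k2 * f2 x) ->
  (\int[mu]_(x in D) (f1 x)%:E <= M1%:E)%E -> (\int[mu]_(x in D) (f2 x)%:E <= M2%:E)%E ->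
  (\int[mu]_(x in D) (g x)%:E <= (k1 * M1 + k2 * M2)%:E)%E.
Proof.
move=> mD mf1 mf2 f10 f20 k10 k20 g0 gf fM1 fM2.
apply: (@le_trans _ _ (\int[mu]_(x in D) ((k1 * f1 x)%:E + (k2 * f2 x)%:E))%E).
  by apply: ge0_le_integral_nonmeas => x Dx; rewrite -?EFinD lee_fin; [exact: g0|exact: gf].
rewrite ge0_integralD//; last 4 first.
- by move=> x Dx; rewrite lee_fin mulr_ge0 ?f10.
- by apply/measurable_EFinP; exact: measurable_funM.
- by move=> x Dx; rewrite lee_fin mulr_ge0 ?f20.
- by apply/measurable_EFinP; exact: measurable_funM.
rewrite EFinD; apply: leeD.
  by apply: (ge0_integral_le_scale mD mf1) => // x Dx; rewrite mulr_ge0 ?f10.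
by apply: (ge0_integral_le_scale mD mf2) => // x Dx; rewrite mulr_ge0 ?f20.
Qed.

(** The factor rho^mu hurts only for rho > 1, where the minimum is the power -b. It becomes -(b -
    mu), still the smaller of the two since a <= b - mu. *)
Lemma min_powR_mul_le (R : realType) (rho a b mu : R) : 0 < rho -> 0 <= mu -> a <= b - mu ->
  (1 + rho `^ mu) * Num.min (rho `^ (- a)) (rho `^ (- b)) <=
  2 * Num.min (rho `^ (- a)) (rho `^ (- (b - mu))).
Proof.
move=> r0 mu0 ab; have p b' : 0 <= rho `^ b' by exact: powR_ge0.
have [r1|r1] := leP rho 1.
  have h1 : rho `^ mu <= 1 by rewrite -[leRHS](powRr0 rho) ger_powR ?r0.
  rewrite min_l; last by rewrite ger_powR ?r0// lerN2; lra.
  rewrite min_l; last by rewrite ger_powR ?r0// lerN2; lra.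
  by rewrite ler_wpM2r//; lra.
have r1' := ltW r1.
rewrite min_r; last by rewrite ler_powR// lerN2; lra.
rewrite min_r; last by rewrite ler_powR// lerN2; lra.
have -> : rho `^ (- (b - mu)) = rho `^ mu * rho `^ (- b).
  by rewrite -powRD ?(gt_eqF r0) ?implybT//; congr (_ `^ _); ring.
rewrite mulrA ler_wpM2r//.
have h1 : 1 <= rho `^ mu by rewrite -[leLHS](powRr0 rho) ler_powR.
lra.
Qed.

Lemma conjugate_exponent_itv (R : realType) (q : \bar R) (c : R) : 0 < c -> (c%:E <= q)%E ->
  0 <= 1 - c * qinv q <= 1.
Proof.
move=> c0; case: q => [p| |] //=; last by rewrite mulr0; lra.
rewrite lee_fin => cp; have p0 : 0 < p by lra.
rewrite subr_ge0 ler_pdivrMr// mul1r cp gerBl divr_ge0//; exact: ltW.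
Qed.

(** * Estimates on a single annulus *)

Section annulus_estimates.
Context (R : realType) (n : nat).
Implicit Types (q : \bar R) (u v w phi : n.-tuple R -> R) (N M c s gamma : R) (j : int).

(** Says that 2^(js) times the L^q norm of v on the annulus is at most N: [N] bounds the j-th term
    of the Herz norm. *)
Definition ann_bound s q v j N : Prop :=
  Lq_bounded q (fun x => v x * \1_(annulus j) x) (((2 : R) ^ j) `^ (- s) * N).

Lemma dyadic_gt0 j : 0 < (2 : R) ^ j. Proof. exact: exprz_gt0. Qed.
Hint Resolve dyadic_gt0 : core.

Lemma measurable_mul_annulus v j : measurable_fun setT v ->
  measurable_fun setT (fun x => v x * \1_(annulus j) x).
Proof.
move=> mv; apply: measurable_funM => //; apply: measurable_indic.
exact: measurable_annulus.
Qed.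

Lemma annulus_powR_le gamma j (x : n.-tuple R) : annulus j x ->
  enorm x `^ gamma <= 2 `^ `|gamma| * ((2 : R) ^ j) `^ gamma.
Proof.
move=> /= /andP[h1 h2]; have L0 := dyadic_gt0 j; have l0 := dyadic_gt0 (j - 1).
have x0 : 0 < enorm x by exact: lt_le_trans h1.
have LE : (2 : R) ^ j = 2 * 2 ^ (j - 1).
  by rewrite -{1}[j](subrK 1) addrC expfzDr ?pnatr_eq0.
have [g0|g0] := leP 0 gamma.
  rewrite -[leLHS]mul1r ler_pM ?powR_ge0//.
    by rewrite -[leLHS](powRr0 2) ler_powR// ler1n.
  by rewrite ge0_ler_powR ?nnegrE ?(ltW x0) ?(ltW L0) ?(ltW h2).
apply: (@le_trans _ _ ((2 ^ (j - 1)) `^ gamma)).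
  rewrite -[gamma]opprK !(powRN _ (- gamma)) lef_pV2 ?posrE ?powR_gt0//.
  by rewrite ge0_ler_powR ?nnegrE ?(ltW x0) ?(ltW l0)// oppr_ge0 ltW.
rewrite LE powRM ?(ltW l0)// mulrA -powRD ?pnatr_eq0 ?implybT//.
by rewrite ltr0_norm// addNr powRr0 mul1r.
Qed.

Lemma integral_annulus_indic (f : n.-tuple R -> R) j :
  (\int[lebn R n]_(x in annulus j) (f x)%:E =
   \int[lebn R n]_x (f x * \1_(annulus j) x)%:E)%E.
Proof.
rewrite integral_mkcond; apply: eq_integral => x _; rewrite patchE indicE.
by case: (x \in annulus j); rewrite ?mulr1 ?mulr0.
Qed.

Lemma annulus_weighted_le q phi v c kappa m N s j :
  measurable_fun setT phi -> measurable_fun setT v ->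
  (forall x, 0 <= phi x) -> (forall x, annulus j x -> phi x <= kappa) ->
  (\int[lebn R n]_(x in annulus j) (phi x)%:E <= m%:E)%E ->
  0 < kappa -> 0 < m -> 0 <= N -> 0 < c -> (c%:E <= q)%E -> ann_bound s q v j N ->
  (\int[lebn R n]_(x in annulus j) (phi x * `|v x| `^ c)%:E
     <= (2 * m `^ (1 - c * qinv q) * kappa `^ (c * qinv q) *
         ((2 : R) ^ j) `^ (- (c * s)) * N `^ c)%:E)%E.
Proof.
move=> mphi mv phi0 phik phim k0 m0 N0 c0 cq vN; rewrite integral_annulus_indic.
have E x : phi x * `|v x| `^ c * \1_(annulus j) x =
    (phi x * \1_(annulus j) x) * `|v x * \1_(annulus j) x| `^ c.
  rewrite indicE; case: (_ \in _); rewrite ?mulr1 ?mulr0 ?mul0r//.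
under eq_integral do rewrite E.
apply: le_trans.
  apply: (@weighted_power_le _ _ _ _ _ _ kappa m (((2 : R) ^ j) `^ (- s) * N) _ _ _ _ _ _ _ _ cq vN) => //.
  - exact: measurable_mul_annulus.
  - exact: measurable_mul_annulus.
  - move=> x; rewrite indicE; have [/set_mem Ax|_] := boolP (x \in annulus j).
      by rewrite mulr1 phi0 phik.
    by rewrite mulr0 lexx (ltW k0).
  - by rewrite -integral_annulus_indic.
  - by rewrite mulr_ge0 ?powR_ge0.
by rewrite lee_fin powRM ?powR_ge0// -powRrM mulrA mulNr (mulrC s c).
Qed.

(** Hoelder's inequality against the weight 1, of mass at most (2L)^n. With c = alpha the power of L
    is beta, which yields the a priori bound on the nonlinearity. *)
Lemma annulus_power_le gamma c : 0 < c ->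
  exists2 C : R, 0 < C & forall q v N s j, measurable_fun setT v -> 0 <= N ->
    (c%:E <= q)%E -> ann_bound s q v j N ->
    (\int[lebn R n]_(x in annulus j) (enorm x `^ gamma * `|v x| `^ c)%:E
     <= (C * ((2 : R) ^ j) `^ (gamma + n%:R - c * (s + n%:R * qinv q)) * N `^ c)%:E)%E.
Proof.
move=> c0; pose G : R := 2 `^ `|gamma|.
have G0 : 0 < G by exact: powR_gt0.
exists (2 * 2 ^+ n * G); first by rewrite !mulr_gt0 ?exprn_gt0.
move=> q v N s j mv N0 cq vN.
pose L : R := 2 ^ j; have L0 : 0 < L by exact: dyadic_gt0.
have mA := @measurable_annulus R n j.
have me : measurable_fun setT (fun x : n.-tuple R => enorm x `^ gamma).
  apply: (@measurableT_comp _ _ _ _ _ _ (fun t : R => t `^ gamma)).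
    exact: measurable_powR.
  exact: measurable_enorm.
have mev : measurable_fun setT (fun x : n.-tuple R => 1 * `|v x| `^ c).
  by apply: measurable_funM => //; exact: measurable_normr_powR.
have q0 := conjugate_exponent_itv c0 cq.
apply: (@le_trans _ _ (G * L `^ gamma * (2 * ((2 * L) ^+ n) `^ (1 - c * qinv q) *
    1 `^ (c * qinv q) * L `^ (- (c * s)) * N `^ c))%:E).
  apply: (@ge0_integral_le_scale _ _ _ _ _ (fun x => 1 * `|v x| `^ c)) => //.
  - exact: measurable_funTS.
  - by rewrite mulr_ge0 ?powR_ge0 ?(ltW G0).
  - by move=> x _; rewrite mulr_ge0 ?powR_ge0.
  - by move=> x Ax; rewrite mul1r ler_wpM2r ?powR_ge0// annulus_powR_le.
  apply: (@annulus_weighted_le q (fun=> 1) v c 1 ((2 * L) ^+ n) N s j) => //.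
    by rewrite integral_cst// mul1e annulus_volume.
  by rewrite exprn_gt0// mulr_gt0.
rewrite lee_fin powR1 mulr1.
have L2 : (L == 0) = false by rewrite gt_eqF.
have -> : ((2 : R) ^ j) `^ (gamma + n%:R - c * (s + n%:R * qinv q)) =
    L `^ gamma * (L `^ (n%:R * (1 - c * qinv q)) * L `^ (- (c * s))).
  by rewrite -!powRD ?L2 ?implybT//; congr (_ `^ _); ring.
have -> : ((2 * L) ^+ n) `^ (1 - c * qinv q) =
    (2 ^+ n) `^ (1 - c * qinv q) * L `^ (n%:R * (1 - c * qinv q)).
  by rewrite exprMn powRM ?exprn_ge0// ?(ltW L0)// -(powR_mulrn n (ltW L0)) -powRrM.
have h : (2 ^+ n) `^ (1 - c * qinv q) <= 2 ^+ n :> R.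
  have /andP[q1 q2] := q0; rewrite -[leRHS](@powRr1 R) ?exprn_ge0//.
  by rewrite ler_powR// exprn_ege1// ler1n.
have -> : 2 * 2 ^+ n * G * (L `^ gamma * (L `^ (n%:R * (1 - c * qinv q)) * L `^ (- (c * s)))) *
   N `^ c = G * L `^ gamma * (2 * (2 ^+ n * L `^ (n%:R * (1 - c * qinv q))) *
   L `^ (- (c * s)) * N `^ c) by ring.
rewrite ler_wpM2l ?mulr_ge0 ?powR_ge0 ?(ltW G0)//.
by do 2! (rewrite ler_wpM2r ?powR_ge0//); rewrite ler_pM2l// ler_wpM2r ?powR_ge0.
Qed.

(** The heat kernel is traded for the bump and the kernel at time 2t, and the latter is the weight
    in Hoelder's inequality. Its supremum is at most t^(-n/2). Its mass on the annulus is at most 1,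
    which gives the power -a of t/L^2, and at most t^(-n/2) (2L)^n, which gives the power -n/2. The
    growth (t/L^2)^mu then lowers n/2 to nu. *)
Lemma annulus_kernel_le gamma c mu : 0 < c -> 0 <= mu ->
  exists2 C : R, 0 < C & forall q v N s j t y, measurable_fun setT v -> 0 <= N ->
    (c%:E <= q)%E -> ann_bound s q v j N -> 0 < t ->
    c * (s + n%:R * qinv q) = 2 + gamma -> c * (n%:R * qinv q) / 2 < n%:R / 2 - mu ->
    (\int[lebn R n]_(x in annulus j)
        (enorm x `^ gamma * `|v x| `^ c * heat_kernel t (tsub x y))%:E
     <= (C * N `^ c * bump mu (2 ^ j) y *
         time_kernel (c * (n%:R * qinv q) / 2) (n%:R / 2 - mu) (2 ^ j) t)%:E)%E.
Proof.
move=> c0 mu0; pose G : R := 2 `^ `|gamma|.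
have G0 : 0 < G by exact: powR_gt0.
have [D D0 HD] := @heat_kernel_decay R n mu mu0.
exists (2 * (2 * 2 ^+ n) * G * D); first by rewrite !mulr_gt0 ?exprn_gt0.
move=> q v N s j t y mv N0 cq vN t0 crit anu.
pose L : R := 2 ^ j; have L0 : 0 < L by exact: dyadic_gt0.
set a := c * (n%:R * qinv q) / 2 in anu *; set nu := n%:R / 2 - mu in anu *.
have mA := @measurable_annulus R n j.
have t20 : 0 < 2 * t by rewrite mulr_gt0.
pose rho := t / L ^+ 2.
have rho0 : 0 < rho by rewrite divr_gt0 ?exprn_gt0.
pose phi (x : n.-tuple R) := heat_kernel (2 * t) (tsub x y).
have phi0 x : 0 <= phi x by exact: heat_kernel_ge0.
have mphi : measurable_fun setT phi.
  by apply: measurable_heat_kernel.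
have mpv : measurable_fun setT (fun x : n.-tuple R => phi x * `|v x| `^ c).
  by apply: measurable_funM => //; exact: measurable_normr_powR.
pose K : R := G * L `^ gamma * (D * bump mu L y * (1 + rho `^ mu)).
have K0 : 0 <= K.
  by rewrite /K !mulr_ge0 ?powR_ge0 ?(ltW G0) ?(ltW D0)// addr_ge0 ?powR_ge0.
have q0 := conjugate_exponent_itv c0 cq.
have cq0 : 0 <= c * qinv q by lra.
have tn0 : 0 < t `^ (- (n%:R / 2)) by exact: powR_gt0.
have phik x : phi x <= t `^ (- (n%:R / 2)).
  apply: le_trans (heat_kernel_le _ t20) _.
  rewrite !powRN lef_pV2 ?posrE ?powR_gt0//.
  by rewrite ge0_ler_powR ?nnegrE ?(ltW t0) ?(ltW t20) ?divr_ge0//; lra.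
have ne : (L == 0) = false by rewrite gt_eqF.
have tE b : t `^ b = L `^ (2 * b) * rho `^ b.
  rewrite (_ : t = L ^+ 2 * rho); last by rewrite /rho mulrC divfK// gt_eqF// exprn_gt0.
  by rewrite powRM ?exprn_ge0 ?(ltW L0) ?(ltW rho0)// -(powR_mulrn 2 (ltW L0)) -powRrM.
(* Criticality: the powers of L from Hoelder's inequality and from the Herz weight add up to -(2 +
   gamma), so that |x|^gamma leaves L^-2. *)
have LE : L `^ (- (2 + gamma)) = L `^ (- (2 * a)) * L `^ (- (c * s)).
  by rewrite -powRD ?ne ?implybT// -crit /a; congr (_ `^ _); field.
have main : (\int[lebn R n]_(x in annulus j) (phi x * `|v x| `^ c)%:E <=
    (2 * 2 ^+ n * N `^ c * L `^ (- (2 + gamma)) *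
      Num.min (rho `^ (- a)) (rho `^ (- (n%:R / 2))))%:E)%E.
  have H := @annulus_weighted_le q phi v c (t `^ (- (n%:R / 2))) _ N s j mphi mv phi0
    (fun x _ => phik x) _ tn0 _ N0 c0 cq vN.
  (* Each side of the minimum is reached with its own mass: 1, or the supremum of the kernel times
     the volume. *)
  have [h|h] := leP (rho `^ (- a)) (rho `^ (- (n%:R / 2))).
    apply: le_trans (H 1 _ ltr01) _.
      apply: (@le_trans _ _ (\int[lebn R n]_x (phi x)%:E)%E); last first.
        by rewrite /phi heat_kernel_mass.
      apply: ge0_subset_integral => //; first exact/measurable_EFinP.
      by move=> x _; rewrite lee_fin; exact: phi0.
    rewrite lee_fin powR1 mulr1 -powRrM tE LE.
    rewrite (_ : - (n%:R / 2) * (c * qinv q) = - a); last by rewrite /a; field.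
    rewrite (_ : 2 * - a = - (2 * a)); last by ring.
    have e1 : 1 <= 2 ^+ n :> R by rewrite exprn_ege1// ler1n.
    have := powR_ge0 N c; have := powR_ge0 L (- (2 * a)); have := powR_ge0 rho (- a).
    have := powR_ge0 L (- (c * s)).
    move: (N `^ c) (L `^ _) (rho `^ _) (L `^ _) (2 ^+ n : R) e1 => A B E F T e1 p1 p2 p3 p4.
    rewrite (_ : 2 * (B * E) * F * A = 1 * (2 * (B * E * F * A))); last by ring.
    rewrite (_ : 2 * T * A * (B * F) * E = T * (2 * (B * E * F * A))); last by ring.
    by rewrite ler_wpM2r ?mulr_ge0.
  have m0 : 0 < t `^ (- (n%:R / 2)) * (2 * L) ^+ n by rewrite mulr_gt0// exprn_gt0// mulr_gt0.
  apply: le_trans (H _ _ m0) _.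
    apply: (@le_trans _ _ (\int[lebn R n]_(x in annulus j) (t `^ (- (n%:R / 2)))%:E)%E).
      by apply: ge0_le_integral_nonmeas => x _; rewrite lee_fin.
    by rewrite integral_cst// EFinM lee_wpmul2l ?lee_fin ?(ltW tn0)// annulus_volume.
  rewrite lee_fin powRM ?(ltW tn0) ?exprn_ge0 ?mulr_ge0 ?(ltW L0)//.
  have {}h : ((2 * L) ^+ n) `^ (1 - c * qinv q) <=
      2 ^+ n * L `^ (n%:R * (1 - c * qinv q)).
    rewrite exprMn powRM ?exprn_ge0 ?(ltW L0)// -(powR_mulrn n (ltW L0)) -powRrM.
    rewrite ler_wpM2r ?powR_ge0//; have /andP[q1 q2] := q0.
    by rewrite -[leRHS](@powRr1 R) ?exprn_ge0// ler_powR// exprn_ege1// ler1n.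
  have h2 : (t `^ (- (n%:R / 2))) `^ (1 - c * qinv q) * (t `^ (- (n%:R / 2))) `^ (c * qinv q) =
      L `^ (- n%:R) * rho `^ (- (n%:R / 2)).
    rewrite -powRD; last by rewrite (gt_eqF tn0) implybT.
    by rewrite subrK powRr1 ?(ltW tn0)// tE; congr (_ `^ _ * _); field.
  have h3 : L `^ (- n%:R) * L `^ (n%:R * (1 - c * qinv q)) = L `^ (- (2 * a)).
    by rewrite -powRD ?ne ?implybT//; congr (_ `^ _); rewrite /a; field.
  rewrite LE -h3.
  move: h2 h; set t1 := (t `^ _) `^ (1 - _); set t2 := (t `^ _) `^ _; set l1 := (_ ^+ n) `^ _.
  have r0 := powR_ge0 rho (- (n%:R / 2)); have l0 := powR_ge0 L (- n%:R).
  have c0' := powR_ge0 L (- (c * s)); have N0' := powR_ge0 N c.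
  move: (rho `^ _) (L `^ (- n%:R)) (L `^ (- (c * s))) (N `^ c) r0 l0 c0' N0'.
  move=> r2 l2 l3 Nc r0 l0 c0' N0' h2 h.
  rewrite (_ : 2 * (t1 * l1) * t2 * l3 * Nc = (t1 * t2) * (2 * l3 * Nc) * l1); last by ring.
  rewrite h2.
  rewrite [leRHS](_ : _ = l2 * r2 * (2 * l3 * Nc) * (2 ^+ n * L `^ (n%:R * (1 - c * qinv q)))); last by ring.
  by rewrite ler_wpM2l// !mulr_ge0.
apply: (@le_trans _ _ (K * (2 * 2 ^+ n * N `^ c * L `^ (- (2 + gamma)) *
      Num.min (rho `^ (- a)) (rho `^ (- (n%:R / 2)))))%:E).
  apply: (ge0_integral_le_scale _ _ _ _ _ _ main) => //.
  - exact: measurable_funTS.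
  - by move=> x _; rewrite mulr_ge0 ?powR_ge0.
  - by move=> x _; rewrite !mulr_ge0 ?powR_ge0 ?heat_kernel_ge0.
  move=> x Ax; rewrite mulrAC /K.
  rewrite -[leRHS]mulrA [_ * (phi x * _)]mulrA [leRHS]mulrA.
  rewrite ler_wpM2r ?powR_ge0// ler_pM ?powR_ge0 ?heat_kernel_ge0//.
    exact: annulus_powR_le.
  by apply: HD => //; move: Ax => /= /andP[_ /ltW].
rewrite lee_fin /time_kernel -/L -/rho.
have := @min_powR_mul_le R rho a (n%:R / 2) mu rho0 mu0 (ltW anu); rewrite -/nu => hmin.
have L2 : L `^ gamma * L `^ (- (2 + gamma)) = L ^- 2.
  rewrite -powRD ?ne ?implybT// (_ : gamma - (2 + gamma) = - 2%:R); last by ring.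
  by rewrite powRN powR_mulrn ?(ltW L0).
rewrite /K -L2.
have b0 := bump_ge0 mu L y; have lg := powR_ge0 L gamma; have lg2 := powR_ge0 L (- (2 + gamma)).
have N0' := powR_ge0 N c.
move: hmin; set m1 := Num.min _ _; set m2 := Num.min _ _ => hmin.
rewrite [leLHS](_ : _ = (2 * 2 ^+ n * G * D * N `^ c * bump mu L y *
   (L `^ gamma * L `^ (- (2 + gamma)))) * ((1 + rho `^ mu) * m1)); last by ring.
rewrite [leRHS](_ : _ = (2 * 2 ^+ n * G * D * N `^ c * bump mu L y *
   (L `^ gamma * L `^ (- (2 + gamma)))) * (2 * m2)); last by ring.
by rewrite ler_wpM2l// !mulr_ge0 ?exprn_ge0 ?(ltW G0) ?(ltW D0).
Qed.

Lemma NL_dist_le gamma alpha u v (y : n.-tuple R) : 1 < alpha ->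
  `|NL gamma alpha u y - NL gamma alpha v y| <=
  2 * alpha * (enorm y `^ gamma *
    ((`|u y| `^ (alpha - 1) + `|v y| `^ (alpha - 1)) * `|u y - v y|)).
Proof.
move=> a1; rewrite /NL -mulrBr normrM ger0_norm ?powR_ge0// mulrCA.
rewrite ler_wpM2l ?powR_ge0//.
have := @signed_power_dist R (u y) (v y) (alpha - 1); rewrite subr_gt0 => /(_ a1).
by rewrite (_ : 1 + (alpha - 1) = alpha)//; ring.
Qed.

Lemma measurable_NL gamma alpha v : measurable_fun setT v -> measurable_fun setT (NL gamma alpha v).
Proof.
move=> mv; apply: measurable_funM.
  apply: (@measurableT_comp _ _ _ _ _ _ (fun t : R => t `^ gamma)); first exact: measurable_powR.
  exact: measurable_enorm.
by apply: measurable_funM => //; exact: measurable_normr_powR.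
Qed.

(** Serves the continuity of the nonlinearity in L^1 of an annulus. Young's inequality with the free
    parameter [eta] separates the functions, so that each enters only through its power alpha. *)
Lemma annulus_NL_dist_le gamma alpha : 1 < alpha ->
  exists2 C : R, 0 < C & forall q u v N M D s j eta, measurable_fun setT u -> measurable_fun setT v ->
    0 <= N -> 0 <= M -> 0 <= D -> 0 < eta ->
    (alpha%:E <= q)%E -> ann_bound s q u j N -> ann_bound s q v j M ->
    ann_bound s q (fun x => u x - v x) j D ->
    (\int[lebn R n]_(x in annulus j) `|NL gamma alpha u x - NL gamma alpha v x|%:E
     <= (C * ((2 : R) ^ j) `^ (gamma + n%:R - alpha * (s + n%:R * qinv q)) *
        (eta * (N `^ alpha + M `^ alpha) + eta `^ (- (alpha - 1)) * D `^ alpha))%:E)%E.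
Proof.
move=> a1; have a0 : 0 < alpha by lra.
have [C C0 HC] := @annulus_power_le gamma alpha a0.
exists (2 * alpha * C * 2); first by rewrite !mulr_gt0.
move=> q u v N M D s j eta mu mv N0 M0 D0 e0 aq uN vM wD.
have mA := @measurable_annulus R n j.
set Lj := (_ ^ j) `^ _.
have m w' : measurable_fun setT w' ->
    measurable_fun setT (fun x : n.-tuple R => enorm x `^ gamma * `|w' x| `^ alpha).
  move=> mw'; apply: measurable_funM; last exact: measurable_normr_powR.
  apply: (@measurableT_comp _ _ _ _ _ _ (fun t : R => t `^ gamma)); first exact: measurable_powR.
  exact: measurable_enorm.
have m' w' : measurable_fun setT w' ->
    measurable_fun (annulus j) (fun x : n.-tuple R => enorm x `^ gamma * `|w' x| `^ alpha).
  by move=> mw'; apply: measurable_funTS; exact: m.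
have muv : measurable_fun setT (fun x => u x - v x) by exact: measurable_funB.
have p0 (w' : n.-tuple R -> R) x : 0 <= enorm x `^ gamma * `|w' x| `^ alpha.
  by rewrite mulr_ge0 ?powR_ge0.
have := HC q u N s j mu N0 aq uN; have := HC q v M s j mv M0 aq vM.
have := HC q _ D s j muv D0 aq wD; rewrite -/Lj => H3 H2 H1.
have H12 : (\int[lebn R n]_(x in annulus j)
    (enorm x `^ gamma * `|u x| `^ alpha + enorm x `^ gamma * `|v x| `^ alpha)%:E <=
    (1 * (C * Lj * N `^ alpha) + 1 * (C * Lj * M `^ alpha))%:E)%E.
  apply: (ge0_integral_le_add mA (m' u mu) (m' v mv)) => // x _; rewrite ?mul1r//.
  exact: addr_ge0.
set P := 2 * alpha.
have P0 : 0 < P by rewrite mulr_gt0.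
apply: (@le_trans _ _ (P * eta * (1 * (C * Lj * N `^ alpha) + 1 * (C * Lj * M `^ alpha)) +
    P * (2 * eta `^ (- (alpha - 1))) * (C * Lj * D `^ alpha))%:E).
  apply: (ge0_integral_le_add mA _ (m' _ muv) _ (fun x _ => p0 _ x) _ _ _ _ H12 H3) => //.
  - by apply: measurable_funD; exact: m'.
  - by move=> x _; exact: addr_ge0.
  - by rewrite mulr_ge0 ?(ltW P0) ?(ltW e0).
  - by rewrite !mulr_ge0 ?(ltW a0) ?powR_ge0.
  move=> x _; apply: le_trans (@NL_dist_le gamma alpha u v x a1) _; rewrite -/P.
  have c0 : 0 < alpha - 1 by lra.
  have := @young_power R `|u x| `|u x - v x| (alpha - 1) eta (normr_ge0 _) (normr_ge0 _) c0 e0.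
  have := @young_power R `|v x| `|u x - v x| (alpha - 1) eta (normr_ge0 _) (normr_ge0 _) c0 e0.
  rewrite subrK; move: (`|u x| `^ (alpha - 1)) (`|v x| `^ (alpha - 1)) (eta `^ _) => A B E h1 h2.
  have g0 := powR_ge0 (enorm x) gamma; move: (enorm x `^ gamma) g0 => g g0.
  rewrite [leRHS](_ : _ = P * (g * (eta * `|u x| `^ alpha + eta * `|v x| `^ alpha +
     2 * (E * `|u x - v x| `^ alpha)))); last by ring.
  apply: (ler_wpM2l (ltW P0)); apply: (ler_wpM2l g0); rewrite mulrDl; lra.
rewrite lee_fin.
have Lj0 : 0 <= Lj by exact: powR_ge0.
have E0 := powR_ge0 eta (- (alpha - 1)).
have N0' := powR_ge0 N alpha; have M0' := powR_ge0 M alpha; have D0' := powR_ge0 D alpha.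
move: (eta `^ _) (N `^ _) (M `^ _) (D `^ _) E0 N0' M0' D0' => E A B F E0 N0' M0' D0'.
have W : 0 <= P * C * Lj by rewrite !mulr_ge0 ?(ltW a0) ?(ltW C0).
rewrite [leLHS](_ : _ = P * C * Lj * (eta * (A + B) + 2 * E * F)); last by ring.
rewrite [leRHS](_ : _ = P * C * Lj * (2 * (eta * (A + B) + E * F))); last by ring.
rewrite ler_wpM2l//.
have : 0 <= eta * (A + B) by rewrite mulr_ge0 ?addr_ge0 ?(ltW e0).
lra.
Qed.

End annulus_estimates.

(** * Summing annuli against the bumps *)

Section annuli_sums.
Context (R : realType) (n : nat).
Hypothesis n0 : (0 < n)%N.
Implicit Types (g : n.-tuple R -> R) (e : int -> R) (M mu beta : R).

Lemma integral_enorm_gt0 (f : n.-tuple R -> \bar R) :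
  measurable_fun setT f -> (forall x, 0 <= f x)%E ->
  (\int[lebn R n]_x f x = \int[lebn R n]_(x in [set x | (0 < enorm x)%R]) f x)%E.
Proof.
move=> mf f0; pose N := [set x : n.-tuple R | enorm x <= 0].
rewrite (@ge0_negligible_integral _ _ _ _ _ N)//; last 2 first.
- exact: measurable_ball.
- exact: enorm_eq0_null.
congr integral; apply/seteqP; split => x /=; rewrite /N /=.
  by move=> [_ /negP]; rewrite -ltNge.
by move=> h; split => //; apply/negP; rewrite -ltNge.
Qed.

Definition sup_le e M : Prop := forall j, e j <= M.
Definition sum_le e M : Prop := forall K, zsum e K <= M.

(** With mu = 0 the bump is 1 and the pairing is the full integral. The factor 1 and the powers 0
    give the conclusion the shape of that of [annuli_sup_bump], with K = 1 and beta = 0. *)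
Lemma annuli_sum_bump g e M : measurable_fun setT g -> (forall x, 0 <= g x) ->
  (forall j, \int[lebn R n]_(x in annulus j) (g x)%:E <= (e j * ((2 : R) ^ j) `^ 0)%:E)%E ->
  sum_le e M ->
  forall i, (\int[lebn R n]_x (bump 0 ((2 : R) ^ i) x * g x)%:E <= (1 * M * ((2 : R) ^ i) `^ 0)%:E)%E.
Proof.
move=> mg g0 ge eM i; rewrite powRr0 mulr1 mul1r.
under eq_integral do rewrite /bump mulr0 oppr0 powRr0 mul1r.
rewrite integral_enorm_gt0; [|exact/measurable_EFinP|by move=> x; rewrite lee_fin].
apply: (@layers_cover R _ _ _ _ _ _ e) => //.
- exact: measurable_enorm.
- exact/measurable_EFinP.
- by move=> j; have := ge j; rewrite powRr0 mulr1.
Qed.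

(** On the annulus i + j the integral of g is at most M (2^i 2^j)^beta. Outwards the bump brings
    2^(-2 mu (j-1)) and the sum converges as beta < 2 mu; inwards the bump is only bounded by 1 and
    the sum converges as beta > 0. *)
Lemma annuli_sup_bump mu beta : 0 < beta -> beta < 2 * mu ->
  exists2 K : R, 0 < K & forall g e M, measurable_fun setT g -> (forall x, 0 <= g x) ->
    0 <= M ->
  (forall j, \int[lebn R n]_(x in annulus j) (g x)%:E <= (e j * ((2 : R) ^ j) `^ beta)%:E)%E ->
  sup_le e M ->
  forall i, (\int[lebn R n]_x (bump mu ((2 : R) ^ i) x * g x)%:E <=
     (K * M * ((2 : R) ^ i) `^ beta)%:E)%E.
Proof.
move=> b0 bm; pose d := 2 * mu - beta; have d0 : 0 < d by rewrite /d; lra.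
have mu0 : 0 <= mu by lra.
pose Gd : R := (1 - 2 `^ (- d))^-1; pose Gb : R := (1 - 2 `^ (- beta))^-1.
have Gd0 : 0 < Gd by exact: geometric_const_gt0.
have Gb0 : 0 < Gb by exact: geometric_const_gt0.
exists (2 `^ (2 * mu) * Gd + Gb); first by rewrite addr_gt0 ?mulr_gt0 ?powR_gt0.
move=> g e M mg g0 M0 ge eM i.
pose L : R := 2 ^ i; have L0 : 0 < L by exact: exprz_gt0.
have mbg : measurable_fun setT (fun x : n.-tuple R => bump mu L x * g x).
  by apply: measurable_funM => //; exact: measurable_bump.
have bg0 x : 0 <= bump mu L x * g x by rewrite mulr_ge0 ?bump_ge0.
rewrite integral_enorm_gt0; [|exact/measurable_EFinP|by move=> x; rewrite lee_fin].
have -> : [set x : n.-tuple R | 0 < enorm x] = [set x | 0 < enorm x / L].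
  by apply/seteqP; split => x /=; rewrite pmulr_lgt0 ?invr_gt0.
pose e' (j : int) : R := M * L `^ beta * (match j with
  | Posz k => 2 `^ (2 * mu) * 2 `^ (- (d * k%:R))
  | Negz k => 2 `^ (- (beta * k%:R)) end).
apply: (@layers_cover R _ _ _ _ _ _ e') => //.
- by apply: measurable_funM => //; exact: measurable_enorm.
- exact/measurable_EFinP.
- move=> j.
  have -> : [set x : n.-tuple R | 2 ^ (j - 1) <= enorm x / L < 2 ^ j] = annulus (i + j).
    have E1 : (2 : R) ^ (i + j) = 2 ^ j * L by rewrite expfzDr ?pnatr_eq0// mulrC.
    have E2 : (2 : R) ^ (i + j - 1) = 2 ^ (j - 1) * L.
      by rewrite -addrA expfzDr ?pnatr_eq0// mulrC.
    by rewrite /annulus E1 E2; apply/seteqP; split => x /=; rewrite ler_pdivlMr// ltr_pdivrMr.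
  pose c : R := if j is Posz _ then 2 `^ (- (2 * mu * (j - 1)%:~R)) else 1.
  have c0 : 0 <= c by rewrite /c; case: (j) => k; rewrite ?powR_ge0.
  apply: (@le_trans _ _ (c * (M * ((2 : R) ^ (i + j)) `^ beta))%:E).
    apply: (ge0_integral_le_scale (measurable_annulus _) (f := g)) => //.
    - exact: measurable_funTS.
    - move=> x /= /andP[h1 _]; rewrite ler_wpM2r// /c; case: j c c0 h1 => [k|k] c c0 h1.
        have y0 : 0 < 2 ^ (Posz k - 1) :> R by exact: exprz_gt0.
        have h2 : (2 : R) ^ (Posz k - 1) <= enorm x / L.
          by rewrite ler_pdivlMr// mulrC -expfzDr ?pnatr_eq0// addrA.
        rewrite /bump -powR_intmul// in h2 *.
        rewrite (_ : - (2 * mu * (Posz k - 1)%:~R) = (Posz k - 1)%:~R * - (2 * mu)); last by ring.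
        rewrite powRrM !powRN lef_pV2 ?posrE ?powR_gt0 ?ltr_wpDr ?divr_ge0 ?enorm_ge0 ?(ltW L0)//.
        rewrite ge0_ler_powR ?nnegrE ?powR_ge0 ?mulr_ge0 ?addr_ge0 ?divr_ge0 ?enorm_ge0 ?(ltW L0)//.
        by apply: le_trans h2 _; rewrite lerDr.
      exact: bump_le1.
    - apply: le_trans (ge _) _; rewrite lee_fin ler_wpM2r ?powR_ge0//; exact: eM.
  rewrite lee_fin /e' expfzDr ?pnatr_eq0// -/L powRM ?(ltW L0) ?exprz_ge0//.
  rewrite mulrCA -!mulrA ler_wpM2l// [c * _]mulrCA ler_wpM2l ?powR_ge0//.
  rewrite -powR_intmul// -powRrM /c; case: (j) => k.
    rewrite -powRD ?pnatr_eq0 ?implybT// -powRD ?pnatr_eq0 ?implybT//.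
    rewrite ler_powR ?ler1n// intrD intrN -[(Posz k)%:~R]/(k%:R : R) /d; lra.
  rewrite mul1r ler_powR ?ler1n//= NegzE intrN -[(Posz k.+1)%:~R]/(k.+1%:R : R) -natr1; lra.
- move=> K; rewrite /e' zsumZ -/L [leRHS](_ : _ = M * L `^ beta * (2 `^ (2 * mu) * Gd + Gb)); last by ring.
  rewrite ler_wpM2l ?mulr_ge0 ?powR_ge0// /zsum big_split /= lerD//.
    by rewrite -mulr_sumr ler_wpM2l ?powR_ge0// geometric_powR_le.
  exact: geometric_powR_le.
Qed.

End annuli_sums.

(** * Paths into L^1 of the annuli and measurability of their heat flow *)

Section paths.
Context (R : realType) (n : nat).
Hypothesis n0 : (0 < n)%N.
Local Notation X := (n.-tuple R).
Local Notation TR := (measurableTypeR R).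
Implicit Types (h g : R -> X -> R) (t tau : R).

(** Continuity on each annulus separately, with nothing uniform in j; it stands in for measurability
    in (tau, x) jointly. *)
Definition L1loc_path h : Prop :=
  [/\ forall tau, measurable_fun setT (h tau),
      forall tau j, (\int[lebn R n]_(x in annulus j) `|h tau x|%:E < +oo)%E &
      forall tau j e, 0 < e -> exists2 d, 0 < d & forall tau', `|tau' - tau| < d ->
        (\int[lebn R n]_(x in annulus j) `|h tau' x - h tau x|%:E <= e%:E)%E].

Lemma L1loc_path_lip h g : L1loc_path h -> (forall tau, measurable_fun setT (g tau)) ->
  (forall tau x, `|g tau x| <= `|h tau x|) ->
  (forall tau tau' x, `|g tau' x - g tau x| <= `|h tau' x - h tau x|) -> L1loc_path g.
Proof.
move=> [mh fh ch] mg gh dgh; split=> // [tau j|tau j e e0].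
  apply: le_lt_trans (fh tau j).
  by apply: ge0_le_integral_nonmeas => x _; rewrite lee_fin.
have [d d0 H] := ch tau j e e0; exists d => // tau' /H; apply: le_trans.
by apply: ge0_le_integral_nonmeas => x _; rewrite lee_fin.
Qed.

Lemma L1loc_path_sub h g : L1loc_path h -> L1loc_path g ->
  L1loc_path (fun tau x => h tau x - g tau x).
Proof.
move=> [mh fh ch] [mg fg cg]; split=> [tau|tau j|tau j e e0]; first exact: measurable_funB.
  have mA := @measurable_annulus R n j.
  apply: (@le_lt_trans _ _ (\int[lebn R n]_(x in annulus j) (`|h tau x|%:E + `|g tau x|%:E))%E).
    by apply: ge0_le_integral_nonmeas => x _; rewrite -?EFinD lee_fin// ler_normB.
  rewrite ge0_integralD//; first exact: lte_add_pinfty.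
  - by apply/measurable_EFinP; apply: measurable_funTS; exact: measurableT_comp.
  - by apply/measurable_EFinP; apply: measurable_funTS; exact: measurableT_comp.
have [d1 d10 H1] := ch tau j (e / 2) (divr_gt0 e0 (ltr0n _ 2)).
have [d2 d20 H2] := cg tau j (e / 2) (divr_gt0 e0 (ltr0n _ 2)).
exists (Num.min d1 d2); first by rewrite lt_min d10.
move=> tau'; rewrite lt_min => /andP[/H1 h1 /H2 h2].
have mA := @measurable_annulus R n j.
rewrite (_ : e = 1 * (e / 2) + 1 * (e / 2)); last by field.
apply: (ge0_integral_le_add mA _ _ _ _ _ _ _ _ h1 h2) => //.
- by apply: measurable_funTS; apply: measurableT_comp => //; exact: measurable_funB.
- by apply: measurable_funTS; apply: measurableT_comp => //; exact: measurable_funB.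
move=> x _; rewrite !mul1r.
rewrite (_ : _ - _ = (h tau' x - h tau x) - (g tau' x - g tau x)); last by ring.
exact: ler_normB.
Qed.

Definition step_time (i : nat) tau : R := (Num.floor (tau * i.+1%:R))%:~R / i.+1%:R.

Lemma step_time_close i tau : `|step_time i tau - tau| <= i.+1%:R^-1.
Proof.
have m0 : (0 : R) < i.+1%:R by rewrite ltr0n.
have /andP[h1 h2] := floor_itv (tau * i.+1%:R).
rewrite /step_time -[X in _ - X](mulfK (lt0r_neq0 m0)) -mulrBl normrM.
rewrite [`|_^-1|]ger0_norm ?invr_ge0 ?(ltW m0)// -[leRHS]mul1r ler_wpM2r ?invr_ge0 ?(ltW m0)//.
by rewrite ler_norml; move: h2; rewrite intrD => h2; lra.
Qed.

Lemma measurable_step h i : (forall tau, measurable_fun setT (h tau)) ->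
  measurable_fun setT (fun p : TR * X => h (step_time i p.1) p.2).
Proof.
move=> mh _ B mB; rewrite setTI.
have m0 : (0 : R) < i.+1%:R by rewrite ltr0n.
pose E (k : int) : set TR := `[(k%:~R / i.+1%:R : R), ((k + 1)%:~R / i.+1%:R : R)[%classic.
have EP k tau : E k tau <-> Num.floor (tau * i.+1%:R) = k.
  rewrite /E /= in_itv /= ler_pdivrMr// ltr_pdivlMr//.
  by split=> [/floor_def//|<-]; exact: floor_itv.
rewrite (_ : _ @^-1` B = \bigcup_(k in [set: int]) (E k `*` (h (k%:~R / i.+1%:R) @^-1` B))).
  apply: countable_bigcupT_measurable => // k; apply: measurableX; first exact: measurable_itv.
  by rewrite -[X in measurable X]setTI; exact: mh.
apply/seteqP; split => [[tau x] /= Bx|[tau x] [k _ [/= /EP Ek Bx]]].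
  by exists (Num.floor (tau * i.+1%:R)) => //; split => //=; exact/EP.
by rewrite /= /step_time Ek.
Qed.

(* The time is truncated at [0], where the heat kernel vanishes, so that [flow]
   makes sense, and is measurable, for all [tau]. *)
Definition flow t h tau x : \bar R :=
  (\int[lebn R n]_y (heat_kernel (Num.max 0 (t - tau)) (tsub x y) * h tau y)%:E)%E.

Lemma flow_ge0 t h tau x : (forall y, 0 <= h tau y) -> (0 <= flow t h tau x)%E.
Proof. by move=> h0; apply: integral_ge0 => y _; rewrite lee_fin mulr_ge0 ?heat_kernel_ge0. Qed.

Definition layer_flow t h (j : int) tau x : \bar R :=
  (\int[lebn R n]_(y in annulus j) (heat_kernel (Num.max 0 (t - tau)) (tsub x y) * h tau y)%:E)%E.

Lemma measurable_heat_kernel_mul t h tau x : measurable_fun setT (h tau) ->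
  measurable_fun setT (fun y : X => heat_kernel (Num.max 0 (t - tau)) (tsub x y) * h tau y).
Proof. by move=> mh; apply: measurable_funM => //; exact: measurable_heat_kernel. Qed.

Lemma measurable_layer_flow_step t h i j : (forall tau, measurable_fun setT (h tau)) ->
  (forall tau y, 0 <= h tau y) ->
  measurable_fun setT (fun p : TR * X =>
    (\int[lebn R n]_(y in annulus j)
       (heat_kernel (Num.max 0 (t - p.1)) (tsub p.2 y) * h (step_time i p.1) y)%:E)%E).
Proof.
move=> mh h0; under eq_fun do rewrite integral_annulus_indic.
pose F (z : (TR * X) * X) : \bar R :=
  (heat_kernel (Num.max 0 (t - z.1.1)) (tsub z.1.2 z.2) * h (step_time i z.1.1) z.2 *
    \1_(annulus j) z.2)%:E.
apply: (@measurable_fun_fubini_tonelli_F _ _ _ _ R (lebn R n) F).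
- apply/measurable_EFinP; apply: measurable_funM.
    apply: measurable_funM.
      apply: measurable_heat_kernel.
      + apply: measurable_maxr => //; apply: measurable_funB => //.
        exact: (measurableT_comp (@measurable_fst _ _ TR X) (@measurable_fst _ _ (TR * X)%type X)).
      + exact: (measurableT_comp (@measurable_snd _ _ TR X) (@measurable_fst _ _ (TR * X)%type X)).
      + exact: measurable_snd.
    have m2 : measurable_fun setT (fun z : (TR * X) * X => (z.1.1, z.2)).
      apply/measurable_fun_pairP; split.
        exact: (measurableT_comp (@measurable_fst _ _ TR X) (@measurable_fst _ _ (TR * X)%type X)).
      exact: measurable_snd.
    have m1 := measurable_step i mh.
    exact: (measurableT_comp m1 m2).
  apply: (@measurableT_comp _ _ _ _ _ _ (\1_(annulus j) : X -> R)).
    by apply: measurable_indic; exact: measurable_annulus.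
  exact: measurable_snd.
- move=> z; rewrite lee_fin; apply: mulr_ge0 => //; apply: mulr_ge0 => //.
  exact: heat_kernel_ge0.
Qed.

Lemma measurable_layer_flow t h j : L1loc_path h -> (forall tau y, 0 <= h tau y) ->
  measurable_fun setT (fun p : TR * X => layer_flow t h j p.1 p.2).
Proof.
move=> [mh fh ch] h0.
have mA := @measurable_annulus R n j.
apply: (@emeasurable_fun_cvg _ _ _ _ (fun i (p : TR * X) =>
  (\int[lebn R n]_(y in annulus j)
       (heat_kernel (Num.max 0 (t - p.1)) (tsub p.2 y) * h (step_time i p.1) y)%:E)%E)).
  by move=> i; exact: measurable_layer_flow_step.
move=> [tau x] _ /=; rewrite /layer_flow.
set s := Num.max 0 (t - tau); have s0 : 0 <= s by rewrite le_max lexx.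
(* The bound depends on the lag, which is harmless for a pointwise limit. *)
have [k k0 kP] : exists2 k : R, 0 < k & forall z : X, heat_kernel s z <= k.
  have [->|sn0] := eqVneq s 0; first by exists 1 => // z; rewrite heat_kernel_time0// ler01.
  have {}s0 : 0 < s by rewrite lt_neqAle eq_sym sn0.
  by exists (s `^ (- (n%:R / 2))) => [|z]; [exact: powR_gt0|exact: heat_kernel_le].
pose I tau' := (\int[lebn R n]_(y in annulus j) (heat_kernel s (tsub x y) * h tau' y)%:E)%E.
have mI tau' : measurable_fun setT (fun y : X => heat_kernel s (tsub x y) * h tau' y).
  by apply: measurable_funM => //; exact: measurable_heat_kernel.
have I0 tau' : (0 <= I tau')%E.
  by apply: integral_ge0 => y _; rewrite lee_fin mulr_ge0 ?heat_kernel_ge0.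
have mabs (g : X -> R) : measurable_fun setT g ->
    measurable_fun (annulus j) (fun y : X => `|g y|).
  by move=> mg; apply: measurable_funTS; exact: measurableT_comp.
have Ifin tau' : I tau' \is a fin_num.
  have hfin : (\int[lebn R n]_(x in annulus j) `|h tau' x|%:E)%E \is a fin_num.
    by rewrite ge0_fin_numE//; apply: integral_ge0 => y _; rewrite lee_fin.
  rewrite ge0_fin_numE//.
  apply: le_lt_trans (ltry (k * fine (\int[lebn R n]_(x in annulus j) `|h tau' x|%:E)%E)).
  apply: (ge0_integral_le_scale mA (mabs _ (mh tau'))) => //; last by rewrite fineK.
  - exact: ltW.
  - by move=> y _; rewrite mulr_ge0 ?heat_kernel_ge0.
  - by move=> y _; rewrite ger0_norm// ler_wpM2r.
have Ile a b e : (\int[lebn R n]_(x in annulus j) `|h a x - h b x|%:E <= e%:E)%E ->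
    fine (I a) <= fine (I b) + k * e.
  move=> he; rewrite -lee_fin fineK// -[fine (I b)]mul1r.
  apply: (@ge0_integral_le_add _ _ _ _ _ (fun y => heat_kernel s (tsub x y) * h b y)
    (fun y => `|h a y - h b y|)) => //.
  - exact: measurable_funTS.
  - by apply: mabs; exact: measurable_funB.
  - by move=> y _; rewrite mulr_ge0 ?heat_kernel_ge0.
  - exact: ltW.
  - by move=> y _; rewrite mulr_ge0 ?heat_kernel_ge0.
  - move=> y _; rewrite mul1r -lerBlDl -mulrBr.
    apply: le_trans (ler_norm _) _; rewrite normrM ger0_norm ?heat_kernel_ge0//.
    exact: ler_wpM2r.
  - by rewrite fineK.
have Idist tau' e : (\int[lebn R n]_(x in annulus j) `|h tau' x - h tau x|%:E <= e%:E)%E ->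
    `|fine (I tau) - fine (I tau')| <= k * e.
  move=> he; have h1 := Ile _ _ _ he.
  have h2 : fine (I tau) <= fine (I tau') + k * e.
    by apply: Ile; under eq_integral do rewrite distrC.
  by rewrite ler_norml; lra.
suff : (fun i => (fine (I (step_time i tau)))%:E) @ \oo --> (fine (I tau))%:E.
  by rewrite fineK//; apply: cvg_trans; apply: near_eq_cvg; apply: nearW => i; rewrite fineK.
apply: cvg_EFin; first by apply: nearW => i.
apply/cvgrPdist_le => e e0.
have [d d0 H] := ch tau j (e / k) (divr_gt0 e0 k0).
have [i0 _ Hi0] := near_infty_natSinv_lt (PosNum d0).
near=> i.
rewrite -[leRHS](divfK (lt0r_neq0 k0)) mulrC; apply: Idist; apply: H.
apply: le_lt_trans (step_time_close i tau) _; apply: (Hi0 i).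
by near: i; exists i0.
Unshelve. all: by end_near. Qed.

Lemma measurable_flow t h : L1loc_path h -> (forall tau y, 0 <= h tau y) ->
  measurable_fun setT (fun p : TR * X => flow t h p.1 p.2).
Proof.
move=> Lh h0; have [mh _ _] := Lh.
rewrite (_ : (fun p : TR * X => _) = fun p : TR * X => (\sum_(0 <= k <oo)
    (layer_flow t h (Posz k) p.1 p.2 + layer_flow t h (Negz k) p.1 p.2))%E).
  apply: ge0_emeasurable_sum.
    by move=> k p _ _; apply: adde_ge0; apply: integral_ge0 => y _;
      rewrite lee_fin mulr_ge0 ?heat_kernel_ge0.
  by move=> k _; apply: emeasurable_funD; exact: measurable_layer_flow.
apply/funext => -[tau x] /=; rewrite /flow integral_enorm_gt0//.
- rewrite integral_layers//; first exact: measurable_enorm.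
    by apply/measurable_EFinP; exact: measurable_heat_kernel_mul.
  by move=> y; rewrite lee_fin mulr_ge0 ?heat_kernel_ge0.
- by apply/measurable_EFinP; exact: measurable_heat_kernel_mul.
- by move=> y; rewrite lee_fin mulr_ge0 ?heat_kernel_ge0.
Qed.

End paths.

Lemma mul_maxr0 (R : realType) (k a : R) : 0 <= k -> k * Num.max a 0 = Num.max (k * a) 0.
Proof. by move=> k0; rewrite maxr_pMr// mulr0. Qed.

(** * Difference of two Duhamel integrals *)

Section duhamel.
Context (R : realType) (n : nat).
Hypothesis n0 : (0 < n)%N.
Local Notation X := (n.-tuple R).
Local Notation TR := (measurableTypeR R).
Implicit Types (h : R -> X -> R) (t tau : R) (x : X).

Lemma measurable_flow_time t h x : L1loc_path h -> (forall tau y, 0 <= h tau y) ->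
  measurable_fun setT (fun tau : TR => flow t h tau x).
Proof.
move=> Lh h0; exact: (measurableT_comp (measurable_flow n0 t Lh h0) (pair2_measurable x)).
Qed.

Lemma L1loc_path_norm h : L1loc_path h -> L1loc_path (fun tau y => `|h tau y|).
Proof.
move=> Lh; have [mh _ _] := Lh; apply: (L1loc_path_lip Lh) => // [tau|tau y|tau tau' y].
- exact: measurableT_comp.
- by rewrite normr_id.
- exact: ler_dist_dist.
Qed.

Lemma L1loc_path_pos h : L1loc_path h -> L1loc_path (fun tau y => Num.max (h tau y) 0).
Proof.
move=> Lh; have [mh _ _] := Lh; apply: (L1loc_path_lip Lh) => // [tau|tau y|tau tau' y].
- exact: measurable_maxr.
- by case: (leP (h tau y) 0) => [|/ltW] H; rewrite ?normr0.
- case: (leP (h tau y) 0) => H; case: (leP (h tau' y) 0) => H'; rewrite ler_norml;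
  case: (ler0P (h tau' y - h tau y)) => H''; apply/andP; split; lra.
Qed.

Lemma L1loc_path_neg h : L1loc_path h -> L1loc_path (fun tau y => Num.max (- h tau y) 0).
Proof.
move=> Lh; apply: (@L1loc_path_pos (fun tau y => - h tau y)).
have [mh _ _] := Lh; apply: (L1loc_path_lip Lh) => // [tau|tau y|tau tau' y].
- exact: measurableT_comp.
- by rewrite normrN.
- by rewrite -opprD normrN.
Qed.

(** Measurability of the flow is established for nonnegative paths, hence the two parts. Where both
    are infinite the value is a convention; under absolute convergence this concerns only a null set
    of times. *)
Definition signed_flow t h tau x : \bar R :=
  (flow t (fun tau y => Num.max (h tau y) 0%R) tau x -
   flow t (fun tau y => Num.max (- h tau y)%R 0%R) tau x)%E.

Lemma measurable_signed_flow_time t h x : L1loc_path h ->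
  measurable_fun setT (fun tau : TR => signed_flow t h tau x).
Proof.
move=> Lh; apply: emeasurable_funB.
  by apply: measurable_flow_time => [|tau y]; [exact: L1loc_path_pos|rewrite le_max lexx orbT].
by apply: measurable_flow_time => [|tau y]; [exact: L1loc_path_neg|rewrite le_max lexx orbT].
Qed.

Lemma integrable_heat_mul t h tau x : L1loc_path h ->
  (flow t (fun tau y => `|h tau y|%R) tau x < +oo)%E ->
  (lebn R n).-integrable setT
    (fun y => (heat_kernel (Num.max 0 (t - tau)) (tsub x y) * h tau y)%:E).
Proof.
move=> [mh _ _] foo; apply/integrableP; split.
  by apply/measurable_EFinP; exact: measurable_heat_kernel_mul.
apply: le_lt_trans foo; rewrite /flow le_eqVlt; apply/orP; left; apply/eqP.
apply: eq_integral => y _ /=; congr EFin.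
by rewrite normrM ger0_norm ?heat_kernel_ge0.
Qed.

(** The integral is by definition the difference of those of the positive and negative parts, and
    multiplication by the nonnegative kernel respects these parts. *)
Lemma signed_flowE t h tau x :
  signed_flow t h tau x =
  (\int[lebn R n]_y (heat_kernel (Num.max 0 (t - tau)) (tsub x y) * h tau y)%:E)%E.
Proof.
rewrite [RHS]integralE; congr (_ - _)%E; apply: eq_integral => y _.
  by rewrite mul_maxr0 ?heat_kernel_ge0// EFin_max funeposE.
by rewrite mul_maxr0 ?heat_kernel_ge0// mulrN EFin_max funenegE.
Qed.

Lemma heat_signed_flow t h tau x : L1loc_path h -> 0 <= tau <= t ->
  (flow t (fun tau y => `|h tau y|%R) tau x < +oo)%E ->
  heat (t - tau) (h tau) x = signed_flow t h tau x.
Proof.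
move=> Lh /andP[tau0 taut] /(integrable_heat_mul Lh) ih.
rewrite signed_flowE -iint_integrable// /heat.
by rewrite max_r// subr_ge0.
Qed.

Lemma flow_norm_iint t h tau x : L1loc_path h -> 0 <= tau <= t ->
  iint (fun y => `|heat_kernel (t - tau) (tsub x y) * h tau y|%:E) =
  flow t (fun tau y => `|h tau y|) tau x.
Proof.
move=> [mh _ _] /andP[tau0 taut]; rewrite iintE.
- rewrite /flow max_r ?subr_ge0//; apply: eq_integral => y _.
  by rewrite normrM ger0_norm ?heat_kernel_ge0.
- apply/measurable_EFinP; apply: measurableT_comp => //; apply: measurable_funM => //.
  exact: measurable_heat_kernel.
- by move=> y; rewrite lee_fin.
Qed.

Section signed_integral.
Context (t : R) (h : R -> X -> R) (x : X).
Hypothesis Lh : L1loc_path h.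
Hypothesis fin : (\int[@lebesgue_measure R]_(tau in `[0%R, t])
  iint (fun y => `|heat_kernel (t - tau) (tsub x y) * h tau y|%:E) < +oo)%E.

Let F tau := flow t (fun tau y => `|h tau y|) tau x.

Let mF : measurable_fun setT (F : TR -> \bar R).
Proof. by apply: measurable_flow_time; [exact: L1loc_path_norm|]. Qed.

Let F0 tau : (0 <= F tau)%E. Proof. by apply: flow_ge0. Qed.

Lemma integrable_flow_norm : (@lebesgue_measure R).-integrable `[0, t] F.
Proof.
apply/integrableP; split; first exact: measurable_funTS.
apply: le_lt_trans fin; rewrite le_eqVlt; apply/orP; left; apply/eqP.
apply: eq_integral => tau; rewrite inE /= in_itv /= => ht.
by rewrite flow_norm_iint// gee0_abs.
Qed.

Lemma ae_flow_norm_finite : exists N : set TR,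
  [/\ measurable N, lebesgue_measure N = 0%E & forall tau, 0 <= tau <= t -> ~ N tau -> (F tau < +oo)%E].
Proof.
have mI : measurable (`[0, t]%classic : set TR) by exact: measurable_itv.
have [N [mN N0 NP]] := integrable_ae mI integrable_flow_norm.
exists N; split => // tau ht Ntau.
have : F tau \is a fin_num.
  apply: contrapT => h'; apply: Ntau; apply: NP => /= H; apply: h'; apply: H.
  by rewrite /= in_itv.
by rewrite ge0_fin_numE.
Qed.

Lemma integrable_signed_flow : (@lebesgue_measure R).-integrable `[0, t] (signed_flow t h ^~ x).
Proof.
apply: le_integrable (integrable_flow_norm) => //.
  by apply: measurable_funTS; exact: measurable_signed_flow_time.
move=> tau _; rewrite [leRHS]gee0_abs// signed_flowE.
have [mh _ _] := Lh.
apply: le_trans (le_abse_integral _ _ _) _ => //.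
  by apply/measurable_EFinP; exact: measurable_heat_kernel_mul.
rewrite /F /flow; apply: ge0_le_integral_nonmeas => y _ //.
by rewrite lee_fin normrM ger0_norm ?heat_kernel_ge0.
Qed.

(** [heat] is an [iint], identified with the signed flow where the slice is integrable; by absolute
    convergence that is almost every tau, so the integrands agree off a null set. *)
Lemma integral_heat_signed_flow :
  (\int[@lebesgue_measure R]_(tau in `[0%R, t]) heat (t - tau) (h tau) x =
   \int[@lebesgue_measure R]_(tau in `[0%R, t]) signed_flow t h tau x)%E.
Proof.
have [N [mN N0 NP]] := ae_flow_norm_finite.
have mI : measurable (`[0, t]%classic : set TR) by exact: measurable_itv.
apply: (eq_integral_off_null mI mN N0).
  by apply: measurable_funTS; exact: measurable_signed_flow_time.
move=> tau; rewrite /= in_itv /= => ht Ntau.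
by apply: heat_signed_flow => //; exact: NP.
Qed.

End signed_integral.

(** Linearity is used twice, in tau and, for almost every tau, in y. The finiteness of both
    integrals is what later allows the common linear term to be cancelled. *)
Lemma duhamel_dist_le t h1 h2 x : L1loc_path h1 -> L1loc_path h2 ->
  (\int[@lebesgue_measure R]_(tau in `[0%R, t])
    iint (fun y => `|heat_kernel (t - tau) (tsub x y) * h1 tau y|%:E) < +oo)%E ->
  (\int[@lebesgue_measure R]_(tau in `[0%R, t])
    iint (fun y => `|heat_kernel (t - tau) (tsub x y) * h2 tau y|%:E) < +oo)%E ->
  [/\ (\int[@lebesgue_measure R]_(tau in `[0%R, t]) heat (t - tau) (h1 tau) x)%E \is a fin_num,
      (\int[@lebesgue_measure R]_(tau in `[0%R, t]) heat (t - tau) (h2 tau) x)%E \is a fin_num &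
      (`|\int[@lebesgue_measure R]_(tau in `[0%R, t]) heat (t - tau) (h1 tau) x -
        \int[@lebesgue_measure R]_(tau in `[0%R, t]) heat (t - tau) (h2 tau) x| <=
       \int[@lebesgue_measure R]_(tau in `[0%R, t])
         flow t (fun tau y => `|h1 tau y - h2 tau y|%R) tau x)%E].
Proof.
move=> L1 L2 f1 f2; rewrite !integral_heat_signed_flow//.
have i1 := integrable_signed_flow L1 f1; have i2 := integrable_signed_flow L2 f2.
split; [exact: integrable_fin_num|exact: integrable_fin_num|].
have mI : measurable (`[0, t]%classic : set TR) by exact: measurable_itv.
rewrite -integralB//.
have m1 := measurable_signed_flow_time t x L1; have m2 := measurable_signed_flow_time t x L2.
have m12 : measurable_fun setT (fun tau : TR => signed_flow t h1 tau x - signed_flow t h2 tau x)%E.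
  exact: emeasurable_funB.
have L12 := L1loc_path_sub L1 L2.
apply: le_trans (le_abse_integral _ _ _) _ => //; first exact: measurable_funTS.
have [N1 [mN1 N10 N1P]] := ae_flow_norm_finite L1 f1.
have [N2 [mN2 N20 N2P]] := ae_flow_norm_finite L2 f2.
apply: ae_ge0_le_integral => //.
- by apply: measurable_funTS; exact: measurableT_comp.
- by move=> tau _; apply: flow_ge0.
- by apply: measurable_funTS; apply: measurable_flow_time => //; exact: L1loc_path_norm.
have A1 : {ae @lebesgue_measure R, forall tau : TR, ~ N1 tau} by exists N1; split => // z /= /contrapT.
have A2 : {ae @lebesgue_measure R, forall tau : TR, ~ N2 tau} by exists N2; split => // z /= /contrapT.
apply: filterS2 A1 A2 => tau h1' h2'; rewrite /= in_itv /= => ht.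
rewrite !signed_flowE.
have j1 := integrable_heat_mul L1 (N1P _ ht h1'); have j2 := integrable_heat_mul L2 (N2P _ ht h2').
rewrite -integralB//.
have [mh1 _ _] := L1; have [mh2 _ _] := L2.
apply: le_trans (le_abse_integral _ _ _) _ => //.
  by apply: emeasurable_funB; apply/measurable_EFinP; exact: measurable_heat_kernel_mul.
rewrite /flow; apply: ge0_le_integral_nonmeas => y _ //.
by rewrite -EFinB lee_fin -mulrBr normrM ger0_norm ?heat_kernel_ge0.
Qed.

End duhamel.

(** * Pairing a potential with the heat flow *)

Section pairing.
Context (R : realType) (n : nat).
Hypothesis n0 : (0 < n)%N.
Local Notation X := (n.-tuple R).
Local Notation TR := (measurableTypeR R).
Local Open Scope ereal_scope.

(** Tonelli's theorem in (x, y) moves the heat kernel from [g] onto the potential cut off to [D],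
    where the pointwise bound [B] is available. *)
Lemma layer_pairing_le (V : X -> R) (g : X -> R) (D : set X) (sg : R) (B : X -> R) :
  measurable D -> measurable_fun setT V -> (forall x, 0 <= V x)%R ->
  measurable_fun setT g -> (forall x, 0 <= g x)%R ->
  (forall y, \int[lebn R n]_(x in D) (V x * heat_kernel sg (tsub x y))%:E <= (B y)%:E) ->
  \int[lebn R n]_(x in D) ((V x)%:E * \int[lebn R n]_y (heat_kernel sg (tsub x y) * g y)%:E)
    <= \int[lebn R n]_y (B y * g y)%:E.
Proof.
move=> mD mV V0 mg g0 HB.
pose W (z : X * X) : \bar R :=
  (V z.1 * \1_D z.1 * (heat_kernel sg (tsub z.1 z.2) * g z.2))%:E.
have W0 z : 0 <= W z.
  by rewrite lee_fin; apply: mulr_ge0; apply: mulr_ge0 => //; exact: heat_kernel_ge0.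
have m1 : measurable_fun setT (fun z : X * X => z.1) by exact: measurable_fst.
have m2 : measurable_fun setT (fun z : X * X => z.2) by exact: measurable_snd.
have mW : measurable_fun setT W.
  apply/measurable_EFinP; apply: measurable_funM.
    apply: measurable_funM; first exact: (measurableT_comp mV m1).
    apply: (@measurableT_comp _ _ _ _ _ _ (\1_D : X -> R)) => //.
  apply: measurable_funM; last exact: (measurableT_comp mg m2).
  exact: measurable_heat_kernel.
rewrite [leLHS](_ : _ = \int[lebn R n]_x \int[lebn R n]_y W (x, y)); last first.
  rewrite integral_mkcond; apply: eq_integral => x _; rewrite patchE.
  have mG : measurable_fun setT (fun y : X => heat_kernel sg (tsub x y) * g y)%R.
    by apply: measurable_funM => //; exact: measurable_heat_kernel.
  case: ifPn => [/set_mem Dx|Dx].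
    rewrite -ge0_integralZl ?lee_fin//.
    - by apply: eq_integral => y _; rewrite /W /= indicE mem_set// mulr1 EFinM.
    - exact/measurable_EFinP.
    - by move=> y _; rewrite lee_fin mulr_ge0 ?heat_kernel_ge0.
  by rewrite integral0_eq// => y _; rewrite /W /= indicE (negbTE Dx) mulr0 mul0r.
rewrite (@fubini_tonelli _ _ _ _ R (lebn R n) (lebn R n) W mW W0).
apply: ge0_le_integral_nonmeas => y _; first by apply: integral_ge0.
rewrite mulrC EFinM.
apply: le_trans (lee_wpmul2l _ (HB y)); last by rewrite lee_fin.
rewrite -ge0_integralZl ?lee_fin//; last 2 first.
- apply/measurable_EFinP; apply: measurable_funTS; apply: measurable_funM => //.
  exact: measurable_heat_kernel.
- by move=> x _; rewrite lee_fin mulr_ge0 ?heat_kernel_ge0.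
rewrite integral_mkcond; apply: ge0_le_integral_nonmeas => x _; first exact: W0.
rewrite patchE /W /= indicE; case: ifPn => Dx.
  by rewrite mulr1 -EFinM lee_fin mulrA [leRHS]mulrC.
by rewrite mulr0 mul0r.
Qed.

(** Tonelli's theorem in (tau, x): this is where the joint measurability of the flow enters. *)
Lemma path_pairing_le t (V : X -> R) (g : R -> X -> R) (D : set X) (b : R -> \bar R) :
  measurable D -> measurable_fun setT V -> (forall x, 0 <= V x)%R ->
  L1loc_path g -> (forall tau y, 0 <= g tau y)%R ->
  (forall tau, (0 <= tau <= t)%R ->
     \int[lebn R n]_(x in D) ((V x)%:E * flow t g tau x) <= b tau) ->
  \int[lebn R n]_(x in D) ((V x)%:E * \int[@lebesgue_measure R]_(tau in `[0%R, t]) flow t g tau x)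
    <= \int[@lebesgue_measure R]_(tau in `[0%R, t]) b tau.
Proof.
move=> mD mV V0 Lg g0 Hb.
have mI : measurable (`[0%R, t]%classic : set TR) by exact: measurable_itv.
pose W (z : TR * X) : \bar R :=
  (V z.2 * \1_D z.2 * \1_(`[0%R, t]%classic) z.1)%:E * flow t g z.1 z.2.
have F0 tau x : 0 <= flow t g tau x by exact: flow_ge0.
have W0 z : 0 <= W z.
  by apply: mule_ge0; [rewrite lee_fin; do 2! apply: mulr_ge0 => //|exact: F0].
have m1 : measurable_fun setT (fun z : TR * X => z.1) by exact: measurable_fst.
have m2 : measurable_fun setT (fun z : TR * X => z.2) by exact: measurable_snd.
have mW : measurable_fun setT W.
  apply: emeasurable_funM; last exact: measurable_flow.
  apply/measurable_EFinP; apply: measurable_funM.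
    apply: measurable_funM; first exact: (measurableT_comp mV m2).
    exact: (@measurableT_comp _ _ _ _ _ _ (\1_D : X -> R)).
  exact: (@measurableT_comp _ _ _ _ _ _ (\1_(`[0%R, t]%classic) : TR -> R)).
rewrite [leLHS](_ : _ = \int[lebn R n]_x \int[@lebesgue_measure R]_tau W (tau, x)); last first.
  rewrite integral_mkcond; apply: eq_integral => x _; rewrite patchE.
  case: ifPn => [/set_mem Dx|Dx].
    rewrite -ge0_integralZl ?lee_fin//.
      rewrite integral_mkcond; apply: eq_integral => tau _.
      rewrite patchE /W /= !indicE (mem_set Dx) mulr1.
      by case: (tau \in _); rewrite ?mulr1// mulr0 mul0e.
    by apply: measurable_funTS; exact: measurable_flow_time.
  by rewrite integral0_eq// => tau _; rewrite /W /= indicE (negbTE Dx) mulr0 mul0r mul0e.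
rewrite -(@fubini_tonelli _ _ _ _ R (@lebesgue_measure R) (lebn R n) W mW W0).
rewrite [leRHS]integral_mkcond.
apply: ge0_le_integral_nonmeas => tau _; first by apply: integral_ge0.
rewrite patchE; case: ifPn => [/set_mem It|It]; last first.
  by rewrite integral0_eq// => x _; rewrite /W /= !indicE (negbTE It) mulr0 mul0e.
apply: le_trans (Hb tau _); last by move: It; rewrite /= in_itv.
rewrite [leRHS]integral_mkcond; apply: ge0_le_integral_nonmeas => x _; first exact: W0.
rewrite patchE /W /= !indicE (mem_set It) mulr1.
by case: (x \in D); rewrite ?mulr1// mulr0 mul0e.
Qed.

End pairing.

(** * The nonlinearity along a path in a Herz space *)

Section NL_paths.
Context (R : realType) (n : nat).
Local Notation X := (n.-tuple R).
Variables (alpha gamma s : R) (q : \bar R).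
Hypothesis a1 : 1 < alpha.
Hypothesis aq : (alpha%:E <= q)%E.
Hypothesis q1 : (1 <= q)%E.

(** What remains of a continuous path in a Herz space when each annulus is looked at alone; the
    summability exponent r has disappeared. *)
Definition ann_path (u : R -> X -> R) (N : R -> int -> R) : Prop :=
  [/\ forall t, measurable_fun setT (u t),
      forall t j, 0 <= N t j,
      forall t j, ann_bound s q (u t) j (N t j) &
      forall t j e, 0 < e -> exists2 d, 0 < d & forall t', `|t' - t| < d ->
        ann_bound s q (fun x => u t' x - u t x) j e].

Lemma ann_bound_add (u v w : X -> R) j N M : 0 <= N -> 0 <= M ->
  measurable_fun setT u -> measurable_fun setT v -> measurable_fun setT w ->
  (forall x, `|u x| <= `|v x| + `|w x|) ->
  ann_bound s q v j N -> ann_bound s q w j M -> ann_bound s q u j (4 * (N + M)).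
Proof.
move=> N0 M0 mu mv mw uvw hv hw; rewrite /ann_bound.
rewrite (_ : _ * _ = 4 * ((2 ^ j) `^ (- s) * N + (2 ^ j) `^ (- s) * M)); last by ring.
have m v' := @measurable_mul_annulus R n v' j.
apply: (@Lq_bounded_add R n q _ _ _ _ _ q1 _ _ (m _ mu) (m _ mv) (m _ mw)) hv hw;
  rewrite ?mulr_ge0 ?powR_ge0// => x.
by rewrite !normrM -mulrDl ler_wpM2r.
Qed.

Lemma L1loc_path_NL u N : ann_path u N -> L1loc_path (fun tau => NL gamma alpha (u tau)).
Proof.
move=> [mu N0 uN cu]; have a0 : 0 < alpha by exact: lt_trans ltr01 a1.
split=> [tau|tau j|tau j e e0]; first exact: measurable_NL.
  have [C C0 HC] := @annulus_power_le R n gamma alpha a0.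
  have := HC q (u tau) (N tau j) s j (mu tau) (N0 tau j) aq (uN tau j).
  move=> h; apply: le_lt_trans (ltry _); apply: le_trans h.
  apply: ge0_le_integral_nonmeas => x _; rewrite lee_fin//.
  rewrite /NL normrM ger0_norm ?powR_ge0// normrM ger0_norm ?powR_ge0//.
  by rewrite powR_succ ?subrK// subr_gt0.
have [C C0 HC] := @annulus_NL_dist_le R n gamma alpha a1.
set L := ((2 : R) ^ j) `^ (gamma + n%:R - alpha * (s + n%:R * qinv q)) in HC *.
pose N' := N tau j; have N'0 : 0 <= N' by exact: N0.
(* Quasi-triangle bound for u(tau') on the annulus, valid as soon as u(tau') - u(tau) has size at
   most 1 there. *)
pose M := 4 * (N' + 1).
have M0 : 0 <= M by rewrite mulr_ge0// addr_ge0.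
pose S := M `^ alpha + N' `^ alpha.
have S0 : 0 <= S by rewrite addr_ge0 ?powR_ge0.
have L0 : 0 < L by rewrite powR_gt0// exprz_gt0.
have CL0 : 0 < C * L by rewrite mulr_gt0.
(* [eta] makes the first Young term at most e/2; [dl] then does the same for the second. *)
pose eta := e / (2 * (C * L * (S + 1))).
have S1 : 0 < S + 1 by rewrite ltr_wpDl.
have eta0 : 0 < eta by rewrite divr_gt0// !mulr_gt0.
pose E := eta `^ (- (alpha - 1)).
have E0 : 0 < E by exact: powR_gt0.
pose dl := Num.min 1 ((e / (2 * (C * L * E))) `^ alpha^-1).
have dl0 : 0 < dl by rewrite lt_min ltr01 powR_gt0// divr_gt0// !mulr_gt0.
have [d d0 H] := cu tau j dl dl0.
exists d => // tau' /H hd.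
have uM : ann_bound s q (u tau') j M.
  have h := ann_bound_add (N0 tau j) (ltW dl0) (mu tau') (mu tau)
    (measurable_funB (mu tau') (mu tau)) _ (uN tau j) hd.
  apply: (Lq_bounded_le q1 _ (fun x => lexx _) (h _)); last first.
    move=> x; rewrite -{1}(subrK (u tau x) (u tau' x)) addrC; exact: ler_normD.
  rewrite mulr_ge0 ?powR_ge0 ?mulr_ge0 ?addr_ge0 ?(ltW dl0)//=.
  rewrite ler_wpM2l ?powR_ge0// /M ler_pM2l// lerD2l ge_min lexx//.
apply: le_trans (HC q _ _ _ _ _ s j eta (mu tau') (mu tau) M0 (N0 tau j) (ltW dl0) eta0 aq uM (uN tau j) hd) _.
rewrite lee_fin -/L -/E -/N' -/S.
have h1 : C * L * (eta * S) <= e / 2.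
  rewrite /eta [leLHS](_ : _ = (e / 2) * (S / (S + 1))); last first.
    by field; rewrite !gt_eqF.
  by rewrite ler_piMr ?divr_ge0 ?(ltW e0)// ler_pdivrMr// mul1r lerDl.
have h2 : dl `^ alpha <= e / (2 * (C * L * E)).
  have z0 : 0 <= e / (2 * (C * L * E)) by rewrite divr_ge0 ?(ltW e0)// !mulr_ge0 ?(ltW C0) ?(ltW L0) ?powR_ge0.
  rewrite -[leRHS](powRr1 z0) -[X in _ <= _ `^ X](mulVf (lt0r_neq0 a0)) powRrM.
  by rewrite ge0_ler_powR ?nnegrE ?powR_ge0 ?(ltW a0) ?(ltW dl0)// ge_min lexx orbT.
have h3 : C * L * (E * dl `^ alpha) <= e / 2.
  apply: (@le_trans _ _ (C * L * (E * (e / (2 * (C * L * E)))))).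
    by rewrite ler_pM2l// ler_pM2l.
  rewrite le_eqVlt; apply/orP; left; apply/eqP.
  have fld (c l b : R) : 0 < c -> 0 < l -> 0 < b -> c * l * (b * (e / (2 * (c * l * b)))) = e / 2.
    by move=> c0 l0 b0; field; rewrite !gt_eqF.
  exact: fld.
rewrite mulrDr; lra.
Qed.

End NL_paths.

(** The supremum of the times up to which [Z] holds cannot stop before T, because the step yields
    [Z] at t0 itself and beyond it. With t0 = 0 the step is also the base case. *)
Lemma real_induction (R : realType) (T : R) (Z : R -> Prop) : 0 <= T ->
  (forall t0, 0 <= t0 <= T -> (forall tau, 0 <= tau < t0 -> Z tau) ->
     exists2 d, 0 < d & forall t, t0 <= t <= T -> t < t0 + d -> Z t) ->
  forall t, 0 <= t <= T -> Z t.
Proof.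
move=> T0 step.
pose S : set R := [set t : R | 0 <= t <= T /\ forall tau, 0 <= tau < t -> Z tau].
have S0 : S 0 by split=> [|tau /andP[h1 h2]]; [rewrite lexx T0|lra].
have ubS : ubound S T by move=> t [/andP[]].
have supS : has_sup S by split; [exists 0|exists T].
have ts0 : 0 <= sup S by apply: (sup_upper_bound supS S0).
have tsT : sup S <= T by apply: (ge_sup (ex_intro _ 0 S0) ubS).
have Zlt tau : 0 <= tau < sup S -> Z tau.
  move=> /andP[h1 h2]; have [|t [_ Zt] tt] := @sup_adherent _ S (sup S - tau) _ supS.
    by rewrite subr_gt0.
  by apply: Zt; rewrite h1 /=; lra.
have [|d d0 H] := step (sup S) _ Zlt; first by rewrite ts0.
have St' : S (Num.min T (sup S + d / 2)).
  split; first by rewrite ge_min lexx /= andbT le_min T0 /=; lra.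
  move=> tau /andP[h1]; rewrite lt_min => /andP[h2 h3].
  have [h4|h4] := ltP tau (sup S); first by apply: Zlt; rewrite h1.
  by apply: H; [rewrite h4 ltW|lra].
have : Num.min T (sup S + d / 2) <= sup S by apply: (sup_upper_bound supS St').
rewrite ge_min => /orP[Ts|]; last by move=> h; exfalso; lra.
move=> t /andP[t0 tT]; have [h4|h4] := ltP t (sup S); first by apply: Zlt; rewrite t0.
by apply: H; [rewrite h4|lra].
Qed.

(** * Contraction on the pairings of the difference of the nonlinearities *)

Section contraction.
Context (R : realType) (n : nat).
Hypothesis n0 : (0 < n)%N.
Local Notation X := (n.-tuple R).
Local Notation TR := (measurableTypeR R).
Variables (alpha gamma s : R) (q : \bar R) (mu T : R).
Hypothesis alpha1 : 1 < alpha.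
Hypothesis alphaq : (alpha%:E <= q)%E.
Hypothesis q1 : (1 <= q)%E.
Local Notation c := (alpha - 1).
Hypothesis crit : c * (s + n%:R * qinv q) = 2 + gamma.
Local Notation a := (c * (n%:R * qinv q) / 2).
Local Notation nu := (n%:R / 2 - mu).
Local Notation beta := (gamma + n%:R - alpha * (s + n%:R * qinv q)).
Hypothesis a0 : 0 <= a.
Hypothesis a1 : a < 1.
Hypothesis mu0 : 0 <= mu.
Hypothesis nu1 : 1 < nu.
Variables (u1 u2 : R -> X -> R) (N1 N2 : R -> int -> R).
Hypothesis P1 : ann_path s q u1 N1.
Hypothesis P2 : ann_path s q u2 N2.

Definition NLdiff (tau : R) (y : X) : R := `|NL gamma alpha (u1 tau) y - NL gamma alpha (u2 tau) y|.
Local Notation f := NLdiff.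

Let alpha0 : 0 < alpha. Proof. exact: lt_trans ltr01 alpha1. Qed.
Let c0 : 0 < c. Proof. by rewrite subr_gt0. Qed.
Let cq : (c%:E <= q)%E.
Proof. by apply: le_trans alphaq; rewrite lee_fin; lra. Qed.
Let f0 tau y : 0 <= f tau y. Proof. exact: normr_ge0. Qed.

Lemma L1loc_path_NLdiff : L1loc_path f.
Proof. by apply/L1loc_path_norm/L1loc_path_sub; apply: L1loc_path_NL; eauto. Qed.

Let mf tau : measurable_fun setT (f tau).
Proof. by have [] := L1loc_path_NLdiff. Qed.

Let V (v : X -> R) (x : X) : R := enorm x `^ gamma * `|v x| `^ c.

Let V0 v x : 0 <= V v x. Proof. by rewrite mulr_ge0 ?powR_ge0. Qed.

Let mV v : measurable_fun setT v -> measurable_fun setT (V v).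
Proof.
move=> mv; apply: measurable_funM; last exact: measurable_normr_powR.
apply: (@measurableT_comp _ _ _ _ _ _ (fun t : R => t `^ gamma)); first exact: measurable_powR.
exact: measurable_enorm.
Qed.

Lemma measurable_flow_integral t (g : R -> X -> R) : L1loc_path g -> (forall tau y, 0 <= g tau y) ->
  measurable_fun setT (fun x : X => \int[@lebesgue_measure R]_(tau in `[0%R, t]) flow t g tau x)%E.
Proof.
move=> Lg g0; pose W (z : TR * X) : \bar R :=
  ((\1_(`[0%R, t]%classic) z.1)%:E * flow t g z.1 z.2)%E.
rewrite (_ : (fun x => _) = fun x => (\int[@lebesgue_measure R]_tau W (tau, x))%E); last first.
  apply/funext => x; rewrite integral_mkcond; apply: eq_integral => tau _.
  by rewrite patchE /W /= indicE; case: (tau \in _); rewrite ?mul1e ?mul0e.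
apply: (@measurable_fun_fubini_tonelli_G _ _ _ _ R (@lebesgue_measure R) W).
- apply: emeasurable_funM; last exact: measurable_flow.
  apply/measurable_EFinP; apply: (@measurableT_comp _ _ _ _ _ _ (\1_(`[0%R, t]%classic) : TR -> R)) => //.
- by move=> z; apply: mule_ge0; [rewrite lee_fin|exact: flow_ge0].
Qed.

(** At each tau the kernel is moved onto the potential, which becomes a constant times the bump and
    [time_kernel], paired with [f tau]. Only tau in [t0, t) contributes, so the lags are at most d
    and their integral brings [time_small]. *)
Lemma potential_pairing_le : exists2 C : R, 0 < C &
  forall (v : X -> R) N j t0 t d A, measurable_fun setT v -> 0 <= N -> ann_bound s q v j N ->
  0 <= t0 <= t -> t - t0 <= d -> 0 <= A ->
  (forall tau, 0 <= tau < t0 -> (\int[lebn R n]_y (bump mu ((2 : R) ^ j) y * f tau y)%:E <= 0)%E) ->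
  (forall tau, t0 <= tau < t -> (\int[lebn R n]_y (bump mu ((2 : R) ^ j) y * f tau y)%:E <= A%:E)%E) ->
  (\int[lebn R n]_(x in annulus j)
     ((V v x)%:E * \int[@lebesgue_measure R]_(tau in `[0%R, t]) flow t f tau x)
   <= (C * N `^ c * time_small ((1 - a) / 2) d (2 ^ j) * A)%:E)%E.
Proof.
have [C C0 HC] := @annulus_kernel_le R n gamma c mu c0 mu0.
have [C' C'0 HC'] := @time_kernel_small_integral R a nu a1 nu1 a0.
exists (C * C'); first exact: mulr_gt0.
move=> v N j t0 t d A mv N0 vN /andP[t00 t0t] td A0 Hlt Hge.
pose L : R := 2 ^ j; have L0 : 0 < L by exact: exprz_gt0.
have [k kE] : exists k : R, k = C * N `^ c by eexists.
have k0 : 0 <= k by rewrite kE mulr_ge0 ?powR_ge0 ?(ltW C0).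
(* The value 0 at tau = t is legitimate since the kernel vanishes at lag 0. *)
pose b (tau : R) : R := if t0 <= tau < t then k * time_kernel a nu L (t - tau) * A else 0.
apply: le_trans.
  apply: (path_pairing_le n0 (b := EFin \o b) (@measurable_annulus R n j) (mV mv) (V0 v) L1loc_path_NLdiff f0).
  move=> tau /andP[tau0]; rewrite le_eqVlt => /predU1P[->|taut].
    rewrite /= /b ltxx andbF integral0_eq// => x _.
    rewrite /flow subrr maxxx integral0_eq ?mule0// => y _.
    by rewrite heat_kernel_time0// mul0r.
  have tt0 : 0 < t - tau by rewrite subr_gt0.
  rewrite /flow max_r ?(ltW tt0)//.
  apply: le_trans.
    apply: (@layer_pairing_le R n (V v) (f tau) (annulus j) (t - tau)
      (fun y => k * bump mu L y * time_kernel a nu L (t - tau))) => //.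
    - exact: measurable_annulus.
    - exact: mV.
    - move=> y; rewrite kE; exact: (HC q v N s j (t - tau) y mv N0 cq vN tt0 crit (lt_trans a1 nu1)).
  have TK0 := time_kernel_ge0 a nu L (t - tau).
  have scale M : (\int[lebn R n]_y (bump mu L y * f tau y)%:E <= M%:E)%E ->
     (\int[lebn R n]_y (k * bump mu L y * time_kernel a nu L (t - tau) * f tau y)%:E
       <= (k * time_kernel a nu L (t - tau) * M)%:E)%E.
    apply: ge0_integral_le_scale => //.
    - by apply: measurable_funM => //; exact: measurable_bump.
    - by move=> y _; rewrite mulr_ge0 ?bump_ge0.
    - exact: mulr_ge0.
    - move=> y _; apply: mulr_ge0 => //; apply: mulr_ge0 => //; apply: mulr_ge0 => //.
      exact: bump_ge0.
    - by move=> y _; rewrite le_eqVlt; apply/orP; left; apply/eqP; ring.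
  rewrite /b /=; have [ht0|ht0] := leP t0 tau.
    by rewrite taut /=; apply: scale; apply: Hge; rewrite ht0.
  by have := scale 0; rewrite mulr0; apply; apply: Hlt; rewrite tau0.
pose J := [set tau : TR | t0 <= tau < t].
have JE : J = `[t0, t[%classic by apply/seteqP; split => x; rewrite /J /= in_itv.
have mJ : measurable J by rewrite JE; exact: measurable_itv.
have mTK : measurable_fun setT (fun tau : TR => time_kernel a nu L (t - tau)).
  apply: (@measurableT_comp _ _ _ _ _ _ (time_kernel a nu L)).
    exact: measurable_time_kernel.
  exact: measurable_funB.
apply: (@le_trans _ _ (\int[@lebesgue_measure R]_(tau in J)
    (k * A * time_kernel a nu L (t - tau))%:E)%E).
  rewrite [leLHS]integral_mkcond [leRHS]integral_mkcond; apply: ge0_le_integral_nonmeas => tau _.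
    rewrite patchE; case: ifPn => // _; rewrite /b /= lee_fin; case: ifP => // _.
    by apply: mulr_ge0 => //; apply: mulr_ge0 => //; exact: time_kernel_ge0.
  rewrite !patchE /b /=; have [Jt|Jt] := boolP (tau \in J).
    move: (set_mem Jt); rewrite /J /= => ->; rewrite mem_set.
      by rewrite lee_fin mulrAC.
    by move: (set_mem Jt); rewrite /J /= in_itv /= => /andP[h1 /ltW ->]; rewrite (le_trans t00 h1).
  rewrite (_ : (t0 <= tau < t) = false); first by case: ifP.
  by apply/negP => h; move/negP: Jt; apply; exact: mem_set.
rewrite (_ : C * C' * N `^ c * _ * A = k * A * (C' * time_small ((1 - a) / 2) d L)); last first.
  by rewrite kE /L; ring.
apply: (ge0_integral_le_scale mJ (f := fun tau : TR => time_kernel a nu L (t - tau))) => //.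
- exact: measurable_funTS.
- by move=> x _; exact: time_kernel_ge0.
- exact: mulr_ge0.
- by move=> x _; apply: mulr_ge0; [exact: mulr_ge0|exact: time_kernel_ge0].
- exact: HC'.
Qed.

Hypothesis duhamel : forall t, 0 < t <= T -> {ae lebn R n, forall x,
  (`|u1 t x - u2 t x|%:E <= \int[@lebesgue_measure R]_(tau in `[0%R, t]) flow t f tau x)%E}.

Lemma layer_NLdiff_le : exists2 C : R, 0 < C &
  forall j t0 t d A, 0 <= t0 <= t -> 0 < t <= T -> t - t0 <= d -> 0 <= A ->
  (forall tau, 0 <= tau < t0 -> (\int[lebn R n]_y (bump mu ((2 : R) ^ j) y * f tau y)%:E <= 0)%E) ->
  (forall tau, t0 <= tau < t -> (\int[lebn R n]_y (bump mu ((2 : R) ^ j) y * f tau y)%:E <= A%:E)%E) ->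
  (\int[lebn R n]_(x in annulus j) (f t x)%:E
   <= (C * (N1 t j `^ c + N2 t j `^ c) * time_small ((1 - a) / 2) d (2 ^ j) * A)%:E)%E.
Proof.
have [C C0 HC] := potential_pairing_le.
exists (2 * alpha * C); first by rewrite !mulr_gt0.
move=> j t0 t d A t0t tT td A0 Hlt Hge.
have [mu1 N10 B1 _] := P1; have [mu2 N20 B2 _] := P2.
pose F (x : X) : \bar R := (\int[@lebesgue_measure R]_(tau in `[0%R, t]) flow t f tau x)%E.
have F0 x : (0 <= F x)%E by apply: integral_ge0 => tau _; exact: flow_ge0.
have mF : measurable_fun setT F by exact: measurable_flow_integral L1loc_path_NLdiff f0.
have mA := @measurable_annulus R n j.
have h1 := HC (u1 t) (N1 t j) j t0 t d A (mu1 t) (N10 t j) (B1 t j) t0t td A0 Hlt Hge.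
have h2 := HC (u2 t) (N2 t j) j t0 t d A (mu2 t) (N20 t j) (B2 t j) t0t td A0 Hlt Hge.
have mVF v : measurable_fun setT v -> measurable_fun setT (fun x => (V v x)%:E * F x)%E.
  by move=> mv; apply: emeasurable_funM => //; apply/measurable_EFinP; exact: mV.
have VF0 v x : (0 <= (V v x)%:E * F x)%E by apply: mule_ge0; rewrite ?lee_fin.
have al0 : 0 <= 2 * alpha by rewrite mulr_ge0 ?(ltW alpha0).
apply: (@le_trans _ _ (\int[lebn R n]_(x in annulus j)
    ((2 * alpha)%:E * ((V (u1 t) x)%:E * F x + (V (u2 t) x)%:E * F x)))%E).
  apply: ae_ge0_le_integral => //.
  - by move=> x _; rewrite lee_fin.
  - by apply/measurable_EFinP; exact: measurable_funTS.
  - by move=> x _; apply: mule_ge0; rewrite ?lee_fin// adde_ge0.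
  - apply: measurable_funTS; apply: measurable_funeM; apply: emeasurable_funD; exact: mVF.
  apply: filterS (duhamel tT) => x hx _.
  apply: (@le_trans _ _ ((2 * alpha)%:E * ((V (u1 t) x + V (u2 t) x)%:E * `|u1 t x - u2 t x|%:E))%E).
    rewrite -!EFinM lee_fin; apply: le_trans (NL_dist_le gamma _ _ _ alpha1) _.
    by rewrite ler_wpM2l// /V -mulrDr mulrA.
  rewrite lee_wpmul2l ?lee_fin// -ge0_muleDl ?lee_fin// -EFinD.
  by rewrite lee_wpmul2l ?lee_fin ?addr_ge0.
rewrite ge0_integralZl ?lee_fin//; last 2 first.
- by apply: measurable_funTS; apply: emeasurable_funD; exact: mVF.
- by move=> x _; rewrite adde_ge0.
rewrite ge0_integralD//; last 2 first.
- by apply: measurable_funTS; exact: mVF.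
- by apply: measurable_funTS; exact: mVF.
apply: le_trans (lee_wpmul2l _ (leeD h1 h2)) _; first by rewrite lee_fin.
rewrite -EFinD -EFinM lee_fin le_eqVlt; apply/orP; left; apply/eqP; ring.
Qed.

(** [Q e M] is an abstract bound by M on the size of the sequence e, so that both critical cases
    share one contraction; [K] is the cost of summing the annuli against a bump. *)
Variables (Q : (int -> R) -> R -> Prop) (K : R).
Hypothesis K0 : 0 < K.
Hypothesis Q_bump : forall (g : X -> R) e M, measurable_fun setT g -> (forall x, 0 <= g x) -> 0 <= M ->
  (forall j, \int[lebn R n]_(x in annulus j) (g x)%:E <= (e j * ((2 : R) ^ j) `^ beta)%:E)%E ->
  Q e M -> forall i, (\int[lebn R n]_x (bump mu ((2 : R) ^ i) x * g x)%:E
     <= (K * M * ((2 : R) ^ i) `^ beta)%:E)%E.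
Hypothesis Q_scale : forall k e M, 0 <= k -> Q e M -> Q (fun j => k * e j) (k * M).
Hypothesis bounded : forall t0, 0 <= t0 <= T -> exists2 d, 0 < d & exists2 A : R, 0 <= A &
  forall t, t0 <= t <= T -> t < t0 + d -> forall i,
  (\int[lebn R n]_x (bump mu ((2 : R) ^ i) x * f t x)%:E <= (A * ((2 : R) ^ i) `^ beta)%:E)%E.
Hypothesis small : forall t0 eta, 0 <= t0 <= T -> 0 < eta -> exists2 d, 0 < d &
  forall t, t0 <= t <= T -> t < t0 + d ->
    Q (fun j => (N1 t j `^ c + N2 t j `^ c) * time_small ((1 - a) / 2) d (2 ^ j)) eta.
Hypothesis initial : {ae lebn R n, forall x, u1 0 x = u2 0 x}.
Hypothesis T0 : 0 <= T.

Let Z tau := forall i, (\int[lebn R n]_y (bump mu ((2 : R) ^ i) y * f tau y)%:E <= 0)%E.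

Let Z0 : Z 0.
Proof.
move=> i; rewrite (_ : integral _ _ _ = 0%E)//.
rewrite -(@integral0 _ _ _ (lebn R n) setT); apply: ae_eq_integral => //.
  by apply/measurable_EFinP; apply: measurable_funM => //; exact: measurable_bump.
by apply: filterS initial => x hx _; rewrite /f /NLdiff /NL hx subrr normr0 mulr0.
Qed.

Let Z_step t0 : 0 <= t0 <= T -> (forall tau, 0 <= tau < t0 -> Z tau) ->
  exists2 d, 0 < d & forall t, t0 <= t <= T -> t < t0 + d -> Z t.
Proof.
move=> t0T Zlt; have /andP[t00 _] := t0T.
have [C C0 HC] := layer_NLdiff_le.
(* Chosen so that C, K and eta combine to 1/2. *)
pose eta := (2 * (C * K))^-1.
have eta0 : 0 < eta by rewrite invr_gt0 !mulr_gt0.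
have [d d0 Hd] := small t0T eta0.
have [d' d'0 [A A0 HA]] := bounded t0T.
exists (Num.min d d'); first by rewrite lt_min d0.
(* The contraction: a bound for the pairings of [f] with all the bumps improves by 1/2. *)
have halve A' : 0 <= A' ->
    (forall t, t0 <= t <= T -> t < t0 + Num.min d d' -> forall i,
      (\int[lebn R n]_y (bump mu ((2 : R) ^ i) y * f t y)%:E <= (A' * ((2 : R) ^ i) `^ beta)%:E)%E) ->
    (forall t, t0 <= t <= T -> t < t0 + Num.min d d' -> forall i,
      (\int[lebn R n]_y (bump mu ((2 : R) ^ i) y * f t y)%:E <= (A' / 2 * ((2 : R) ^ i) `^ beta)%:E)%E).
  move=> A'0 PA t /andP[t0t tT] tdd i.
  have td : t < t0 + d by apply: lt_le_trans tdd _; rewrite lerD2l ge_min lexx.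
  (* Duhamel's inequality is available for t > 0 only; t = 0 is covered by the initial condition. *)
  have [tz|tn0] := eqVneq t 0.
    by rewrite tz; apply: le_trans (Z0 i) _; rewrite lee_fin mulr_ge0 ?powR_ge0 ?divr_ge0.
  have tp : 0 < t by rewrite lt_neqAle eq_sym tn0 (le_trans t00 t0t).
  have := Q_bump (mf t) (f0 t) _ _ (Q_scale _ (Hd t _ td)) i.
  move=> /(_ (C * A')).
  rewrite (_ : K * (C * A' * eta) = A' / 2); last by rewrite /eta; field; rewrite !gt_eqF.
  apply.
  - by rewrite !mulr_ge0 ?(ltW C0) ?(ltW eta0).
  - move=> j; apply: le_trans (HC j t0 t d (A' * ((2 : R) ^ j) `^ beta) _ _ _ _ _ _) _.
    + by rewrite t00.
    + by rewrite tp.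
    + by lra.
    + by rewrite mulr_ge0 ?powR_ge0.
    + by move=> tau /Zlt.
    + move=> tau /andP[h1 h2]; apply: PA; first by rewrite h1 (le_trans (ltW h2)).
      exact: lt_trans h2 tdd.
    + by rewrite lee_fin le_eqVlt; apply/orP; left; apply/eqP; ring.
  - by rewrite mulr_ge0 ?(ltW C0).
  - by rewrite t0t.
(* The a priori bound A is halved k times; as A is finite, the pairings vanish in the limit. *)
have iter k t : t0 <= t <= T -> t < t0 + Num.min d d' -> forall i,
    (\int[lebn R n]_y (bump mu ((2 : R) ^ i) y * f t y)%:E
       <= (A / 2 ^+ k * ((2 : R) ^ i) `^ beta)%:E)%E.
  elim: k t => [|k IH] t ht htd i.
    by rewrite expr0 divr1; apply: HA => //; apply: lt_le_trans htd _; rewrite lerD2l ge_min lexx orbT.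
  rewrite (_ : A / 2 ^+ k.+1 = A / 2 ^+ k / 2); last by rewrite exprSr invfM mulrA.
  by apply: halve => //; rewrite divr_ge0 ?exprn_ge0.
move=> t ht htd i; apply/lee_addgt0Pr => e e0; rewrite add0e.
pose B := A * ((2 : R) ^ i) `^ beta.
have B0 : 0 <= B by rewrite mulr_ge0 ?powR_ge0.
have [k hk] : exists k, B / 2 ^+ k <= e.
  exists (Num.truncn (B / e)).+1; rewrite ler_pdivrMr ?exprn_gt0// mulrC -ler_pdivrMr//.
  apply: ltW; apply: lt_le_trans (truncnS_gt _) _.
  by rewrite -natrX ler_nat ltnW// ltn_expl.
apply: le_trans (iter k t ht htd i) _; rewrite lee_fin.
by apply: le_trans hk; rewrite mulrAC.
Qed.

(** The weights are positive, so vanishing pairings mean f = 0 almost everywhere. The right side of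
    Duhamel's inequality is then 0, which gives u1 = u2 without inverting the nonlinearity. *)
Theorem critical_uniqueness t : 0 <= t <= T -> {ae lebn R n, forall x, u1 t x = u2 t x}.
Proof.
move=> /andP[t0 tT]; have [->//|tn0] := eqVneq t 0.
have tp : 0 < t by rewrite lt_neqAle eq_sym tn0.
have HZ := @real_induction R T Z T0 Z_step.
have flow0 tau x : 0 <= tau <= t -> flow t f tau x = 0%E.
  move=> /andP[h1 h2].
  have mb : measurable_fun setT (fun y : X => (bump mu ((2 : R) ^ 0%R) y * f tau y)%:E).
    by apply/measurable_EFinP; apply: measurable_funM => //; exact: measurable_bump.
  have /(ae_eq_integral_abs _ measurableT mb).1 fz :
      (\int[lebn R n]_y `|(bump mu ((2 : R) ^ 0%R) y * f tau y)%:E|)%E = 0%E.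
    apply/eqP; rewrite eq_le integral_ge0// andbT.
    apply: le_trans (HZ tau _ 0); last by rewrite h1 (le_trans h2).
    apply: ge0_le_integral_nonmeas => y _ //.
    by rewrite gee0_abs// lee_fin mulr_ge0 ?bump_ge0.
  rewrite /flow -(@integral0 _ _ _ (lebn R n) setT); apply: ae_eq_integral => //.
    by apply/measurable_EFinP; exact: measurable_heat_kernel_mul.
  apply: filterS fz => y /(_ Logic.I) [/eqP]; rewrite mulf_eq0 => /orP[|/eqP -> _]; last by rewrite mulr0.
  by rewrite gt_eqF// powR_gt0// ltr_wpDr// divr_ge0 ?enorm_ge0 ?exprz_ge0.
have := @duhamel t; rewrite tp tT => /(_ isT); apply: filterS => x.
rewrite integral0_eq; last first.
  by move=> tau; rewrite /= in_itv /= => ht; exact: flow0.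
by rewrite lee_fin normr_le0 subr_eq0 => /eqP.
Qed.

End contraction.

(** * Herz norms through their annulus terms *)

Section herz_norms.
Context (R : realType) (n : nat).
Hypothesis n0 : (0 < n)%N.
Local Notation X := (n.-tuple R).
Implicit Types (q r : \bar R) (u v w : X -> R) (s : R) (j : int).

(** On a null space every essential supremum would be -oo; the unit mass of the heat kernel excludes
    this. *)
Lemma lebn_setT_neq0 : lebn R n setT <> 0%E.
Proof.
move=> h; have t0 : 0 < 1 :> R by exact: ltr01.
have := @heat_kernel_mass R n 1 [tuple of nseq n 0] t0.
rewrite (ge0_negligible_integral (N := setT))//.
- by rewrite setDv integral_set0 => /eqP; rewrite eq_sym onee_eq0.
- by apply/measurable_EFinP; exact: measurable_heat_kernel.
- by move=> x _; rewrite lee_fin heat_kernel_ge0.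
Qed.

Lemma Lqnorm_ge0 q v : (1 <= q)%E -> (0 <= Lqnorm q v)%E.
Proof.
case: q => [p| |] //= _; first exact: poweR_ge0.
apply: le_ereal_inf_tmp => M /= /ae_rnP [N [mN N0 NP]].
rewrite leNgt; apply/negP => M0; apply: lebn_setT_neq0.
apply/eqP; rewrite eq_le measure_ge0 andbT -N0; apply: le_measure; rewrite ?inE//.
move=> x _; apply: NP => /= h.
by have := le_lt_trans h M0; rewrite lte_fin ltNge normr_ge0.
Qed.

Lemma Lqnorm_le q v (N : R) : (1 <= q)%E -> measurable_fun setT v -> 0 <= N ->
  Lq_bounded q v N -> (Lqnorm q v <= N%:E)%E.
Proof.
case: q => [p| |] //=; rewrite ?lee_fin => q1 mv N0 h.
  have p0 : 0 < p by lra.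
  have p10 : 0 <= p^-1 by rewrite invr_ge0 ltW.
  rewrite iintE; last 2 first.
  - by apply/measurable_EFinP; exact: measurable_normr_powR.
  - by move=> x; rewrite lee_fin powR_ge0.
  move: h; set I := (\int[_]_x _)%E => h.
  have I0 : (0 <= I)%E by apply: integral_ge0 => x _; rewrite lee_fin powR_ge0.
  have := @gt0_ler_poweR R p^-1 p10 _ _ _ _ h.
  rewrite !in_itv /= !leey I0 lee_fin powR_ge0 /= => /(_ isT isT).
  by rewrite -powRrM mulfV ?gt_eqF// powRr1.
by apply: ereal_inf_lbound => /=; apply/ae_rnP; apply: filterS h => x; rewrite lee_fin.
Qed.

Definition loc_norm s q v j : \bar R :=
  (((2 : R) `^ (j%:~R * s))%:E * Lqnorm q (fun x => (v x * \1_(annulus j) x)%R))%E.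

Definition ann_norm s q v j : R := fine (loc_norm s q v j).

Lemma loc_norm_ge0 s q v j : (1 <= q)%E -> (0 <= loc_norm s q v j)%E.
Proof. by move=> q1; apply: mule_ge0; [rewrite lee_fin powR_ge0|exact: Lqnorm_ge0]. Qed.

Lemma ann_norm_ge0 s q v j : (1 <= q)%E -> 0 <= ann_norm s q v j.
Proof. by move=> q1; apply: fine_ge0; exact: loc_norm_ge0. Qed.

Lemma esum_int_ge (a : int -> \bar R) K :
  (\sum_(k < K) (a (Posz k) + a (Negz k)) <= \esum_(j in [set: int]) a j)%E.
Proof.
pose l := [seq Posz k | k <- iota 0 K] ++ [seq Negz k | k <- iota 0 K].
have ul : uniq l.
  rewrite cat_uniq !map_inj_uniq ?iota_uniq//=; try by move=> x y [].
  by rewrite andbT; apply/hasPn => _ /mapP[k _ ->]; apply/negP => /mapP[].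
apply: esum_ge; exists [set` l]; first by split => //; exact: finite_seq.
rewrite -fsbig_seq// /l big_cat /= !big_map.
rewrite -(big_mkord predT (fun k => (a (Posz k) + a (Negz k))%E)) /index_iota subn0.
by rewrite big_split.
Qed.

Lemma herz_zsum s q (p B : R) v K : (1 <= q)%E -> 0 < p -> 0 <= B ->
  (herz s q p%:E v <= B%:E)%E -> (\sum_(k < K) ((loc_norm s q v (Posz k)) `^ p + (loc_norm s q v (Negz k)) `^ p)
     <= (B `^ p)%:E)%E.
Proof.
move=> q1 p0 B0 h; apply: le_trans (esum_int_ge (fun j => loc_norm s q v j `^ p)%E K) _.
move: h; rewrite /= -/(loc_norm s q v); set I := (\esum_(_ in _) _)%E => h.
have I0 : (0 <= I)%E by apply: esum_ge0 => j _; exact: poweR_ge0.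
have := @gt0_ler_poweR R p (ltW p0) _ _ _ _ h.
rewrite !in_itv /= !leey poweR_ge0 lee_fin B0 /= => /(_ isT isT).
by rewrite -poweRrM mulVf ?gt_eqF// poweRe1.
Qed.

Lemma loc_norm_le_herz s q r (B : R) v j : (1 <= q)%E -> (0 < r)%E -> 0 <= B ->
  (herz s q r v <= B%:E)%E -> (loc_norm s q v j <= B%:E)%E.
Proof.
move=> q1; case: r => [p| |] //= p0 B0 h; last first.
  by apply: le_trans h; apply: ereal_sup_ubound; exists j.
rewrite lte_fin in p0; have p10 : 0 <= p^-1 by rewrite invr_ge0 ltW.
have [k jk] : exists k, j = Posz k \/ j = Negz k by case: (j) => k; exists k; [left|right].
have hs := herz_zsum k.+1 q1 p0 B0 h.
have pj : (loc_norm s q v j `^ p <= (B `^ p)%:E)%E.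
  apply: le_trans hs; rewrite big_ord_recr /=.
  have S0 : (0 <= \sum_(i < k) (loc_norm s q v i `^ p + loc_norm s q v (Negz i) `^ p))%E.
    by apply: sume_ge0 => i _; rewrite adde_ge0 ?poweR_ge0.
  apply: le_trans (leeDr _ S0).
  by case: jk => ->; [apply: leeDl|apply: leeDr]; exact: poweR_ge0.
have := @gt0_ler_poweR R p^-1 p10 _ _ _ _ pj.
rewrite !in_itv /= !leey poweR_ge0 lee_fin powR_ge0 /= => /(_ isT isT).
by rewrite -poweRrM mulfV ?gt_eqF// poweRe1 ?loc_norm_ge0// -powRrM mulfV ?gt_eqF// powRr1.
Qed.

Section bounds.
Variables (s B : R) (q r : \bar R) (v : X -> R).
Hypothesis q1 : (1 <= q)%E.
Hypothesis r0 : (0 < r)%E.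
Hypothesis B0 : 0 <= B.
Hypothesis hv : (herz s q r v <= B%:E)%E.

Lemma loc_norm_fine j : loc_norm s q v j = (ann_norm s q v j)%:E.
Proof.
rewrite fineK// ge0_fin_numE ?loc_norm_ge0//.
exact: le_lt_trans (loc_norm_le_herz j q1 r0 B0 hv) (ltry _).
Qed.

Lemma ann_norm_le j : ann_norm s q v j <= B.
Proof. by rewrite -lee_fin -loc_norm_fine; exact: loc_norm_le_herz hv. Qed.

Lemma powR_dyadic j : (2 : R) `^ (j%:~R * s) = ((2 : R) ^ j) `^ s.
Proof. by rewrite powRrM powR_intmul. Qed.

Lemma ann_bound_norm j : measurable_fun setT v -> ann_bound s q v j (ann_norm s q v j).
Proof.
move=> mv; have L0 : 0 < ((2 : R) ^ j) `^ s by rewrite powR_gt0// exprz_gt0.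
apply: Lq_bounded_norm => //.
- exact: measurable_mul_annulus.
- by rewrite mulr_ge0 ?powR_ge0// ann_norm_ge0.
have := loc_norm_fine j; rewrite /loc_norm powR_dyadic.
set I := Lqnorm _ _ => h.
have : ((((2 : R) ^ j) `^ s)^-1%:E * ((((2 : R) ^ j) `^ s)%:E * I) = I)%E.
  by rewrite muleA -EFinM mulVf ?gt_eqF// mul1e.
by rewrite h -EFinM powRN => <-.
Qed.

(** The inclusion of l^r in l^c for r <= c: all terms are at most B, so their power c is at most
    B^(c-r) times their power r. *)
Lemma zsum_ann_norm_le c K : 0 < c -> (r <= c%:E)%E -> zsum (fun j => ann_norm s q v j `^ c) K <= B `^ c.
Proof.
move=> c0; have Uj := loc_norm_fine; have Ub := ann_norm_le; move: r0 hv Uj => r0' hv' Uj.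
case: r r0' hv' => [p| |] //= p0 h; rewrite lee_fin => pc; rewrite lte_fin in p0.
have := herz_zsum K q1 p0 B0 h.
under eq_bigr do rewrite !Uj -EFinD.
rewrite sumEFin lee_fin => hs.
have [B00|Bn0] := eqVneq B 0.
  rewrite B00 powR0 ?gt_eqF// /zsum big1// => k _.
  have U0 j : ann_norm s q v j = 0 by apply/eqP; rewrite eq_le ann_norm_ge0// andbT -B00.
  by rewrite !U0 powR0 ?gt_eqF// addr0.
have {Bn0}B0' : 0 < B by rewrite lt_neqAle eq_sym Bn0.
have le1 j : ann_norm s q v j `^ c <= B `^ (c - p) * ann_norm s q v j `^ p.
  have := ann_norm_ge0 s v j q1; rewrite le_eqVlt => /predU1P[<-|U0].
    by rewrite powR0 ?gt_eqF// mulr_ge0 ?powR_ge0.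
  rewrite -{1}(subrK p c) powRD; last by rewrite (gt_eqF U0) implybT.
  by rewrite ler_wpM2r ?powR_ge0// ge0_ler_powR ?nnegrE ?subr_ge0 ?(ltW U0) ?(ltW B0').
apply: le_trans (ler_zsum K le1) _.
rewrite zsumZ -[leRHS](_ : B `^ (c - p) * B `^ p = _).
  by rewrite ler_wpM2l ?powR_ge0.
by rewrite -powRD ?subrK// (gt_eqF B0') implybT.
Qed.

End bounds.

Lemma ann_norm_le_bound s q v j (N : R) : (1 <= q)%E -> measurable_fun setT v -> 0 <= N ->
  ann_bound s q v j N -> ann_norm s q v j <= N.
Proof.
move=> q1 mv N0 h; have L0 : 0 < ((2 : R) ^ j) `^ s by rewrite powR_gt0// exprz_gt0.
have /(Lqnorm_le q1 (measurable_mul_annulus j mv)) h' := h.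
have {}h' := h' (mulr_ge0 (powR_ge0 _ _) N0).
have le : (loc_norm s q v j <= N%:E)%E.
  rewrite /loc_norm powR_dyadic; apply: le_trans (lee_wpmul2l _ h') _.
    by rewrite lee_fin ltW.
  by rewrite -EFinM lee_fin mulrA powRN mulfV ?gt_eqF// mul1r.
rewrite -lee_fin /ann_norm fineK// ge0_fin_numE ?loc_norm_ge0//.
exact: le_lt_trans le (ltry _).
Qed.

(** Meant for comparisons with v - phi, where the test function [phi] enters through its continuity
    at the origin alone. *)
Lemma iint_le_nonmeas m (f g : m.-tuple R -> \bar R) :
  (forall x, 0 <= f x <= g x)%E -> (iint f <= iint g)%E.
Proof.
elim: m f g => [|m IH] f g fg /=; first by have /andP[] := fg [tuple].
apply: ge0_le_integral_nonmeas => x _; last by apply: IH => y.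
have := IH (fun=> 0%E) (fun y => f [tuple of x :: y]).
rewrite (_ : iint (fun=> 0%E) = 0%E); last by rewrite iintE// integral0.
by apply=> y; rewrite lexx; have /andP[] := fg [tuple of x :: y].
Qed.

Lemma const_ann_bound s (p M : R) j : 0 < p -> 0 <= M ->
  ann_bound s p%:E (fun _ : X => M) j (M * 2 `^ (n%:R / p) * ((2 : R) ^ j) `^ (s + n%:R / p)).
Proof.
move=> p0 M0; have L0 : 0 < (2 : R) ^ j by exact: exprz_gt0.
have mA := @measurable_annulus R n j.
rewrite /ann_bound /=.
have E : ((2 : R) ^ j) `^ (- s) * (M * 2 `^ (n%:R / p) * ((2 : R) ^ j) `^ (s + n%:R / p)) =
    M * (2 * 2 ^ j) `^ (n%:R / p).
  rewrite [in RHS]powRM ?(ltW L0)// [LHS]mulrC -[LHS]mulrA -powRD; last by rewrite (gt_eqF L0) implybT.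
  by rewrite -mulrA; congr (_ * (_ * _ `^ _)); ring.
rewrite E powRM ?powR_ge0// -powRrM divfK ?gt_eqF// powR_mulrn ?mulr_ge0 ?(ltW L0)//.
rewrite (eq_integral (fun x => (M `^ p * \1_(annulus j) x)%:E)); last first.
  move=> x _; rewrite indicE; case: (_ \in _); rewrite ?mulr1 ?mulr0 ?ger0_norm//.
  by rewrite powR0// gt_eqF.
rewrite -integral_annulus_indic integral_cst// EFinM lee_wpmul2l ?lee_fin ?powR_ge0//.
exact: annulus_volume.
Qed.

(* The approximating test function is bounded near the origin, and bounded
   functions have small norm on the annuli shrinking to it. *)
Lemma Kcal_vanishing s (p : R) r v : 1 <= p -> (0 < r)%E -> 0 < s + n%:R / p ->
  in_Kcal s p%:E r v ->
  forall eta, 0 < eta -> exists J : nat, forall j, (j <= - Posz J)%R -> ann_norm s p%:E v j <= eta.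
Proof.
move=> p1 r0 th0 [[mv _] Kv] eta e0; have p0 : 0 < p by lra.
have q1 : (1 <= p%:E)%E by rewrite lee_fin.
(* 64 is 8 times 8: a quasi-triangle inequality with factor 4 on two equal terms is applied twice,
   to v/2 and then to v = v/2 + v/2. *)
have e16 : 0 < eta / 64 by rewrite divr_gt0.
have [phi [[sm _] hphi]] := Kv _ e16.
have [cphi _] := sm [::].
pose z : X := [tuple of nseq n 0].
have [d d0 Hd] := cphi z 1 ltr01.
pose M := `|phi z| + 1; have M0 : 0 <= M by rewrite addr_ge0.
have zE y : enorm (tsub y z) = enorm y.
  rewrite /enorm; congr Num.sqrt; apply: eq_bigr => i _.
  by rewrite tnth_mktuple [tnth z i](tnth_nth 0) /z /= nth_nseq ltn_ord subr0.
have phiM x : enorm x < d -> `|phi x| <= M.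
  rewrite -zE => /Hd h; have := ler_normD (phi x - phi z) (phi z).
  by rewrite subrK => h2; move: h => /= h; rewrite /M; lra.
have [e1 e10 He1] : exists2 e1, 0 < e1 & forall L, 0 < L -> L <= e1 ->
   M * 2 `^ (n%:R / p) * L `^ (s + n%:R / p) <= eta / 64.
  pose C := M * 2 `^ (n%:R / p) + 1.
  have C0 : 0 < C by rewrite ltr_wpDl// mulr_ge0 ?powR_ge0.
  have h0 : 0 < eta / 64 / C by rewrite !divr_gt0.
  exists ((eta / 64 / C) `^ (s + n%:R / p)^-1); first exact: powR_gt0.
  move=> L L0 hL.
  have : L `^ (s + n%:R / p) <= eta / 64 / C.
    rewrite -[leRHS](powRr1 (ltW h0)) -[X in _ <= _ `^ X](mulVf (lt0r_neq0 th0)) powRrM.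
    by rewrite ge0_ler_powR ?nnegrE ?(ltW th0) ?(ltW L0) ?powR_ge0.
  rewrite ler_pdivlMr// => h; apply: le_trans h; rewrite mulrC ler_wpM2l ?powR_ge0//.
  by rewrite /C lerDl.
have [J HJ] : exists J : nat, forall j, (j <= - Posz J)%R -> (2 : R) ^ j <= Num.min d e1.
  pose m := Num.min d e1; have m0 : 0 < m by rewrite lt_min d0.
  exists (Num.truncn m^-1).+1 => j hj.
  apply: (@le_trans _ _ ((2 : R) ^ (- Posz (Num.truncn m^-1).+1))).
    by rewrite ler_eXz2l// ltr1n.
  rewrite -invr_expz -[leRHS]invrK lef_pV2 ?posrE ?exprz_gt0 ?invr_gt0//.
  apply: ltW; apply: lt_le_trans (truncnS_gt _) _.
  by rewrite -exprnP -natrX ler_nat ltnW// ltn_expl.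
exists J => j /HJ; rewrite le_min => /andP[jd je].
have L0 : 0 < (2 : R) ^ j by exact: exprz_gt0.
have hM := He1 _ L0 je.
(* Up to [v1], v/2 is bounded by M. Near the origin |phi| <= M, so |v| > 2M forces |v|/2 <= |v -
   phi|: [v1] is small because v - phi is. *)
pose v1 x := v x / 2 * \1_[set x | 2 * M < `|v x|] x.
have mB : measurable [set x : X | 2 * M < `|v x|].
  rewrite (_ : mkset _ = (fun x => `|v x|) @^-1` `]2 * M, +oo[); last first.
    by apply/seteqP; split => x /=; rewrite in_itv /= andbT.
  by rewrite -[X in measurable X]setTI; apply: (measurableT_comp _ mv).
have mv2 : measurable_fun setT (fun x => v x / 2) by exact: measurable_funM.
have mv1 : measurable_fun setT v1 by apply: measurable_funM => //; exact: measurable_indic.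
have b1 : ann_bound s p%:E v1 j (eta / 64).
  apply: Lq_bounded_norm => //.
  - exact: measurable_mul_annulus.
  - by rewrite mulr_ge0 ?powR_ge0 ?divr_ge0 ?(ltW e0).
  have hB0 : 0 <= eta / 64 by rewrite divr_ge0 ?(ltW e0).
  have := loc_norm_le_herz j q1 r0 hB0 (ltW hphi).
  rewrite /loc_norm powR_dyadic => h.
  apply: (@le_trans _ _ (Lqnorm p%:E (fun x => (v x - phi x) * \1_(annulus j) x))).
    rewrite /=; apply: (@gt0_ler_poweR R p^-1); rewrite ?invr_ge0 ?(ltW p0)//.
    - rewrite in_itv /= leey andbT; apply: le_trans (@iint_le_nonmeas n (fun=> 0%E) _ _).
        by rewrite iintE// integral0.
      by move=> x; rewrite lexx lee_fin powR_ge0.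
    - rewrite in_itv /= leey andbT; apply: le_trans (@iint_le_nonmeas n (fun=> 0%E) _ _).
        by rewrite iintE// integral0.
      by move=> x; rewrite lexx lee_fin powR_ge0.
    apply: iint_le_nonmeas => x; rewrite !lee_fin powR_ge0 /=.
    rewrite ge0_ler_powR ?nnegrE ?(ltW p0)// !indicE.
    have [/set_mem Ax|_] := boolP (x \in annulus j); last by rewrite !mulr0.
    rewrite /v1 indicE; have [/set_mem /= Bx|_] := boolP (_ \in _); last by rewrite !mulr0 mul0r normr0.
    rewrite !mulr1.
    have := phiM x; move: Ax => /= /andP[_ h2]; rewrite (lt_le_trans h2 jd) => /(_ isT) h3.
    have := ler_normD (v x - phi x) (phi x); rewrite subrK => h4.
    by rewrite normrM (ger0_norm (_ : 0 <= 2^-1)) ?invr_ge0//; lra.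
  have := L0 => /(powR_gt0 s) L0s; have L0s' : (0 <= ((((2 : R) ^ j) `^ s)^-1)%:E)%E.
    by rewrite lee_fin invr_ge0 ltW.
  rewrite powRN EFinM; apply: le_trans (lee_wpmul2l L0s' h).
  by rewrite muleA -EFinM mulVf ?gt_eqF// mul1e.
have b2 := const_ann_bound s j p0 M0.
have b3 : ann_bound s p%:E (fun x => v x / 2) j (4 * (eta / 64 + eta / 64)).
  apply: (ann_bound_add q1 _ _ _ _ _ _ b1 (Lq_bounded_le q1 _ (fun x => lexx _) b2)) => //.
  - by rewrite divr_ge0 ?(ltW e0).
  - by rewrite divr_ge0 ?(ltW e0).
  - move=> x; rewrite /v1 indicE /=.
    have [_|Bx] := boolP (_ \in _); first by rewrite mulr1 lerDl.
    rewrite mulr0 normr0 add0r (ger0_norm M0) normrM (ger0_norm (_ : 0 <= 2^-1)) ?invr_ge0//.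
    have : ~ (2 * M < `|v x|) by move=> h; move/negP: Bx; apply; exact: mem_set.
    by move=> /negP; rewrite -leNgt; lra.
  - by rewrite !mulr_ge0 ?powR_ge0//= ler_wpM2l ?powR_ge0.
have e80 : 0 <= 4 * (eta / 64 + eta / 64) by lra.
have b4 := ann_bound_add q1 e80 e80 mv mv2 mv2 _ b3 b3.
apply: le_trans (ann_norm_le_bound q1 mv _ (b4 _)) _; [lra| |lra].
by move=> x; rewrite normrM (ger0_norm (_ : 0 <= 2^-1)) ?invr_ge0//; lra.
Qed.

End herz_norms.

(* Paths are frozen outside [0, T], so that they are continuous on the whole line. *)
Definition clamp (R : realType) (T t : R) : R := Num.max 0 (Num.min t T).

Lemma clamp_itv (R : realType) (T t : R) : 0 <= T -> 0 <= clamp T t <= T.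
Proof. by move=> T0; rewrite /clamp le_max lexx /= ge_max T0 /= ge_min lexx orbT. Qed.

Lemma clamp_id (R : realType) (T t : R) : 0 <= t <= T -> clamp T t = t.
Proof. by move=> /andP[t0 tT]; rewrite /clamp min_l// max_r. Qed.

Lemma clamp_dist (R : realType) (T t t' : R) : `|clamp T t' - clamp T t| <= `|t' - t|.
Proof.
have k1 := ler_norm (t' - t); have := ler_norm (t - t'); rewrite distrC => k2.
have h : `|Num.min t' T - Num.min t T| <= `|t' - t|.
  by rewrite ler_norml; case: (leP t' T) => ?; case: (leP t T) => ?; apply/andP; split; lra.
apply: le_trans h; rewrite /clamp; move: (Num.min t' T) (Num.min t T) => {k1 k2}x y.
have k1 := ler_norm (x - y); have := ler_norm (y - x); rewrite distrC => k2.
by rewrite ler_norml; case: (leP 0 x) => ?; case: (leP 0 y) => ?; apply/andP; split; lra.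
Qed.

(** * Continuous paths in the Herz space and their Duhamel inequality *)

Section herz_paths.
Context (R : realType) (n : nat).
Hypothesis n0 : (0 < n)%N.
Local Notation X := (n.-tuple R).
Variables (s : R) (q r : \bar R) (T : R).
Hypothesis q1 : (1 <= q)%E.
Hypothesis r0 : (0 < r)%E.
Hypothesis T0 : 0 <= T.
Implicit Types (u v w : X -> R).

Lemma in_herz_bounded v : in_herz s q r v ->
  measurable_fun setT v /\ exists2 B : R, 0 <= B & (herz s q r v <= B%:E)%E.
Proof.
move=> [mv]; case: (herz s q r v) => [b| |]// _; split=> //.
  by exists (Num.max 0 b); [rewrite le_max lexx|rewrite lee_fin le_max lexx orbT].
by exists 0 => //; rewrite leNye.
Qed.

Lemma ann_norm_triangle u v w j : measurable_fun setT u -> in_herz s q r v -> in_herz s q r w ->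
  (forall x, `|u x| <= `|v x| + `|w x|) -> ann_norm s q u j <= 4 * (ann_norm s q v j + ann_norm s q w j).
Proof.
move=> mu /in_herz_bounded[mv [B B0 hv]] /in_herz_bounded[mw [C C0 hw]] uvw.
have V0 := ann_norm_ge0 s v j q1; have W0 := ann_norm_ge0 s w j q1.
apply: ann_norm_le_bound => //; first by apply: mulr_ge0 => //; exact: addr_ge0.
apply: (ann_bound_add q1 V0 W0 mu mv mw uvw).
- exact: (ann_bound_norm q1 r0 B0 hv).
- exact: (ann_bound_norm q1 r0 C0 hw).
Qed.

Section path.
Variable u : R -> X -> R.
Hypothesis cu : cont_Kcal s q r T u.

Local Notation N t := (ann_norm s q (u (clamp T t))).

Lemma cont_Kcal_in_herz t : 0 <= t <= T -> in_herz s q r (u t).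
Proof. by move=> ht; have [h _] := cu; have [] := h t ht. Qed.

Lemma cont_Kcal_measurable t : 0 <= t <= T -> measurable_fun setT (u t).
Proof. by move=> /cont_Kcal_in_herz[]. Qed.

Lemma ann_path_clamp : ann_path s q (fun t => u (clamp T t)) (fun t => N t).
Proof.
have cl t := clamp_itv t T0.
have mu t := cont_Kcal_measurable (cl t).
split=> [t|t j|t j|t j e e0]; [exact: mu|exact: ann_norm_ge0| |].
  have [m [B B0 h]] := in_herz_bounded (cont_Kcal_in_herz (cl t)).
  exact: (ann_bound_norm q1 r0 B0 h).
have [_ c] := cu; have [d d0 H] := c _ (cl t) e e0.
exists d => // t' tt'.
have {}H := H _ (cl t') (le_lt_trans (clamp_dist T t t') tt').
have md : measurable_fun setT (fun x => u (clamp T t') x - u (clamp T t) x).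
  exact: measurable_funB.
have b := ann_bound_norm q1 r0 (ltW e0) (ltW H) j md.
apply: Lq_bounded_le b => //.
rewrite mulr_ge0 ?powR_ge0 ?ann_norm_ge0//= ler_wpM2l ?powR_ge0//.
exact: (ann_norm_le q1 r0 (ltW e0) (ltW H)).
Qed.

Lemma path_power_le c t t0 j : 0 <= c -> 0 <= t <= T -> 0 <= t0 <= T ->
  in_herz s q r (fun x => u t x - u t0 x) ->
  ann_norm s q (u t) j `^ c <=
  8 `^ c * (ann_norm s q (fun x => u t x - u t0 x) j `^ c + ann_norm s q (u t0) j `^ c).
Proof.
move=> c0 ht ht0 hd.
have h : ann_norm s q (u t) j <= 4 * (ann_norm s q (fun x => u t x - u t0 x) j + ann_norm s q (u t0) j).
  apply: ann_norm_triangle => //; [exact: cont_Kcal_measurable|exact: cont_Kcal_in_herz|].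
  by move=> x; rewrite -{1}(subrK (u t0 x) (u t x)) ler_normD.
have X0 := ann_norm_ge0 s (fun x => u t x - u t0 x) j q1.
have Y0 := ann_norm_ge0 s (u t0) j q1; have Z0 := ann_norm_ge0 s (u t) j q1.
move: h X0 Y0 Z0; move: (ann_norm s q (fun _ => _ - _) j) (ann_norm s q (u t0) j) (ann_norm s q (u t) j) => x y z.
move=> h X0 Y0 Z0; have xy0 : 0 <= x + y by exact: addr_ge0.
apply: (@le_trans _ _ ((4 * (x + y)) `^ c)).
  by rewrite ge0_ler_powR ?nnegrE//; exact: mulr_ge0.
rewrite powRM//.
(* 4 comes from the quasi-triangle inequality, 2 from the power of a sum. *)
have -> : (8 : R) = 4 * 2 by ring.
rewrite [X in _ <= X * _]powRM// -mulrA ler_wpM2l ?powR_ge0//.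
exact: powR_add_le.
Qed.

Lemma cont_Kcal_diff t0 e : 0 <= t0 <= T -> 0 < e -> exists2 d, 0 < d &
  forall t, 0 <= t <= T -> `|t - t0| < d ->
    in_herz s q r (fun x => u t x - u t0 x) /\ (herz s q r (fun x => u t x - u t0 x)%R <= e%:E)%E.
Proof.
move=> ht0 e0; have [_ c] := cu; have [d d0 H] := c _ ht0 e e0.
exists d => // t ht htt; have {}H := H t ht htt; split; last exact: ltW.
split; last exact: lt_trans H (ltry _).
by apply: measurable_funB; exact: cont_Kcal_measurable.
Qed.

End path.

Lemma heat_fin_num t u x : measurable_fun setT u ->
  (iint (fun y => (`|heat_kernel t (tsub x y) * u y|)%:E) < +oo)%E ->
  heat t u x \is a fin_num.
Proof.
move=> mu h.
have mk : measurable_fun setT (fun y => heat_kernel t (tsub x y) * u y).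
  by apply: measurable_funM => //; exact: measurable_heat_kernel.
have ik : (lebn R n).-integrable setT (fun y => (heat_kernel t (tsub x y) * u y)%:E).
  apply/integrableP; split; first exact/measurable_EFinP.
  by rewrite -iintE//=; apply/measurable_EFinP; exact: measurableT_comp.
by rewrite /heat iint_integrable//; exact: integrable_fin_num.
Qed.

Section duhamel.
Variables (alpha gamma : R) (u0 : X -> R) (u1 u2 : R -> X -> R).
Hypothesis alpha1 : 1 < alpha.
Hypothesis alphaq : (alpha%:E <= q)%E.
Hypothesis mu0 : measurable_fun setT u0.
Hypothesis c1 : cont_Kcal s q r T u1.
Hypothesis c2 : cont_Kcal s q r T u2.
Hypothesis s1 : is_solution gamma alpha T u0 u1.
Hypothesis s2 : is_solution gamma alpha T u0 u2.
Local Notation v1 := (fun t => u1 (clamp T t)).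
Local Notation v2 := (fun t => u2 (clamp T t)).

(** Absolute convergence in the notion of solution makes the linear term and both time integrals
    finite, so that the linear term, common to both solutions, cancels. On [0, t] freezing the paths
    changes nothing. *)
Lemma solutions_dist_le t : 0 < t <= T ->
  {ae lebn R n, forall x, ((`|v1 t x - v2 t x|)%:E <=
    \int[@lebesgue_measure R]_(tau in `[0%R, t]) flow t (NLdiff alpha gamma v1 v2) tau x)%E}.
Proof.
move=> ht; have /andP[t0 tT] := ht.
have L1 := @L1loc_path_NL R n alpha gamma s q alpha1 alphaq q1 _ _ (ann_path_clamp c1).
have L2 := @L1loc_path_NL R n alpha gamma s q alpha1 alphaq q1 _ _ (ann_path_clamp c2).
have [_ h1] := s1; have [_ h2] := s2.
have /ae_rnP a1 := h1 t ht; have /ae_rnP a2 := h2 t ht.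
apply: filterS2 a1 a2 => x [f0 [f1 e1]] [_ [f2 e2]].
have cE tau : tau \in `[0, t]%classic -> clamp T tau = tau.
  move=> /set_mem /=; rewrite in_itv /= => /andP[k1 k2].
  by apply: clamp_id; rewrite k1 (le_trans k2).
have [||i1 i2 D] := duhamel_dist_le n0 (t := t) (x := x) L1 L2.
- by apply: le_lt_trans f1; rewrite le_eqVlt; apply/orP; left; apply/eqP;
    apply: eq_integral => tau /cE ->.
- by apply: le_lt_trans f2; rewrite le_eqVlt; apply/orP; left; apply/eqP;
    apply: eq_integral => tau /cE ->.
apply: le_trans D; rewrite /= clamp_id ?(ltW t0)//.
have E1 : (\int[@lebesgue_measure R]_(tau in `[0%R, t])
    heat (t - tau) (NL gamma alpha (u1 (clamp T tau))) x =
   \int[@lebesgue_measure R]_(tau in `[0%R, t]) heat (t - tau) (NL gamma alpha (u1 tau)) x)%E.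
  by apply: eq_integral => tau /cE ->.
have E2 : (\int[@lebesgue_measure R]_(tau in `[0%R, t])
    heat (t - tau) (NL gamma alpha (u2 (clamp T tau))) x =
   \int[@lebesgue_measure R]_(tau in `[0%R, t]) heat (t - tau) (NL gamma alpha (u2 tau)) x)%E.
  by apply: eq_integral => tau /cE ->.
move: i1 i2; rewrite E1 E2 => i1 i2.
have i0 := heat_fin_num mu0 f0.
rewrite -abse_EFin EFinB e1 e2 le_eqVlt; apply/orP; left; apply/eqP; congr abse.
move: i0 i1 i2; move: (heat t u0 x) (integral _ _ _) (integral _ _ _).
by move=> [a| |] [b| |] [c| |]// _ _ _; rewrite /adde /=; congr EFin; ring.
Qed.

Lemma solutions_initial : {ae lebn R n, forall x, v1 0 x = v2 0 x}.
Proof.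
have [/ae_rnP h1 _] := s1; have [/ae_rnP h2 _] := s2.
apply: filterS2 h1 h2 => x e1 e2; rewrite clamp_id ?lexx//.
by rewrite e1 e2.
Qed.

End duhamel.

End herz_paths.

Lemma le_time_small (R : realType) (eps d d' L : R) : 0 <= eps -> 0 <= d <= d' ->
  time_small eps d L <= time_small eps d' L.
Proof.
move=> e0 /andP[d0 dd]; rewrite /time_small le_min !ge_min lexx /=.
have L0 : 0 <= (L ^+ 2)^-1 by rewrite invr_ge0 sqr_ge0.
apply/orP; right; rewrite ge0_ler_powR ?nnegrE ?mulr_ge0//; first exact: le_trans dd.
by rewrite ler_wpM2r.
Qed.

Lemma time_small_le_scale (R : realType) (eps eta l : R) : 0 < eps -> 0 < eta -> 0 < l ->
  exists2 d, 0 < d & forall L, l <= L -> time_small eps d L <= eta.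
Proof.
move=> e0 h0 l0; have k0 : 0 < eta `^ eps^-1 by exact: powR_gt0.
exists (l ^+ 2 * eta `^ eps^-1) => [|L lL]; first by rewrite mulr_gt0 ?exprn_gt0.
have L0 : 0 < L by exact: lt_le_trans lL.
rewrite /time_small ge_min; apply/orP; right.
apply: (@le_trans _ _ ((eta `^ eps^-1) `^ eps)); last first.
  by rewrite -powRrM mulVf ?gt_eqF// powRr1// ltW.
have d0 : 0 <= l ^+ 2 * eta `^ eps^-1 by rewrite mulr_ge0 ?sqr_ge0 ?powR_ge0.
rewrite ge0_ler_powR ?nnegrE ?(ltW e0) ?(ltW k0)//; first by rewrite divr_ge0 ?sqr_ge0.
rewrite ler_pdivrMr ?exprn_gt0// mulrC ler_wpM2l ?(ltW k0)//.
by rewrite lerXn2r ?nnegrE ?(ltW l0) ?(ltW L0).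
Qed.

(** * Uniqueness for an abstract size functional *)

Section uniqueness.
Context (R : realType) (n : nat).
Hypothesis n0 : (0 < n)%N.
Local Notation X := (n.-tuple R).
Variables (alpha gamma s : R) (q r : \bar R) (mu T : R).
Hypothesis alpha1 : 1 < alpha.
Hypothesis alphaq : (alpha%:E <= q)%E.
Hypothesis q1 : (1 <= q)%E.
Hypothesis r0 : (0 < r)%E.
Hypothesis T0 : 0 <= T.
Local Notation c := (alpha - 1).
Hypothesis crit : c * (s + n%:R * qinv q) = 2 + gamma.
Local Notation a := (c * (n%:R * qinv q) / 2).
Local Notation beta := (gamma + n%:R - alpha * (s + n%:R * qinv q)).
Hypothesis a0 : 0 <= a.
Hypothesis a1 : a < 1.
Hypothesis mu0 : 0 <= mu.
Hypothesis nu1 : 1 < n%:R / 2 - mu.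
(* [Q e M] stands for [sup_j e j <= M] when [r = oo] and for [sum_j e j <= M]
   when [r <= alpha - 1]. *)
Variables (Q : (int -> R) -> R -> Prop) (K : R).
Hypothesis K0 : 0 < K.
Hypothesis Q_bump : forall (g : X -> R) (e : int -> R) M, measurable_fun setT g ->
  (forall x, 0 <= g x) -> 0 <= M ->
  (forall j, \int[lebn R n]_(x in annulus j) (g x)%:E <= (e j * ((2 : R) ^ j) `^ beta)%:E)%E ->
  Q e M ->
  forall i, (\int[lebn R n]_x (bump mu ((2 : R) ^ i) x * g x)%:E <=
    (K * M * ((2 : R) ^ i) `^ beta)%:E)%E.
Hypothesis Q_scale : forall (k : R) e M, 0 <= k -> Q e M -> Q (fun j => k * e j) (k * M).
Hypothesis Q_add : forall e e' M M', Q e M -> Q e' M' -> Q (fun j => e j + e' j) (M + M').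
Hypothesis Q_le : forall e e' M M', (forall j, e j <= e' j) -> M' <= M -> Q e' M' -> Q e M.
Hypothesis Q_herz : forall (v : X -> R) p B, c <= p -> 0 <= B -> (herz s q r v <= B%:E)%E ->
  Q (fun j => ann_norm s q v j `^ p) (B `^ p).
Hypothesis Q_tail : forall (v : X -> R) eps eta, in_Kcal s q r v -> 0 < eps -> 0 < eta ->
  exists2 d, 0 < d & Q (fun j => ann_norm s q v j `^ c * time_small eps d (2 ^ j)) eta.
Variables (u0 : X -> R) (u1 u2 : R -> X -> R).
Hypothesis mu_u0 : measurable_fun setT u0.
Hypothesis c1 : cont_Kcal s q r T u1.
Hypothesis c2 : cont_Kcal s q r T u2.
Hypothesis s1 : is_solution gamma alpha T u0 u1.
Hypothesis s2 : is_solution gamma alpha T u0 u2.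
Local Notation v1 := (fun t => u1 (clamp T t)).
Local Notation v2 := (fun t => u2 (clamp T t)).
Local Notation N1 := (fun t => ann_norm s q (v1 t)).
Local Notation N2 := (fun t => ann_norm s q (v2 t)).

Let c0 : 0 < c. Proof. by rewrite subr_gt0. Qed.
Let alpha0 : 0 < alpha. Proof. exact: lt_trans ltr01 alpha1. Qed.
Local Notation eps := ((1 - a) / 2).
Let eps0 : 0 < eps. Proof. by rewrite divr_gt0// subr_gt0. Qed.

(** u(t) is u(t0) plus a difference that is small in the Herz norm; for u(t0) the smallness comes
    from [Q_tail]. The conclusion for every d' <= d lets the two solutions share one duration. *)
Lemma path_small (u : R -> X -> R) t0 eta : cont_Kcal s q r T u -> 0 <= t0 <= T -> 0 < eta ->
  exists2 d, 0 < d & forall d', 0 < d' <= d -> forall t, t0 <= t <= T -> t < t0 + d' ->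
    Q (fun j => ann_norm s q (u t) j `^ c * time_small eps d' (2 ^ j)) eta.
Proof.
move=> cu ht0 eta0; pose k : R := 8 `^ c; have k0 : 0 < k by exact: powR_gt0.
(* Two pieces of size h, each multiplied by the constant k of [path_power_le]; below, e is such that
   e^c = h. *)
pose h := eta / (2 * k); have h0 : 0 < h by rewrite divr_gt0// mulr_gt0.
have [uK _] := cu; have [d1 d10 Q1] := Q_tail (uK _ ht0) eps0 h0.
pose e := h `^ c^-1; have e0 : 0 < e by exact: powR_gt0.
have [d2 d20 H2] := cont_Kcal_diff cu ht0 e0.
exists (Num.min d1 d2); first by rewrite lt_min d10.
move=> d' /andP[d'0]; rewrite le_min => /andP[dd1 dd2] t /andP[t0t tT] tt.
have /andP[t00 _] := ht0.
have ht : 0 <= t <= T by rewrite tT (le_trans t00).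
have [hd he] : in_herz s q r (fun x => u t x - u t0 x) /\
    (herz s q r (fun x => u t x - u t0 x)%R <= e%:E)%E.
  by apply: H2 => //; rewrite ger0_norm ?subr_ge0//; lra.
have Q2 := Q_herz (lexx c) (ltW e0) he.
have eE : e `^ c = h by rewrite /e -powRrM mulVf ?gt_eqF// powRr1// ltW.
rewrite eE in Q2.
apply: (Q_le _ _ (Q_scale (ltW k0) (Q_add Q2 Q1))); last first.
  by rewrite /h le_eqVlt; apply/orP; left; apply/eqP; field; rewrite gt_eqF.
move=> j /=; have hj := path_power_le q1 r0 cu j (ltW c0) ht ht0 hd.
apply: (@le_trans _ _ (k * (ann_norm s q (fun x => u t x - u t0 x) j `^ c + ann_norm s q (u t0) j `^ c) *
    time_small eps d' (2 ^ j))).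
  by rewrite ler_wpM2r ?time_small_ge0.
rewrite -mulrA ler_wpM2l ?(ltW k0)// mulrDl lerD//.
  by rewrite ler_piMr ?powR_ge0// time_small_le1.
by rewrite ler_wpM2l ?powR_ge0// le_time_small ?(ltW eps0) ?(ltW d'0).
Qed.

(** Feeds the a priori bound of the contraction, where the nonlinearity itself, of degree alpha, has
    to be bounded. *)
Lemma path_bounded (u : R -> X -> R) t0 : cont_Kcal s q r T u -> 0 <= t0 <= T ->
  exists2 d, 0 < d & exists2 A, 0 <= A & forall t, t0 <= t <= T -> t < t0 + d ->
    Q (fun j => ann_norm s q (u t) j `^ alpha) A.
Proof.
move=> cu ht0; pose k : R := 8 `^ alpha; have k0 : 0 < k by exact: powR_gt0.
have [_ [B B0 hB]] := in_herz_bounded (cont_Kcal_in_herz cu ht0).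
have ca : c <= alpha by rewrite lerBlDr lerDl.
have Q1 := Q_herz ca B0 hB.
have [d d0 H] := cont_Kcal_diff cu ht0 (@ltr01 R).
exists d => //; exists (k * (1 `^ alpha + B `^ alpha)).
  by apply: mulr_ge0; [exact: ltW|apply: addr_ge0; exact: powR_ge0].
move=> t /andP[t0t tT] tt; have /andP[t00 _] := ht0.
have ht : 0 <= t <= T by rewrite tT (le_trans t00).
have [hd he] : in_herz s q r (fun x => u t x - u t0 x) /\
    (herz s q r (fun x => u t x - u t0 x)%R <= 1%:E)%E.
  by apply: H => //; rewrite ger0_norm ?subr_ge0//; lra.
have Q2 := Q_herz ca ler01 he.
apply: (Q_le _ (lexx _) (Q_scale (ltW k0) (Q_add Q2 Q1))) => j.
exact: (path_power_le q1 r0 cu j (ltW alpha0) ht ht0 hd).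
Qed.

Lemma admissible_uniqueness t : 0 <= t <= T -> {ae lebn R n, forall x, u1 t x = u2 t x}.
Proof.
have P1 := ann_path_clamp q1 r0 T0 c1; have P2 := ann_path_clamp q1 r0 T0 c2.
move=> ht; have : {ae lebn R n, forall x, v1 t x = v2 t x}; last by rewrite !clamp_id.
have inT t0 t' : 0 <= t0 <= T -> t0 <= t' <= T -> 0 <= t' <= T.
  by move=> /andP[h1 _] /andP[h2 ->]; rewrite (le_trans h1).
have := @critical_uniqueness R n n0 alpha gamma s q mu T alpha1 alphaq q1 crit a0 a1 mu0 nu1
  _ _ _ _ P1 P2 (solutions_dist_le n0 q1 r0 T0 alpha1 alphaq mu_u0 c1 c2 s1 s2) Q K K0 Q_bump Q_scale.
apply => //; last exact: solutions_initial s1 s2.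
(* The a priori bound uses no cancellation: the difference is at most |x|^gamma (|u1|^alpha +
   |u2|^alpha). *)
- move=> t0 ht0.
  have [d1 d10 [A1 A10 H1]] := path_bounded c1 ht0.
  have [d2 d20 [A2 A20 H2]] := path_bounded c2 ht0.
  have [C C0 HC] := @annulus_power_le R n gamma alpha alpha0.
  exists (Num.min d1 d2); first by rewrite lt_min d10.
  exists (K * (C * (A1 + A2))).
    by apply: mulr_ge0; [exact: ltW|apply: mulr_ge0; [exact: ltW|exact: addr_ge0]].
  move=> t' ht'; rewrite addr_minr lt_min => /andP[h1 h2] i.
  have ht'T := inT _ _ ht0 ht'.
  have Qe := Q_scale (ltW C0) (Q_add (H1 _ ht' h1) (H2 _ ht' h2)).
  apply: (Q_bump _ _ _ _ Qe); first by have [] := @L1loc_path_NLdiff R n alpha gamma s q alpha1 alphaq q1 _ _ _ _ P1 P2.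
  + by move=> x; exact: normr_ge0.
  + by apply: mulr_ge0; [exact: ltW|exact: addr_ge0].
  move=> j; pose G (v : X -> R) (x : X) : R := enorm x `^ gamma * `|v x| `^ alpha.
  have mG v : measurable_fun setT v -> measurable_fun setT (G v).
    move=> mv; apply: measurable_funM; last exact: measurable_normr_powR.
    apply: (@measurableT_comp _ _ _ _ _ _ (fun t : R => t `^ gamma)); first exact: measurable_powR.
    exact: measurable_enorm.
  have mA := @measurable_annulus R n j.
  have [m1 N10 b1 _] := P1; have [m2 N20 b2 _] := P2.
  have g1 := HC q (v1 t') _ s j (m1 t') (N10 t' j) alphaq (b1 t' j).
  have g2 := HC q (v2 t') _ s j (m2 t') (N20 t' j) alphaq (b2 t' j).
  have NLE (v : X -> R) x : `|NL gamma alpha v x| = G v x.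
    rewrite /NL normrM ger0_norm ?powR_ge0// normrM ger0_norm ?powR_ge0//.
    by rewrite powR_succ ?subrK.
  set M1 := C * _ * _ in g1; set M2 := C * _ * _ in g2.
  apply: (@le_trans _ _ (1 * M1 + 1 * M2)%:E); last first.
    rewrite lee_fin le_eqVlt; apply/orP; left; apply/eqP.
    rewrite /M1 /M2 (clamp_id ht'T).
    move: (ann_norm s q (u1 t') j `^ alpha) (ann_norm s q (u2 t') j `^ alpha) => x y.
    by move: (((2 : R) ^ j) `^ beta) => z; clear; ring.
  move: g1 g2; move: M1 M2 => M1 M2 g1 g2.
  have G0 v x : 0 <= G v x by rewrite /G mulr_ge0 ?powR_ge0.
  have dG x : NLdiff alpha gamma v1 v2 t' x <= 1 * G (v1 t') x + 1 * G (v2 t') x.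
    by rewrite !mul1r -!NLE /NLdiff ler_normB.
  apply: (@ge0_integral_le_add _ _ _ _ _ (G (v1 t')) (G (v2 t'))) => //.
  + by apply: measurable_funTS; exact: mG.
  + by apply: measurable_funTS; exact: mG.
  + by move=> x _; exact: normr_ge0.
- move=> t0 eta ht0 eta0; have e20 : 0 < eta / 2 by rewrite divr_gt0.
  have [d1 d10 H1] := path_small c1 ht0 e20.
  have [d2 d20 H2] := path_small c2 ht0 e20.
  have d0 : 0 < Num.min d1 d2 by rewrite lt_min d10.
  exists (Num.min d1 d2) => // t' ht' h.
  have ht'T := inT _ _ ht0 ht'.
  have Q1 := H1 (Num.min d1 d2); have Q2 := H2 (Num.min d1 d2).
  rewrite d0 !ge_min !lexx orbT /= in Q1 Q2.
  apply: (Q_le _ _ (Q_add (Q1 isT _ ht' h) (Q2 isT _ ht' h))); last lra.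
  by move=> j; rewrite !clamp_id// mulrDl.
Qed.

End uniqueness.

(** * The two size functionals: supremum and sum *)

Section admissible_functionals.
Context (R : realType).
Implicit Types (e : int -> R) (k M : R).

Lemma sup_le_scale k e M : 0 <= k -> sup_le e M -> sup_le (fun j => k * e j) (k * M).
Proof. by move=> k0 h j; rewrite ler_wpM2l. Qed.

Lemma sup_le_add e e' M M' : sup_le e M -> sup_le e' M' ->
  sup_le (fun j => e j + e' j) (M + M').
Proof. by move=> h h' j; rewrite lerD. Qed.

Lemma sup_le_le e e' M M' : (forall j, e j <= e' j) -> M' <= M -> sup_le e' M' -> sup_le e M.
Proof. by move=> h MM h' j; apply: le_trans (h j) (le_trans (h' j) MM). Qed.

Lemma sum_le_scale k e M : 0 <= k -> sum_le e M -> sum_le (fun j => k * e j) (k * M).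
Proof. by move=> k0 h j; rewrite zsumZ ler_wpM2l. Qed.

Lemma sum_le_add e e' M M' : sum_le e M -> sum_le e' M' ->
  sum_le (fun j => e j + e' j) (M + M').
Proof. by move=> h h' j; rewrite zsumD lerD. Qed.

Lemma sum_le_le e e' M M' : (forall j, e j <= e' j) -> M' <= M -> sum_le e' M' -> sum_le e M.
Proof. by move=> h MM h' j; apply: le_trans (ler_zsum j h) (le_trans (h' j) MM). Qed.

Lemma int_ge_dyadic (J : nat) (j : int) : (- Posz J <= j)%R -> (2 : R) ^ (- Posz J) <= 2 ^ j.
Proof. by move=> h; rewrite ler_eXz2l// ltr1n. Qed.

(** [time_small] gains nothing at the scales 2^j -> 0. Convergence of the series leaves less than
    eta/2 outside -K0 <= j < K0; inside, all scales are at least 2^(-K0), where a small d gains the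
    factor (eta/2)/(M + 1). *)
Lemma sum_le_tail e M eps eta : (forall j, 0 <= e j) -> sum_le e M -> 0 < eps -> 0 < eta ->
  exists2 d, 0 < d & sum_le (fun j => e j * time_small eps d (2 ^ j)) eta.
Proof.
move=> e0 eM eps0 eta0.
have M0 : 0 <= M by apply: le_trans (eM 0%N); exact: zsum_ge0.
have hS : has_sup (range (zsum e)).
  by split; [exists (zsum e 0%N); exists 0%N|exists M => _ [K _ <-]].
pose S := sup (range (zsum e)).
have leS K : zsum e K <= S by apply: (sup_upper_bound hS); exists K.
have e20 : 0 < eta / 2 by rewrite divr_gt0.
have [_ [K0 _ <-] hK0] := sup_adherent e20 hS.
have h0 : 0 < eta / 2 / (M + 1) by rewrite divr_gt0// ltr_wpDl.
have l0 : 0 < (2 : R) ^ (- Posz K0) by exact: exprz_gt0.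
have [d d0 Hd] := time_small_le_scale eps0 h0 l0.
exists d => // K; pose f j := e j * time_small eps d (2 ^ j); rewrite -/f.
have f0 j : 0 <= f j by rewrite mulr_ge0 ?time_small_ge0.
have fe j : f j <= e j by rewrite ler_piMr ?time_small_le1.
have ef0 j : 0 <= e j - f j by rewrite subr_ge0.
have hf : zsum f K0 <= eta / 2.
  apply: (@le_trans _ _ (eta / 2 / (M + 1) * zsum e K0)).
    rewrite -zsumZ /zsum; apply: ler_sum => k _.
    have hk j : (- Posz K0 <= j)%R -> f j <= eta / 2 / (M + 1) * e j.
      by move=> /int_ge_dyadic hj; rewrite /f mulrC ler_wpM2r// Hd.
    apply: lerD; apply: hk.
      by apply: (@le_trans _ _ (0 : int)); rewrite ?oppr_le0.
    by rewrite NegzE lerN2 lez_nat ltn_ord.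
  rewrite -[leRHS](divfK (x := M + 1)) ?gt_eqF ?ltr_wpDl//.
  by rewrite ler_wpM2l ?(ltW h0)//; apply: le_trans (eM K0) _; rewrite lerDl.
(* The range is enlarged so as to contain the core -K0 <= j < K0. *)
apply: (@le_trans _ _ (zsum f (K0 + K))); first by apply: zsum_nondecreasing => //; exact: leq_addl.
have split_zsum K' : zsum (fun j => e j - f j) K' = zsum e K' - zsum f K'.
  have -> : (fun j => e j - f j) = (fun j => e j + -1 * f j) by apply/funext => j; ring.
  by rewrite zsumD (zsumZ (-1)) mulN1r.
have := zsum_nondecreasing ef0 (leq_addr K K0); rewrite !split_zsum => h.
have h2 := leS (K0 + K)%N; move: hK0; rewrite -/S => h3.
by move: h h2 h3 hf; move: (zsum f _) (zsum f _) (zsum e _) (zsum e _) => w x y z; lra.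
Qed.

Section herz.
Context (n : nat) (s : R) (q r : \bar R).
Hypothesis q1 : (1 <= q)%E.
Hypothesis r0 : (0 < r)%E.
Implicit Types v : n.-tuple R -> R.

Lemma sup_le_herz v p B : 0 <= p -> 0 <= B -> (herz s q r v <= B%:E)%E ->
  sup_le (fun j => ann_norm s q v j `^ p) (B `^ p).
Proof.
move=> p0 B0 h j; rewrite ge0_ler_powR ?nnegrE ?ann_norm_ge0//.
exact: (ann_norm_le q1 r0 B0 h).
Qed.

Lemma sum_le_herz v p B : 0 < p -> (r <= p%:E)%E -> 0 <= B -> (herz s q r v <= B%:E)%E ->
  sum_le (fun j => ann_norm s q v j `^ p) (B `^ p).
Proof. by move=> p0 rp B0 h K; exact: (zsum_ann_norm_le q1 r0 B0 h). Qed.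

Lemma sum_le_herz_tail v c eps eta : 0 < c -> (r <= c%:E)%E -> in_Kcal s q r v ->
  0 < eps -> 0 < eta ->
  exists2 d, 0 < d & sum_le (fun j => ann_norm s q v j `^ c * time_small eps d (2 ^ j)) eta.
Proof.
move=> c0 rc [/in_herz_bounded[_ [B B0 hB]] _] eps0 eta0.
apply: (sum_le_tail _ (sum_le_herz c0 rc B0 hB)) => // j; exact: powR_ge0.
Qed.

End herz.

(** A bounded sequence need not have a small tail, so the scales up to 2^(-J) are handled by the
    vanishing of [v] at the origin, and the others by a small d. *)
Lemma sup_le_herz_tail n s q r (v : n.-tuple R -> R) c eps eta : (1 <= q)%E -> q != +oo%E ->
  (0 < r)%E -> 0 < s + n%:R * qinv q -> 0 < c -> in_Kcal s q r v -> 0 < eps -> 0 < eta ->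
  exists2 d, 0 < d & sup_le (fun j => ann_norm s q v j `^ c * time_small eps d (2 ^ j)) eta.
Proof.
case: q => [p| |]// q1 _ r0 th0 c0 hv eps0 eta0; have p1 : 1 <= p by rewrite -lee_fin.
have [/in_herz_bounded[_ [B B0 hB]] _] := hv.
have [J HJ] := Kcal_vanishing p1 r0 th0 hv (powR_gt0 c^-1 eta0).
pose b : R := B `^ c; have b0 : 0 <= b by exact: powR_ge0.
have h0 : 0 < eta / (b + 1) by rewrite divr_gt0// ltr_wpDl.
have l0 : 0 < (2 : R) ^ (- Posz J) by exact: exprz_gt0.
have [d d0 Hd] := time_small_le_scale eps0 h0 l0.
exists d => // j; have t0 := time_small_ge0 eps d ((2 : R) ^ j).
have [jJ|Jj] := leP j (- Posz J).
  apply: (@le_trans _ _ (ann_norm s p%:E v j `^ c)); first by rewrite ler_piMr ?powR_ge0 ?time_small_le1.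
  rewrite -[leRHS](powRr1 (ltW eta0)) -[X in _ <= _ `^ X](mulVf (lt0r_neq0 c0)) powRrM.
  by rewrite ge0_ler_powR ?nnegrE ?ann_norm_ge0 ?powR_ge0 ?(ltW c0)// HJ.
have /Hd ht := int_ge_dyadic (ltW Jj).
have hU := sup_le_herz q1 r0 (ltW c0) B0 hB j.
apply: (@le_trans _ _ ((b + 1) * (eta / (b + 1)))).
  by apply: ler_pM => //; [exact: powR_ge0|apply: le_trans hU _; rewrite lerDl].
by rewrite mulrC divfK// gt_eqF// ltr_wpDl.
Qed.

End admissible_functionals.

(** * The two critical cases *)

Theorem theorem1p2 (R : realType) (n : nat) (gamma alpha s : R) (q r : \bar R) (T : R) :
  (3 <= n)%N -> 1 < alpha -> (1 <= q)%E -> (0 < r)%E -> 0 < T ->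
  - Num.min 2 n%:R < gamma ->
  Num.max 1 (1 + gamma / n%:R) <= alpha ->
  gamma / (alpha - 1) < s -> s <= n%:R ->
  (alpha%:E <= q)%E ->
  0 < s / n%:R + qinv q ->
  (s / n%:R + qinv q < 1 \/ (s / n%:R + qinv q = 1 /\ (r <= 1)%E)) ->
  ((s / n%:R + qinv q = ((n%:R * (alpha - 1)) / (2 + gamma))^-1 /\
    ((n%:R * (alpha - 1)) / (2 + gamma))^-1 < ((n%:R * alpha) / (n%:R + gamma))^-1 /\
    q != +oo%E /\ r = +oo%E)
   \/
   (s / n%:R + qinv q = ((n%:R * (alpha - 1)) / (2 + gamma))^-1 /\
    ((n%:R * (alpha - 1)) / (2 + gamma))^-1 = ((n%:R * alpha) / (n%:R + gamma))^-1 /\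
    ((q != +oo%E /\ (r <= (alpha - 1)%:E)%E) \/ (r <= (Num.min 1 (alpha - 1))%:E)%E))) ->
  forall u0 : n.-tuple R -> R, in_Kcal s q r u0 ->
  forall u1 u2 : R -> n.-tuple R -> R,
    cont_Kcal s q r T u1 -> cont_Kcal s q r T u2 ->
    is_solution gamma alpha T u0 u1 -> is_solution gamma alpha T u0 u2 ->
    forall t, 0 <= t <= T -> ae_rn (fun x => u1 t x = u2 t x).
Proof.
move=> n3 alpha1 q1 r0 T0 hgamma _ hs _ alphaq th0 _ hcase u0 [[mu_u0 _] _] u1 u2 c1 c2 s1 s2 t ht.
apply/ae_rnP.
have n0 : (0 < n)%N by exact: leq_trans n3.
have N3 : 3 <= n%:R :> R by rewrite ler_nat.
have N0 : 0 < n%:R :> R by rewrite ltr0n.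
have c0 : 0 < alpha - 1 by rewrite subr_gt0.
have alpha0 : 0 < alpha by lra.
have g2 : - 2 < gamma by move: hgamma; rewrite min_l//; lra.
have g20 : 0 < 2 + gamma by lra.
have ng0 : 0 < n%:R + gamma by lra.
pose th := s + n%:R * qinv q.
have thE : s / n%:R + qinv q = th / n%:R by rewrite /th mulrDl mulrAC divff ?mul1r// gt_eqF.
rewrite thE pmulr_lgt0 ?invr_gt0// in th0.
have invq (b d : R) : (n%:R * b / d)^-1 = d / b / n%:R by rewrite invf_div invfM mulrA mulrAC.
have crit0 : s / n%:R + qinv q = ((n%:R * (alpha - 1)) / (2 + gamma))^-1 ->
    (alpha - 1) * th = 2 + gamma.
  rewrite thE invq => /(mulIf (lt0r_neq0 (_ : 0 < n%:R^-1))) ->; last by rewrite invr_gt0.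
  by rewrite mulrC divfK// gt_eqF.
have qi0 : 0 <= qinv q by move: q1; case: (q) => [p| |]//=; rewrite lee_fin invr_ge0; lra.
have crit : (alpha - 1) * th = 2 + gamma by case: hcase => -[/crit0].
have a0 : 0 <= (alpha - 1) * (n%:R * qinv q) / 2.
  by rewrite divr_ge0// mulr_ge0 ?(ltW c0)// mulr_ge0.
(* Criticality reads (alpha - 1) n/q = 2 + gamma - s (alpha - 1), and gamma < s (alpha - 1). *)
have a1 : (alpha - 1) * (n%:R * qinv q) / 2 < 1.
  have : gamma < s * (alpha - 1) by rewrite -ltr_pdivrMr.
  move: crit; rewrite /th mulrDr => h1 h2.
  by rewrite ltr_pdivrMr// mul1r; move: h1; rewrite mulrC; lra.
pose beta := gamma + n%:R - alpha * th.
have betaE : beta = n%:R - 2 - th.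
  have -> : beta = gamma + n%:R - ((alpha - 1) * th + th) by rewrite /beta; ring.
  by rewrite crit; ring.
(* Case (ii): the sum functional, with mu = 0 and K = 1; the condition on nu is n/2 > 1. *)
have th_small : beta = 0 -> (r <= (alpha - 1)%:E)%E -> {ae lebn R n, forall x, u1 t x = u2 t x}.
  move=> b0 rc.
  apply: (@admissible_uniqueness R n n0 alpha gamma s q r 0 T alpha1 alphaq q1 r0 (ltW T0) crit
    a0 a1 (lexx 0) _ (@sum_le R) 1 ltr01 _ _ _ _ _ _ u0) => //.
  - by rewrite subr0 ltr_pdivlMr//; lra.
  - by move=> g e M mg g0 _; rewrite -/th -/beta b0; exact: annuli_sum_bump.
  - exact: sum_le_scale.
  - exact: sum_le_add.
  - exact: sum_le_le.
  - move=> v p B cp; apply: sum_le_herz => //; first exact: lt_le_trans cp.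
    by apply: le_trans rc _; rewrite lee_fin.
  - by move=> v eps eta; exact: sum_le_herz_tail.
case: hcase => -[_ [hQ h]].
- have [qf _] := h.
  (* 1/q_c < 1/Q_c says th < (n + gamma)/alpha. *)
  have beta0 : 0 < beta.
    move: hQ; rewrite !invq -crit ltr_pM2r ?invr_gt0// mulrAC divff ?gt_eqF// mul1r.
    by rewrite ltr_pdivlMr// /beta subr_gt0 mulrC addrC.
  (* 2 mu is the midpoint of beta and n - 2, with beta < n - 2 as th > 0; this gives both beta < 2
     mu and n/2 - mu > 1. *)
  pose mu := (beta + (n%:R - 2)) / 4.
  have bm : beta < 2 * mu by rewrite /mu; move: betaE beta0; lra.
  have mu0 : 0 <= mu by lra.
  have nu1 : 1 < n%:R / 2 - mu by rewrite /mu; move: betaE; lra.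
  have [K K0 HK] := @annuli_sup_bump R n n0 mu beta beta0 bm.
  apply: (@admissible_uniqueness R n n0 alpha gamma s q r mu T alpha1 alphaq q1 r0 (ltW T0) crit
    a0 a1 mu0 nu1 (@sup_le R) K K0 HK _ _ _ _ _ u0) => //.
  - exact: sup_le_scale.
  - exact: sup_le_add.
  - exact: sup_le_le.
  - by move=> v p B cp; apply: sup_le_herz => //; apply: ltW; exact: lt_le_trans cp.
  - by move=> v eps eta; exact: sup_le_herz_tail.
- apply: th_small.
    move: hQ; rewrite !invq -crit => /(mulIf (lt0r_neq0 (_ : 0 < n%:R^-1))).
    rewrite invr_gt0 mulrAC divff ?gt_eqF// mul1r => /(_ N0) hth.
    by rewrite /beta hth [alpha * _]mulrC divfK ?gt_eqF// [gamma + _]addrC subrr.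
  (* Both alternatives give r <= alpha - 1. *)
  case: h => [[]//|rm]; apply: le_trans rm _.
  by rewrite lee_fin ge_min lexx orbT.
Qed.
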